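(* Let $n$ be a positive integer, $\vartheta_n=\pi/(2n)$ and $L_n=2\pi/\sin\vartheta_n$. Every rectifiable simple closed curve $\mathcal{C}\subset\mathbb{S}^2$ of length $L\le L_n$ satisfies $$\mathcal{J}(\mathcal{C})\ \ge\ j(L_n)=\frac{\pi}{2n}-\tan\frac{\pi}{4n},$$ and every such curve attaining equality has length exactly $L_n$. Equality holds for the curves $\beta^{n,k}$ with $0\le k<n$ and $\gcd(k,n)=1$. These have length $L_n$, so in particular $J(L_n)=j(L_n)$. At $L_3=4\pi$ the minimum is $\pi/6+\sqrt{3}-2$, attained by $\beta^{3,1}$, which is the six-arc curve parametrized by the map $\gamma$ given in the context, and by its mirror image $\beta^{3,2}$.
   Context: $\mathbb{S}^2$ is the unit sphere in $\mathbb{R}^3$ with area element $dA$; $\operatorname{dist}(x,\mathcal{C})=\min_{y\in\mathcal{C}}\arccos\langle x,y\rangle$; $$\mathcal{J}(\mathcal{C})=\frac{1}{4\pi}\int_{\mathbb{S}^2}\operatorname{dist}(x,\mathcal{C})\,dA(x).$$ $J(L)$ is the infimum of $\mathcal{J}(\mathcal{C})$ over rectifiable simple closed curves $\mathcal{C}\subset\mathbb{S}^2$ of length exactly $L$. For $L\ge2\pi$, let $\vartheta=\vartheta(L)\in(0,\pi/2]$ be determined by $\sin\vartheta=2\pi/L$, and put $j(L)=\vartheta-\tan(\vartheta/2)$; thus $\vartheta(L_n)=\vartheta_n$. The curves $\beta^{n,k}$ (sphere-filling ropes of Gerlach and von der Mosel), for $n\ge1$, $0\le k\le n-1$, $\gcd(k,n)=1$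 (so $k=0$ occurs only for $n=1$): for $0\le i\le n-1$ let $\Gamma_i\subset\mathbb{S}^2$ be the latitude circle at colatitude $(2i+1)\vartheta_n$ (angle measured from the north pole $(0,0,1)$). Cut $\mathbb{S}^2$ along the great circle $\{y=0\}$ through the poles into the closed hemispheres $\{y\ge0\}$ and $\{y\le0\}$, which cut each $\Gamma_i$ into two semicircles. Keep the semicircles in $\{y\ge0\}$ fixed and rotate those in $\{y\le0\}$ about the $y$-axis through the angle $\phi=2k\vartheta_n$ by $$Q_\phi(x,y,z)=(x\cos\phi+z\sin\phi,\ y,\ -x\sin\phi+z\cos\phi).$$ Then $\beta^{n,k}=\bigcup_{i=0}^{n-1}\big[(\Gamma_i\cap\{y\ge0\})\cup Q_\phi(\Gamma_i\cap\{y\le0\})\big]$; the $2n$ semicircles join up into a single simple closed curve. $\beta^{1,0}$ is a great circle. Mirror images are understood up to rotations of $\mathbb{S}^2$. The six-arc curve: let $Q(x,y,z)=\bigl(\tfrac12x+\tfrac{\sqrt3}{2}z,\ y,\ -\tfrac{\sqrt3}{2}x+\tfrac12z\bigr)$, $c_0(t)=(\tfrac12\cos t,\tfrac12\sin t,\tfrac{\sqrt3}{2})$, $c_1(t)=(\cos t,\sin t,0)$, $c_2(t)=(\tfrac12\cos t,\tfrac12\sin t,-\tfrac{\sqrt3}{2})$. Define $\gamma:[0,4\pi]\to\mathbb{S}^2$ (unit speed) by $$\gamma(s)=\begin{cases} c_0(2s), & 0\le s\le\tfrac{\pi}{2},\\ Q\,c_1(s-\tfrac{3\pi}{2}), & \tfrac{\pi}{2}\le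 s\le\tfrac{3\pi}{2},\\ c_2(2s-3\pi), & \tfrac{3\pi}{2}\le s\le2\pi,\\ Q\,c_2(4\pi-2s), & 2\pi\le s\le\tfrac{5\pi}{2},\\ c_1(\tfrac{7\pi}{2}-s), & \tfrac{5\pi}{2}\le s\le\tfrac{7\pi}{2},\\ Q\,c_0(7\pi-2s), & \tfrac{7\pi}{2}\le s\le4\pi.\end{cases}$$ *)

(* Defs.v *)
(* MathComp / MathComp-Analysis *)
From mathcomp Require Import all_boot all_order all_algebra.
From mathcomp Require Import all_classical all_reals all_analysis.
Import Order.TTheory GRing.Theory Num.Theory.
Import numFieldNormedType.Exports.

Set Implicit Arguments.
Unset Strict Implicit.
Unset Printing Implicit Defensive.

Local Open Scope classical_set_scope.
Local Open Scope ring_scope.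

Section SphereGeometry.
Context {R : realType}.
Implicit Types (u v x y : 'rV[R]_3) (C D : set 'rV[R]_3).

Definition vec3 (a b c : R) : 'rV[R]_3 := \row_(i < 3) [:: a; b; c]`_i.

Definition xcoord x : R := x 0 (inord 0).
Definition ycoord x : R := x 0 (inord 1).
Definition zcoord x : R := x 0 (inord 2).

Definition dot u v : R := \sum_(i < 3) u 0 i * v 0 i.

(* The library norm on row vectors is the sup norm; lengths are measured with
   the Euclidean norm. *)
Definition enorm u : R := Num.sqrt (dot u u).

Definition sphere : set 'rV[R]_3 := [set x | enorm x = 1].

(* For [C] nonempty and compact this infimum is a minimum. *)
Definition sdist x C : R := inf [set acos (dot x y) | y in C].

(* The point with colatitude [p] and longitude [t]. *)
Definition spherical (p t : R) : 'rV[R]_3 :=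
  vec3 (sin p * cos t) (sin p * sin t) (cos p).

(* Integral with respect to the area element [dA = sin p dp dt]. *)
Definition sphere_integral (f : 'rV[R]_3 -> R) : R :=
  \int[(@lebesgue_measure R \x @lebesgue_measure R)%E]_(w in
      `[0, pi] `*` `[0, 2 * pi]) (f (spherical w.1 w.2) * sin w.1).

Definition avg_dist C : R :=
  (4 * pi)^-1 * sphere_integral (fun x => sdist x C).

Definition polygon_length (g : R -> 'rV[R]_3) (a : R) (s : seq R) : R :=
  \sum_(0 <= i < size s)
     enorm (g (nth a (a :: s) i.+1) - g (nth a (a :: s) i)).

Definition curve_length (a b : R) (g : R -> 'rV[R]_3) : \bar R :=
  ereal_sup [set (polygon_length g a s)%:E | s in [set s | itv_partition a b s]].

Definition simple_closed_param (a b : R) (g : R -> 'rV[R]_3) C : Prop :=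
  [/\ a < b,
      {within `[a, b], continuous g},
      g a = g b,
      {in `[a, b[ &, injective g} &
      g @` `[a, b] = C].

(* Since [L] is a real number, [C] is rectifiable. *)
Definition simple_closed_curve C (L : R) : Prop :=
  C `<=` sphere /\
  exists a b g, simple_closed_param a b g C /\ curve_length a b g = L%:E.

(* The real [inf] has the junk value 0 on the empty set, which occurs only for
   [L <= 0]. *)
Definition inf_avg_dist (L : R) : R :=
  inf [set avg_dist C | C in [set C | simple_closed_curve C L]].

(* For [L >= 2 * pi], the solution in ]0, pi / 2] of [sin theta = 2 * pi / L]. *)
Definition theta (L : R) : R := asin (2 * pi / L).

Definition jbound (L : R) : R := theta L - tan (theta L / 2).

Definition theta_ (n : nat) : R := pi / (2 * n%:R).

Definition L_ (n : nat) : R := 2 * pi / sin (theta_ n).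

Definition latitude (p : R) : set 'rV[R]_3 :=
  [set x | sphere x /\ acos (dot x (vec3 0 0 1)) = p].

Definition rot_y (phi : R) x : 'rV[R]_3 :=
  vec3 (xcoord x * cos phi + zcoord x * sin phi)
       (ycoord x)
       (- xcoord x * sin phi + zcoord x * cos phi).

(* Sphere-filling ropes of Gerlach and von der Mosel: the latitude circles at
   colatitudes [(2 i + 1) * theta_ n] are cut along [y = 0], and the halves in
   [y <= 0] are rotated about the y-axis by [2 k * theta_ n]. *)
Definition rope (n k : nat) : set 'rV[R]_3 :=
  \bigcup_(i in [set i | (i < n)%N])
    let Gamma := latitude ((2 * i + 1)%:R * theta_ n) in
    (Gamma `&` [set x | 0 <= ycoord x]) `|`
    rot_y (2 * k%:R * theta_ n) @` (Gamma `&` [set x | ycoord x <= 0]).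

Definition reflection u x : 'rV[R]_3 := x - (2 * dot x u) *: u.

Definition rotation (A : 'M[R]_3) : Prop := A *m A^T = 1%:M /\ \det A = 1.

(* Mirror images are understood up to rotations of the sphere. *)
Definition mirror_image C D : Prop :=
  exists u A, [/\ sphere u, rotation A &
                  D = [set reflection u x *m A | x in C]].

Definition Qsix x : 'rV[R]_3 :=
  vec3 (2^-1 * xcoord x + Num.sqrt 3 / 2 * zcoord x)
       (ycoord x)
       (- (Num.sqrt 3 / 2) * xcoord x + 2^-1 * zcoord x).

Definition c0 (t : R) : 'rV[R]_3 :=
  vec3 (2^-1 * cos t) (2^-1 * sin t) (Num.sqrt 3 / 2).
Definition c1 (t : R) : 'rV[R]_3 := vec3 (cos t) (sin t) 0.
Definition c2 (t : R) : 'rV[R]_3 :=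
  vec3 (2^-1 * cos t) (2^-1 * sin t) (- (Num.sqrt 3 / 2)).

(* Consecutive pieces agree at the common endpoints; the values outside
   [0, 4 * pi] are irrelevant. *)
Definition six_arc (s : R) : 'rV[R]_3 :=
  if s <= pi / 2 then c0 (2 * s)
  else if s <= 3 * pi / 2 then Qsix (c1 (s - 3 * pi / 2))
  else if s <= 2 * pi then c2 (2 * s - 3 * pi)
  else if s <= 5 * pi / 2 then Qsix (c2 (4 * pi - 2 * s))
  else if s <= 7 * pi / 2 then c1 (7 * pi / 2 - s)
  else Qsix (c0 (7 * pi - 2 * s)).

End SphereGeometry.

(* Main.v *)
(* Fix th = theta_ n and let f be the truncation of an angle p in [0, pi] that has
   slope 1 on the caps p <= th and p >= pi - th and is constant between them.
   Then f p <= p and f (pi - p) = 2 th - f p, so that for each x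
     dist(x, C) + dist(-x, C) >= 2 th - (max u - min u),  u(y) = f(angle(x, y)), y in C,
   and the oscillation of u on the closed curve C is at most half its variation.
   Averaging over x, the variation of u becomes proportional to the length of C:
   moving the pole by d changes f(angle) on the two caps only, and by |cos t| d to
   first order.  This gives avg_dist C >= th - L (1 - cos th) / (2 pi), which is
   decreasing in L and equals jbound (L_ n) at L = L_ n.

   For a rope, the distance from x to the semicircles in its own hemisphere is at
   most the distance from the colatitude of x to the odd multiples of th.  Since
   y -> -y exchanges the hemispheres, each of them contributes half of a colatitude
   integral, whose value is that of the lower bound.  Walking along the rope, the q-th
   semicircle has angle (2 k q + 1) th; as k is prime to n these angles meet every
   latitude once in each hemisphere.  The resulting parametrization has length at
   most L_ n, and then exactly L_ n by the case of equality. *)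

Require Import Defs.
From mathcomp Require Import all_boot all_order all_algebra.
From mathcomp Require Import all_classical all_reals all_analysis.
From mathcomp Require Import measurable_realfun ring lra zify.
Import Order.TTheory GRing.Theory Num.Theory.
Import numFieldNormedType.Exports.

Set Implicit Arguments.
Unset Strict Implicit.
Unset Printing Implicit Defensive.

Local Open Scope classical_set_scope.
Local Open Scope ring_scope.

(** The sphere integral is defined in spherical coordinates, so its invariance has to be proved.
    Rotations about the z-axis come from periodicity in the longitude. The exchange of [x] and [z]
    becomes Fubini once a hemisphere is written as a graph over the disk in the (x, z)-plane; the
    density [1 / y] blows up at the rim, so the exchange is first proved with a factor [y ^+ 2],
    which dominated convergence then removes. These two symmetries move any two points to the pole
    and the meridian of longitude 0.

    The loss [L (1 - cos th) / (2 pi)] arises as follows. The truncated angles to two points at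
    small distance [d] differ, integrated over the sphere, by about [8 (1 - cos th) d]: each of the
    two caps gives [1 - cos th] times 4, the integral of [|cos t|]. Half of the variation is lost
    for the pair [x], [-x], and averaging over pairs divides by [8 pi].

    For ropes the matching constant is [sin th + sin (3 th) + ... + sin ((2 n - 1) th) = 1 / sin
    th], which holds because [n th = pi / 2]. *)

(** * Measurability and Fubini on rectangles *)

Section cont_prod_meas.
Context {R : realType}.

(** Balls with rational centre and radius [1 / (m + 1)] form a countable base whose products are
    measurable rectangles. *)
Lemma open_prod_measurable (U : set (R * R)) : open U ->
  measurable (U : set (measurableTypeR R * measurableTypeR R)).
Proof.
move=> oU.
pose B (q : rat * rat * nat) : set (R * R) :=
  (ball (ratr q.1.1 : R) q.2.+1%:R^-1) `*` (ball (ratr q.1.2 : R) q.2.+1%:R^-1).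
have mB q : measurable (B q : set (measurableTypeR R * measurableTypeR R)).
  by apply: measurableX; apply: measurable_ball.
have -> : U = \bigcup_(q in [set q | B q `<=` U]) B q.
  rewrite eqEsubset; split=> [[x y] Uxy|w [q qU Bw]]; last exact: qU.
  have /nbhs_ballP[e /= e0 eU] : nbhs (x, y) U by exact: open_nbhs_nbhs.
  have [n ne] : exists n : nat, n.+1%:R^-1 < e / 2.
    have := near_infty_natSinv_lt (PosNum (divr_gt0 e0 (@ltr0Sn R 1))).
    by case=> N _ /(_ N (leqnn N)) /=; exists N.
  have d0 : (0:R) < n.+1%:R^-1 by rewrite invr_gt0.
  have [q1 q1x] : exists q : rat, `|x - ratr q| < n.+1%:R^-1.
    have /(@rat_in_itvoo R)[q] : x - n.+1%:R^-1 < x + n.+1%:R^-1.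
      by rewrite ltrBlDr -addrA ltrDl addr_gt0.
    rewrite in_itv/= => /andP[h1 h2]; exists q; rewrite ltr_norml; apply/andP; split; move: h1 h2; set d := (_^-1 : R); lra.
  have [q2 q2y] : exists q : rat, `|y - ratr q| < n.+1%:R^-1.
    have /(@rat_in_itvoo R)[q] : y - n.+1%:R^-1 < y + n.+1%:R^-1.
      by rewrite ltrBlDr -addrA ltrDl addr_gt0.
    rewrite in_itv/= => /andP[h1 h2]; exists q; rewrite ltr_norml; apply/andP; split; move: h1 h2; set d := (_^-1 : R); lra.
  exists (q1, q2, n); last by split; rewrite /= /ball/= distrC.
  move=> [u v] [/= hu hv]; apply: eU; split; rewrite /= /ball/=.
    rewrite /ball/= in hu.
    have -> : x - u = (x - ratr q1) + (ratr q1 - u) by ring.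
    by rewrite (le_lt_trans (ler_normD _ _))// (lt_trans (ltrD q1x hu))// [ltRHS]splitr ltrD.
  rewrite /ball/= in hv.
  have -> : y - v = (y - ratr q2) + (ratr q2 - v) by ring.
  by rewrite (le_lt_trans (ler_normD _ _))// (lt_trans (ltrD q2y hv))// [ltRHS]splitr ltrD.
rewrite bigcup_mkcond; apply: countable_bigcupT_measurable; first exact: countableP.
by move=> q; case: ifP => _; [exact: mB|exact: measurable0].
Qed.

Lemma continuous_prod_measurable (f : R * R -> R) (D : set (R * R)) : continuous f ->
  measurable_fun (D : set (measurableTypeR R * measurableTypeR R))
   (f : measurableTypeR R * measurableTypeR R -> measurableTypeR R).
Proof.
move=> cf; apply: measurable_funTS.
apply: (measurability _ (RGenOpens.measurableE R)).
move=> _ [_ [a [b ->] <-]]; rewrite setTI; apply: open_prod_measurable.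
by apply: open_comp; [move=> x _; exact: cf|exact: interval_open].
Qed.
End cont_prod_meas.

Lemma continuous_pair {T U V : topologicalType} (f : T -> U) (g : T -> V) :
  continuous f -> continuous g -> continuous (fun t => (f t, g t) : U * V).
Proof.
move=> cf cg x.
exact: (@cvg_pair _ _ _ (nbhs x) (nbhs (f x)) (nbhs (g x)) _ _ _ _ _ (cf x) (cg x)).
Qed.

Section rect_integral.
Context {R : realType}.
Local Notation mu := (@lebesgue_measure R).
Local Notation mu2 := (@lebesgue_measure R \x @lebesgue_measure R)%E.
Implicit Types (f g : R * R -> R) (a b c d : R).

Lemma continuous_integrable_itv (f : R -> R) a b : continuous f ->
  mu.-integrable `[a, b] (EFin \o f).
Proof.
move=> cf; apply: continuous_compact_integrable; first exact: segment_compact.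
exact: continuous_subspaceT.
Qed.

Lemma measurable_rect a b c d :
  measurable (`[a, b] `*` `[c, d] : set (measurableTypeR R * measurableTypeR R)).
Proof. exact: measurableX. Qed.

Lemma mu2_rect_lty a b c d : (mu2 (`[a, b] `*` `[c, d]) < +oo)%E.
Proof.
have h u v : (mu `[u, v]%classic < +oo)%E.
  by rewrite lebesgue_measure_itv/=; case: ifP => // _; rewrite -EFinB ltry.
rewrite product_measure1E//; apply: lte_mul_pinfty => //; last exact: h.
by rewrite ge0_fin_numE//; exact: h.
Qed.

Lemma bounded_integrable_rect f a b c d (K : R) :
  measurable_fun (`[a, b] `*` `[c, d] : set (measurableTypeR R * measurableTypeR R))
    (f : measurableTypeR R * measurableTypeR R -> measurableTypeR R) ->
  (forall w, (`[a, b] `*` `[c, d]) w -> `|f w| <= K) ->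
  mu2.-integrable (`[a, b] `*` `[c, d]) (EFin \o f).
Proof.
move=> mf fK; apply: (@measurable_bounded_integrable _ _ _ mu2 f) => //.
- exact: measurable_rect.
- exact: mu2_rect_lty.
- exists K; split; first exact: num_real.
  by move=> x Kx y /= Dy; exact: (le_trans (fK _ Dy) (ltW Kx)).
Qed.

Lemma continuous_rect_bounded f a b c d : continuous f ->
  exists K, forall w, (`[a, b] `*` `[c, d]) w -> `|f w| <= K.
Proof.
move=> cf.
have /compact_bounded [M [Mr MB]] : compact (f @` (`[a, b] `*` `[c, d])).
  apply: continuous_compact; first exact: continuous_subspaceT.
  by apply: compact_setX; exact: segment_compact.
exists (M + 1) => w Dw; apply: (MB (M + 1)); first by rewrite ltrDl.
by exists w.
Qed.

Lemma continuous_integrable_rect f a b c d : continuous f ->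
  mu2.-integrable (`[a, b] `*` `[c, d]) (EFin \o f).
Proof.
move=> cf; have [K fK] := @continuous_rect_bounded f a b c d cf.
apply: (@bounded_integrable_rect _ _ _ _ _ K) => //.
exact: continuous_prod_measurable.
Qed.

(** Fubini on the whole plane is applied to the extension of [f] by zero, whose sections are the
    extensions by zero of the sections of [f], or zero outside [[a, b]]. *)
Lemma rect_fubini12 f a b c d :
  mu2.-integrable (`[a, b] `*` `[c, d]) (EFin \o f) ->
  (\int[mu2]_(w in `[a, b] `*` `[c, d]) (f w)%:E =
   \int[mu]_(x in `[a, b]) \int[mu]_(y in `[c, d]) (f (x, y))%:E)%E.
Proof.
move=> fi; rewrite integral_mkcond -integral12_prod_meas1; last first.
  by apply/(integrable_mkcond _ (measurable_rect _ _ _ _)).1.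
rewrite [RHS]integral_mkcond; apply: eq_integral => x _.
rewrite /fubini_F !patchE; have [xA|xA] := boolP (x \in `[a, b]%classic).
  rewrite [RHS]integral_mkcond; apply: eq_integral => y _.
  by rewrite !patchE in_setX xA.
by apply: integral0_eq => y _; rewrite patchE in_setX (negbTE xA).
Qed.

Lemma rect_fubini21 f a b c d :
  mu2.-integrable (`[a, b] `*` `[c, d]) (EFin \o f) ->
  (\int[mu2]_(w in `[a, b] `*` `[c, d]) (f w)%:E =
   \int[mu]_(y in `[c, d]) \int[mu]_(x in `[a, b]) (f (x, y))%:E)%E.
Proof.
move=> fi; rewrite integral_mkcond -integral21_prod_meas1; last first.
  by apply/(integrable_mkcond _ (measurable_rect _ _ _ _)).1.
rewrite [RHS]integral_mkcond; apply: eq_integral => y _.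
rewrite /fubini_G !patchE; have [xA|xA] := boolP (y \in `[c, d]%classic).
  rewrite [RHS]integral_mkcond; apply: eq_integral => x _.
  by rewrite !patchE in_setX xA andbT.
by apply: integral0_eq => x _; rewrite patchE in_setX (negbTE xA) andbF.
Qed.

Lemma continuous_pair1 f x : continuous f -> continuous (fun y => f (x, y)).
Proof.
move=> cf y; apply: (@continuous_comp _ _ _ (fun y => (x, y)) f); last exact: cf.
apply: continuous_pair; first exact: cst_continuous.
  by move=> z; exact: cvg_id.
Qed.

Lemma continuous_pair2 f y : continuous f -> continuous (fun x => f (x, y)).
Proof.
move=> cf x; apply: (@continuous_comp _ _ _ (fun x => (x, y)) f); last exact: cf.
apply: continuous_pair; last exact: cst_continuous.
  by move=> z; exact: cvg_id.
Qed.

Lemma Rintegral_rect12 f a b c d : continuous f ->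
  \int[mu2]_(w in `[a, b] `*` `[c, d]) f w =
  \int[mu]_(x in `[a, b]) \int[mu]_(y in `[c, d]) f (x, y).
Proof.
move=> cf; rewrite /Rintegral rect_fubini12; last exact: continuous_integrable_rect.
congr fine; apply: eq_integral => x _; rewrite fineK//.
apply: integrable_fin_num => //; apply: continuous_integrable_itv.
exact: continuous_pair1.
Qed.

Lemma Rintegral_rect21 f a b c d : continuous f ->
  \int[mu2]_(w in `[a, b] `*` `[c, d]) f w =
  \int[mu]_(y in `[c, d]) \int[mu]_(x in `[a, b]) f (x, y).
Proof.
move=> cf; rewrite /Rintegral rect_fubini21; last exact: continuous_integrable_rect.
congr fine; apply: eq_integral => y _; rewrite fineK//.
apply: integrable_fin_num => //; apply: continuous_integrable_itv.
exact: continuous_pair2.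
Qed.

Lemma continuous_Rintegral_swap f a b c d : continuous f ->
  \int[mu]_(x in `[a, b]) \int[mu]_(y in `[c, d]) f (x, y) =
  \int[mu]_(y in `[c, d]) \int[mu]_(x in `[a, b]) f (x, y).
Proof. by move=> cf; rewrite -Rintegral_rect12// -Rintegral_rect21. Qed.

End rect_integral.

(** * One-variable integration: antiderivatives and substitution *)

Section one_dim.
Context {R : realType}.
Local Notation mu := (@lebesgue_measure R).
Implicit Types (a b c d x : R).

Lemma is_derive_continuous (F dF : R -> R) (D : set R) :
  (forall x, D x -> is_derive x 1 F (dF x)) -> forall x, D x -> {for x, continuous F}.
Proof.
move=> dFx x Dx; apply: differentiable_continuous; apply/derivable1_diffP.
by have [] := dFx x Dx.
Qed.

(** The integral from [m] has a two-sided derivative only strictly to the right of [m]. Uses on a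
    closed interval therefore start at a point lower by 1. *)
Lemma continuous_antiderivative (g : R -> R) m : continuous g ->
  exists A : R -> R, forall x, m < x -> is_derive x 1 A (g x).
Proof.
move=> cg; pose A x := \int[@lebesgue_measure R]_(t in `[m, x]) g t.
have AE x : m < x -> derivable A x 1 /\ derive1 A x = g x.
  move=> mx.
  have gi := @continuous_integrable_itv R g m (x + 1) cg.
  apply: (continuous_FTC1_closed _ gi mx (cg x)).
  by rewrite ltrDl.
exists A => x mx; have [dA eA] := AE x mx.
have e1 : 'D_1 A x = derive1 A x by rewrite derive1E.
have e2 : 'D_1 A x = g x by rewrite e1.
exact: (DeriveDef dA e2).
Qed.

Lemma Rintegral_FTC (f F : R -> R) a b : a <= b -> continuous f ->
  (forall x, a <= x <= b -> is_derive x 1 F (f x)) ->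
  \int[mu]_(x in `[a, b]) f x = F b - F a.
Proof.
rewrite le_eqVlt => /predU1P[<- _ _|ab cf dF].
  by rewrite subrr set_itv1 Rintegral_set1.
have cF := is_derive_continuous (D := [set x | a <= x <= b]) dF.
rewrite /Rintegral (continuous_FTC2 ab (F := F)) //.
- exact: continuous_subspaceT.
- split.
  + by move=> x; rewrite in_itv/= => /andP[ax xb]; have [] := dF x; rewrite ?(ltW ax) ?(ltW xb).
  + by apply: cvg_at_right_filter; apply: cF => /=; rewrite lexx ltW.
  + by apply: cvg_at_left_filter; apply: cF => /=; rewrite lexx ltW.
- move=> x; rewrite in_itv/= => /andP[ax xb].
  by rewrite derive1E; apply: derive_val; apply: dF; rewrite !ltW.
Qed.

Lemma Rintegral_cat (f : R -> R) a b c : a <= b -> b <= c -> continuous f ->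
  \int[mu]_(x in `[a, c]) f x = \int[mu]_(x in `[a, b]) f x + \int[mu]_(x in `[b, c]) f x.
Proof.
move=> ab bc cf; have [A dA] := continuous_antiderivative (a - 1) cf.
have E u v : a <= u -> u <= v -> \int[mu]_(x in `[u, v]) f x = A v - A u.
  move=> au uv; apply: Rintegral_FTC => // x /andP[ux _]; apply: dA.
  by rewrite (lt_le_trans _ (le_trans au ux))// ltrBlDr ltrDl.
by rewrite !E// ?(le_trans ab)//; ring.
Qed.

(** Both sides equal [A (F a) - A (F b)] for an antiderivative [A] of [g]; only the order of the two
    end values of [F] enters. *)
Lemma Rintegral_subst_decr (g F dF : R -> R) a b : a <= b ->
  continuous g -> continuous dF -> (forall x, is_derive x 1 F (- dF x)) -> F b <= F a ->
  \int[mu]_(x in `[a, b]) (g (F x) * dF x) = \int[mu]_(x in `[F b, F a]) g x.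
Proof.
move=> ab cg cdF dFE Fab.
have cF : continuous F.
  by move=> x; exact: (is_derive_continuous (D := setT) (dF := fun x => - dF x)).
(* The antiderivative must be valid at every value of [F] on [[a, b]], so it starts below the
   minimum of [F]. *)
have [c cab Fc] := EVT_min ab (continuous_subspaceT cF).
have [A dA] := continuous_antiderivative (F c - 1) cg.
transitivity (A (F a) - A (F b)); last first.
  apply/esym/Rintegral_FTC => // x /andP[Fbx _]; apply: dA.
  rewrite (lt_le_trans _ Fbx)// (lt_le_trans _ (Fc b _)) ?in_itv/= ?lexx ?ab//.
  by rewrite ltrBlDr ltrDl.
transitivity ((- (A \o F)) b - (- (A \o F)) a); last by rewrite /= opprK addrC.
apply: Rintegral_FTC => //.
- by move=> x; apply: cvgM; [apply: continuous_comp; [exact: cF|exact: cg]|exact: cdF].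
- move=> x xab.
  have dAF : is_derive (F x) 1 A (g (F x)).
    apply: dA; rewrite (lt_le_trans _ (Fc x _)) ?in_itv/=//.
    by rewrite ltrBlDr ltrDl.
  have := is_deriveN (is_derive1_comp dAF (dFE x)).
  by rewrite /= mulrN opprK.
Qed.

End one_dim.

(** * Continuity of composite expressions *)

Section continuity.
Context {R : realType} {T : topologicalType}.
Implicit Types (f g : T -> R) (x : T).

Lemma cont_cst x (c : R) : continuous_at x (fun _ => c).
Proof. exact: cvg_cst. Qed.

Lemma contD x f g : continuous_at x f -> continuous_at x g ->
  continuous_at x (fun t => f t + g t).
Proof. exact: cvgD. Qed.

Lemma contM x f g : continuous_at x f -> continuous_at x g ->
  continuous_at x (fun t => f t * g t).
Proof. exact: cvgM. Qed.

Lemma contN x f : continuous_at x f -> continuous_at x (fun t => - f t).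
Proof. exact: cvgN. Qed.

Lemma contX x f n : continuous_at x f -> continuous_at x (fun t => f t ^+ n).
Proof.
move=> cf; elim: n => [|n IH].
  by under eq_fun do rewrite expr0; exact: cont_cst.
by under eq_fun do rewrite exprS; exact: contM.
Qed.

Lemma contnorm x f : continuous_at x f -> continuous_at x (fun t => `|f t|).
Proof. exact: cvg_norm. Qed.

Lemma contV x f : f x != 0 -> continuous_at x f -> continuous_at x (fun t => (f t)^-1).
Proof. by move=> f0 cf; exact: cvgV. Qed.

Lemma cont_comp x (h : R -> R) f : continuous h -> continuous_at x f ->
  continuous_at x (fun t => h (f t)).
Proof. by move=> ch cf; apply: (continuous_comp cf); exact: ch. Qed.

Lemma contmax x f g : continuous_at x f -> continuous_at x g ->
  continuous_at x (fun t => Num.max (f t) (g t)).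
Proof.
move=> cf cg.
have -> : (fun t => Num.max (f t) (g t)) = (fun t => 2^-1 * (f t + g t + `|f t - g t|)).
  by apply/funext => t; rewrite maxr_absE mulrC.
apply: contM; first exact: cont_cst.
by apply: contD; [exact: contD|apply: contnorm; apply: contD => //; exact: contN].
Qed.

Lemma contmin x f g : continuous_at x f -> continuous_at x g ->
  continuous_at x (fun t => Num.min (f t) (g t)).
Proof.
move=> cf cg.
have -> : (fun t => Num.min (f t) (g t)) = (fun t => 2^-1 * (f t + g t - `|f t - g t|)).
  by apply/funext => t; rewrite minr_absE mulrC.
apply: contM; first exact: cont_cst.
by apply: contD; [exact: contD|apply: contN; apply: contnorm; apply: contD => //; exact: contN].
Qed.

Lemma cont_fst {U V : topologicalType} (x : U * V) : continuous_at x (fun w => w.1).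
Proof. exact: cvg_fst. Qed.

Lemma cont_snd {U V : topologicalType} (x : U * V) : continuous_at x (fun w => w.2).
Proof. exact: cvg_snd. Qed.

Lemma cont_id x : continuous_at x (fun w => w).
Proof. exact: cvg_id. Qed.

Lemma cont_pair {U V : topologicalType} x (f : T -> U) (g : T -> V) :
  continuous_at x f -> continuous_at x g -> continuous_at x (fun t => (f t, g t) : U * V).
Proof.
move=> cf cg.
exact: (@cvg_pair _ _ _ (nbhs x) (nbhs (f x)) (nbhs (g x)) _ _ _ _ _ cf cg).
Qed.

Lemma cont_comp_gen {U V : topologicalType} x (h : U -> V) (f : T -> U) :
  continuous h -> continuous_at x f -> continuous_at x (fun t => h (f t)).
Proof. by move=> ch cf; apply: (continuous_comp cf); exact: ch. Qed.
End continuity.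

(** The goal is decomposed by its head operation. Functions outside the fixed list are treated
    through a hypothesis [continuous h], which is why proofs put such facts into the context before
    calling [ctn]. *)
Ltac ctn1 :=
  lazymatch goal with
  | |- continuous_at _ (fun _ => ?c) => exact: cont_cst
  | |- continuous_at _ (fun t => t) => exact: cont_id
  | |- continuous_at _ (fun t => @?f t + @?g t) => apply: (contD (f := f) (g := g))
  | |- continuous_at _ (fun t => @?f t * @?g t) => apply: (contM (f := f) (g := g))
  | |- continuous_at _ (fun t => - @?f t) => apply: (contN (f := f))
  | |- continuous_at _ (fun t => `|@?f t|) => apply: (contnorm (f := f))
  | |- continuous_at _ (fun t => (@?f t) ^+ ?n) => apply: (contX (f := f) (n := n))
  | |- continuous_at _ (fun t => Num.max (@?f t) (@?g t)) => apply: (contmax (f := f) (g := g))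
  | |- continuous_at _ (fun t => Num.min (@?f t) (@?g t)) => apply: (contmin (f := f) (g := g))
  | |- continuous_at _ (fun t => sin (@?f t)) => apply: (cont_comp (f := f) (@continuous_sin _))
  | |- continuous_at _ (fun t => cos (@?f t)) => apply: (cont_comp (f := f) (@continuous_cos _))
  | |- continuous_at _ (fun t => Num.sqrt (@?f t)) => apply: (cont_comp (f := f) (@sqrt_continuous _))
  | |- continuous_at _ (fun t => ((@?f t), (@?g t))) => apply: (cont_pair (f := f) (g := g))
  | |- continuous_at _ (fun t => (@?f t).1) => apply: (cont_comp_gen (f := f) (fun x => @cont_fst _ _ x))
  | |- continuous_at _ (fun t => (@?f t).2) => apply: (cont_comp_gen (f := f) (fun x => @cont_snd _ _ x))
  | H : continuous ?h |- continuous_at _ (fun t => ?h (@?f t)) => apply: (cont_comp_gen (f := f) H)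
  end.
Ltac ctn := intros; repeat ctn1.

(** * Exchange of [x] and [z] in weighted sphere integrals *)

Section spherical_integral.
Context {R : realType}.
Local Notation mu := (@lebesgue_measure R).
Local Notation mu2 := (@lebesgue_measure R \x @lebesgue_measure R)%E.
Implicit Types (F : R * R * R -> R).

Definition sph (w : R * R) : R * R * R :=
  (sin w.1 * cos w.2, sin w.1 * sin w.2, cos w.1).

(* Sphere integrals are computed in [R * R * R] because the continuity and Fubini
   lemmas are about products. *)
Definition SI F : R :=
  \int[mu2]_(w in `[0, pi] `*` `[0, 2 * pi]) (F (sph w) * sin w.1).

Definition swap13 (v : R * R * R) : R * R * R := (v.2, v.1.2, v.1.1).
Definition flip2 (v : R * R * R) : R * R * R := (v.1.1, - v.1.2, v.2).

(* The hemisphere [y >= 0] is a graph over the disk in the (x, z)-plane with area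
   element [dx dz / y]; the weight [y ^+ 2] makes the density vanish on the rim. *)
Definition disk_density F (w : R * R) : R :=
  let s := Num.sqrt (1 - w.1 ^+ 2 - w.2 ^+ 2) in F (w.1, s, w.2) * s.

Lemma continuous_sph F : continuous F -> continuous (fun w => F (sph w) * sin w.1).
Proof. move=> cF; rewrite /sph; ctn. Qed.

Lemma continuous_disk_density F : continuous F -> continuous (disk_density F).
Proof. move=> cF; rewrite /disk_density; ctn. Qed.

(** Extends the chord of the disk at height [cos p] to [[-1, 1]], so that the domain no longer
    depends on [p] and the integrals can be exchanged. *)
Lemma Rintegral_disk_section (k : R -> R) (r : R) : 0 <= r -> r <= 1 -> continuous k ->
  (forall x, r ^+ 2 <= x ^+ 2 -> k x = 0) ->
  \int[mu]_(x in `[- r, r]) k x = \int[mu]_(x in `[-1, 1]) k x.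
Proof.
move=> r0 r1 ck k0.
rewrite [RHS](@Rintegral_cat _ _ _ (- r))//; [|lra|lra].
rewrite (@Rintegral_cat _ _ (- r) r)//; last lra.
rewrite [X in _ = X + _](_ : _ = 0) ?add0r; last first.
  rewrite -[RHS](mul0r (fine (mu `[-1, - r]%classic))) -Rintegral_cst//.
  apply: eq_Rintegral => x /set_mem; rewrite /= in_itv/= => /andP[x1 x2].
  apply: k0; nra.
rewrite [X in _ = _ + X](_ : _ = 0) ?addr0//.
rewrite -[RHS](mul0r (fine (mu `[r, 1]%classic))) -Rintegral_cst//.
apply: eq_Rintegral => x /set_mem; rewrite /= in_itv/= => /andP[x1 x2].
apply: k0; nra.
Qed.

(** [Num.sqrt] is 0 on negative numbers, so the density continues by zero outside the disk and a
    square can serve as domain. *)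
Lemma disk_density0 F x z : 1 <= x ^+ 2 + z ^+ 2 -> disk_density F (x, z) = 0.
Proof.
by move=> h; rewrite /disk_density/= ler0_sqrtr ?mulr0// -addrA -opprD subr_le0.
Qed.

(** Two one-variable substitutions replace a change of variables in the plane: [x = sin p * cos t]
    at fixed [p] and, after exchanging the integrals, [z = cos p]. With [y = sin p * sin t], one
    factor of the weight [y ^+ 2] is absorbed by [dx = - y dt] and the other stays in
    [disk_density]; the area factor [sin p] is absorbed by [dz]. *)
Lemma half_sphere_disk F : continuous F ->
  \int[mu2]_(w in `[0, pi] `*` `[0, pi])
     (F (sph w) * (sin w.1 * sin w.2) ^+ 2 * sin w.1) =
  \int[mu]_(x in `[-1, 1]) \int[mu]_(z in `[-1, 1]) disk_density F (x, z).
Proof.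
move=> cF; have ck := continuous_disk_density cF.
rewrite Rintegral_rect12; last by rewrite /sph; ctn.
transitivity (\int[mu]_(p in `[0, pi]) \int[mu]_(x in `[-1, 1])
   (disk_density F (x, cos p) * sin p)).
  apply: eq_Rintegral => p /set_mem; rewrite /= in_itv/= => p0pi.
  have sp0 := sin_ge0_pi p0pi.
  have ckp : continuous (fun x : R => disk_density F (x, cos p)) by ctn.
  rewrite [RHS]RintegralZr//; last exact: continuous_integrable_itv.
  rewrite RintegralZr//; last first.
    by apply: continuous_integrable_itv; rewrite /sph; ctn.
  congr (_ * _).
  rewrite -(@Rintegral_disk_section _ (sin p))//; last first.
    by move=> x; rewrite sin2cos2 => hx; apply: disk_density0; lra.
  have dcos (x : R) : is_derive x 1 (fun t => sin p * cos t) (- (sin p * sin x)).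
    by have := is_deriveZ (sin p) (is_derive_cos x); rewrite scalerN.
  have csin : continuous (fun t : R => sin p * sin t) by ctn.
  have := Rintegral_subst_decr (pi_ge0 R) ckp csin dcos.
  rewrite cos0 cospi mulr1 mulrN1 => <-; last by lra.
  apply: eq_Rintegral => t /set_mem; rewrite /= in_itv/= => t0pi.
  have st0 := sin_ge0_pi t0pi.
  rewrite /disk_density /sph/=.
  have -> : 1 - (sin p * cos t) ^+ 2 - cos p ^+ 2 = (sin p * sin t) ^+ 2.
    by rewrite !exprMn (cos2sin2 p) (cos2sin2 t); ring.
  rewrite sqrtr_sqr ger0_norm ?mulr_ge0//; ring.
have cG : continuous (fun w : R * R => disk_density F (w.2, cos w.1) * sin w.1) by ctn.
rewrite (continuous_Rintegral_swap _ _ _ _ cG)/=.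
apply: eq_Rintegral => x _.
have dcos (p : R) : is_derive p 1 cos (- sin p) by exact: is_derive_cos.
have ckx : continuous (fun z : R => disk_density F (x, z)) by ctn.
have := Rintegral_subst_decr (pi_ge0 R) ckx (@continuous_sin R) dcos.
by rewrite cos0 cospi => ->//; lra.
Qed.

(** Over the disk the exchange of [x] and [z] only exchanges the order of integration, as [s] is
    symmetric in both. *)
Lemma half_sphere_swap13 F : continuous F ->
  \int[mu2]_(w in `[0, pi] `*` `[0, pi])
     (F (sph w) * (sin w.1 * sin w.2) ^+ 2 * sin w.1) =
  \int[mu2]_(w in `[0, pi] `*` `[0, pi])
     (F (swap13 (sph w)) * (sin w.1 * sin w.2) ^+ 2 * sin w.1).
Proof.
move=> cF; rewrite half_sphere_disk//.
rewrite (continuous_Rintegral_swap _ _ _ _ (continuous_disk_density cF)).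
have cFs : continuous (fun v => F (swap13 v)) by rewrite /swap13; ctn.
rewrite (half_sphere_disk cFs).
apply: eq_Rintegral => x _; apply: eq_Rintegral => y _.
by rewrite /disk_density/= addrAC.
Qed.

(** The longitudes in [[pi, 2 * pi]] are folded back by [t -> 2 * pi - t], which changes only the
    sign of [y]. *)
Lemma SI_flip2_half F : continuous F ->
  SI F = \int[mu2]_(w in `[0, pi] `*` `[0, pi]) (F (sph w) * sin w.1) +
         \int[mu2]_(w in `[0, pi] `*` `[0, pi]) (F (flip2 (sph w)) * sin w.1).
Proof.
move=> cF; rewrite /SI; have cG := continuous_sph cF.
have cFf : continuous (fun v => F (flip2 v)) by rewrite /flip2; ctn.
have cH := continuous_sph cFf.
rewrite -RintegralD//; [|exact: measurable_rect|exact: continuous_integrable_rect..].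
have cS : continuous (fun w => F (sph w) * sin w.1 + F (flip2 (sph w)) * sin w.1).
  by rewrite /flip2 /sph; ctn.
rewrite (Rintegral_rect12 _ _ _ _ cG) (Rintegral_rect12 _ _ _ _ cS).
apply: eq_Rintegral => p _.
have cg : continuous (fun t : R => F (sph (p, t)) * sin p) by rewrite /sph; ctn.
have cgf : continuous (fun t : R => F (flip2 (sph (p, t))) * sin p).
  by rewrite /flip2 /sph; ctn.
have pi0 := pi_ge0 R.
rewrite RintegralD//; [|exact: continuous_integrable_itv..].
rewrite (Rintegral_cat (b := pi))//; last by lra.
congr (_ + _).
have c1 : continuous (fun _ : R => 1 : R) by ctn.
have dF (x : R) : is_derive x 1 (fun t : R => 2 * pi - t) (- 1).
  have := is_deriveB (is_derive_cst (2 * pi : R) x 1) (is_derive_id x 1).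
  by rewrite sub0r.
have := Rintegral_subst_decr pi0 cg c1 dF.
rewrite subr0 (_ : 2 * pi - pi = pi); last by ring.
move=> <-; last by lra.
apply: eq_Rintegral => t _.
rewrite /flip2 /sph/= mulr1 cosB sinB.
have -> : 2 * pi = pi *+ 2 :> R by rewrite mulr_natl.
by rewrite cos2pi sin2pi !mul0r !mul1r sub0r addr0 mulrN.
Qed.

(** The hemisphere [y <= 0] is covered by the result for [y >= 0] applied to [F] after [flip2],
    which commutes with [swap13]. *)
Lemma SI_swap13_sq F : continuous F ->
  SI (fun v => F v * v.1.2 ^+ 2) = SI (fun v => F (swap13 v) * v.1.2 ^+ 2).
Proof.
move=> cF.
have cFs : continuous (fun v => F (swap13 v)) by rewrite /swap13; ctn.
have cFf : continuous (fun v => F (flip2 v)) by rewrite /flip2; ctn.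
rewrite [LHS]SI_flip2_half; last by ctn.
rewrite [RHS]SI_flip2_half; last by rewrite /swap13; ctn.
congr (_ + _); first exact: half_sphere_swap13.
have := half_sphere_swap13 cFf; rewrite /=.
by under eq_Rintegral do rewrite -sqrrN; under [in RHS]eq_Rintegral do rewrite -sqrrN.
Qed.

End spherical_integral.

(** * Removal of the weight, and rotations about the z-axis *)

Section rect_limits.
Context {R : realType}.
Local Notation mu2 := (@lebesgue_measure R \x @lebesgue_measure R)%E.

Lemma negligible_setX1 (c : R) : mu2.-negligible ([set c] `*` setT).
Proof.
exists ([set c] `*` setT); split => //; first exact: measurableX.
rewrite product_measure1E// [X in (X * _)%E](_ : _ = 0%E) ?mul0e//.
exact: lebesgue_measure_set1.
Qed.

Lemma negligible_setX2 (c : R) : mu2.-negligible (setT `*` [set c]).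
Proof.
exists (setT `*` [set c]); split => //; first exact: measurableX.
rewrite product_measure1E// [X in (_ * X)%E](_ : _ = 0%E) ?mule0//.
exact: lebesgue_measure_set1.
Qed.

Lemma Rintegral_rect_cvg (f_ : nat -> R * R -> R) (f : R * R -> R) (N : set (R * R))
    (a b c d K : R) :
  (forall n, continuous (f_ n)) ->
  measurable_fun (`[a, b] `*` `[c, d] : set (measurableTypeR R * measurableTypeR R))
    (f : measurableTypeR R * measurableTypeR R -> measurableTypeR R) ->
  (forall n w, (`[a, b] `*` `[c, d]) w -> `|f_ n w| <= K) ->
  mu2.-negligible N ->
  (forall w, (`[a, b] `*` `[c, d]) w -> ~ N w -> f_ n w @[n --> \oo] --> f w) ->
  \int[mu2]_(w in `[a, b] `*` `[c, d]) f_ n w @[n --> \oo] -->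
  \int[mu2]_(w in `[a, b] `*` `[c, d]) f w.
Proof.
move=> cf mf fK N0 fcvg.
have mD := @measurable_rect R a b c d.
have [] := @dominated_convergence _ _ _ mu2 _ mD (fun n => EFin \o f_ n) (EFin \o f) (EFin \o cst K).
- move=> n; apply/measurable_EFinP; exact: continuous_prod_measurable.
- exact/measurable_EFinP.
- case: N0 => M [mM M0 NM]; exists M; split => // w /= /not_implyP[Dw nc].
  apply: NM; apply: contrapT => nN; apply: nc; apply/cvg_EFin; last exact: fcvg.
  by near=> n.
- apply: continuous_integrable_rect; exact: cst_continuous.
- by apply: aeW => w n Dw /=; rewrite lee_fin; exact: fK.
move=> fi _ cv; apply: fine_cvg; rewrite fineK//; exact: integrable_fin_num.
Unshelve. all: by end_near. Qed.
End rect_limits.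

Section sphere_symmetry.
Context {R : realType}.
Local Notation mu := (@lebesgue_measure R).
Local Notation mu2 := (@lebesgue_measure R \x @lebesgue_measure R)%E.
Implicit Types (F : R * R * R -> R).

Lemma sin_neq0_2pi (t : R) : 0 <= t <= 2 * pi -> t != 0 -> t != pi -> t != 2 * pi ->
  sin t != 0.
Proof.
move=> /andP[t0 t2] n0 npi n2pi; have [tpi|tpi] := ltP t pi.
  by rewrite gt_eqF// sin_gt0_pi// lt_neqAle eq_sym n0 t0.
rewrite -[t](subrK pi) sinDpi oppr_eq0 gt_eqF// sin_gt0_pi//.
by rewrite subr_gt0 lt_neqAle eq_sym npi tpi/= ltrBlDr lt_neqAle -mulr2n -mulr_natl n2pi.
Qed.

(** The weight tends to 1 wherever [y] is nonzero. At the poles the area factor [sin p] already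
    vanishes, so only the meridians [t = 0], [pi], [2 * pi] are discarded. *)
Lemma SI_weight_cvg F : continuous F ->
  SI (fun v => F v * (v.1.2 ^+ 2 / (v.1.2 ^+ 2 + n.+1%:R^-1))) @[n --> \oo] --> SI F.
Proof.
move=> cF; pose N : set (R * R) :=
  (setT `*` [set 0]) `|` ((setT `*` [set pi]) `|` (setT `*` [set 2 * pi])).
have cFs := continuous_sph cF.
have d0 (n : nat) (y : R) : 0 < y ^+ 2 + n.+1%:R^-1.
  by rewrite ltr_wpDl ?sqr_ge0// invr_gt0.
have [K FK] := @continuous_rect_bounded _ _ 0 pi 0 (2 * pi) cFs.
apply: (@Rintegral_rect_cvg _ _ _ N _ _ _ _ K).
- move=> n; rewrite /sph; ctn; apply: contV; first by rewrite gt_eqF.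
  by ctn.
- exact: continuous_prod_measurable.
- move=> n w Dw; rewrite mulrAC normrM (le_trans _ (FK w Dw))// ler_piMr//.
  rewrite ger0_norm ?divr_ge0 ?sqr_ge0 ?(ltW (d0 _ _))//.
  by rewrite ler_pdivrMr// mul1r lerDl invr_ge0.
- do 2?[apply: negligibleU]; exact: negligible_setX2.
- move=> [p t] [/=]; rewrite !in_itv/= => p0pi t02pi nN.
  have [sp0|sp0] := eqVneq (sin p) 0.
    by rewrite sp0; under eq_fun do rewrite mulr0; rewrite mulr0; exact: cvg_cst.
  have st0 : sin t != 0.
    apply: sin_neq0_2pi => //; apply/eqP => tE; apply: nN; rewrite tE.
    + by left.
    + by right; left.
    + by right; right.
  apply: cvgM; last exact: cvg_cst.
  rewrite -[X in _ --> X]mulr1; apply: cvgM; first exact: cvg_cst.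
  set y := sin p * sin t; have y0 : y ^+ 2 != 0 by rewrite sqrf_eq0 mulf_neq0.
  rewrite -[X in _ --> X](divff y0); apply: cvgM; first exact: cvg_cst.
  apply: cvgV => //; rewrite -[X in _ --> X]addr0; apply: cvgD; first exact: cvg_cst.
  exact: cvg_harmonic.
Qed.

Lemma SI_swap13 F : continuous F -> SI F = SI (F \o swap13).
Proof.
move=> cF; have cFs : continuous (F \o swap13) by rewrite /swap13/comp; ctn.
have E n : SI (fun v => F (swap13 v) * (v.1.2 ^+ 2 / (v.1.2 ^+ 2 + n.+1%:R^-1))) =
           SI (fun v => F v * (v.1.2 ^+ 2 / (v.1.2 ^+ 2 + n.+1%:R^-1))).
  (* [swap13] fixes [y], hence also this denominator; the weighted invariance applied to [G] yields
     the factor [y ^+ 2 / (y ^+ 2 + 1 / (n + 1))] on both sides. *)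
  pose G v := F v / (v.1.2 ^+ 2 + n.+1%:R^-1).
  have cG : continuous G.
    rewrite /G; ctn; apply: contV; last by ctn.
    by rewrite gt_eqF// ltr_wpDl ?sqr_ge0// invr_gt0.
  have := SI_swap13_sq cG; rewrite /G/SI/= => GE.
  transitivity (\int[mu2]_(w in `[0, pi] `*` `[0, 2 * pi])
    (F (swap13 (sph w)) / ((sin w.1 * sin w.2) ^+ 2 + n.+1%:R^-1) *
     (sin w.1 * sin w.2) ^+ 2 * sin w.1)).
    by apply: eq_Rintegral => w _; congr (_ * _); rewrite mulrA mulrAC.
  rewrite -GE.
  by apply: eq_Rintegral => w _; congr (_ * _); rewrite mulrA mulrAC.
have cvs := SI_weight_cvg cFs; rewrite /= in cvs.
have cv : SI (fun v => F (swap13 v) * (v.1.2 ^+ 2 / (v.1.2 ^+ 2 + n.+1%:R^-1))) @[n --> \oo]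
   --> SI F.
  by rewrite (funext E); exact: SI_weight_cvg.
exact: (cvg_unique _ cv cvs).
Qed.

Definition rotz (c : R) (v : R * R * R) : R * R * R :=
  (v.1.1 * cos c - v.1.2 * sin c, v.1.1 * sin c + v.1.2 * cos c, v.2).

Lemma is_derive_shift (A : R -> R) (x c d : R) :
  is_derive (x + c) 1 A d -> is_derive x 1 (fun u => A (u + c)) d.
Proof.
move=> dA; have dp : is_derive x 1 (fun u : R => u + c) 1.
  have := is_deriveD (is_derive_id x 1) (is_derive_cst (c : R) x 1).
  by rewrite addr0.
by have := is_derive1_comp (g := fun u : R => u + c) dA dp; rewrite mulr1.
Qed.

Lemma Rintegral_periodic (g : R -> R) (c T : R) : 0 <= T -> continuous g ->
  (forall t, g (t + T) = g t) ->
  \int[mu]_(t in `[0, T]) g (t + c) = \int[mu]_(t in `[0, T]) g t.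
Proof.
move=> T0 cg gT.
have [A dA] := continuous_antiderivative (- `|c| - 1) cg.
have E (u v : R) : - `|c| <= u -> u <= v -> \int[mu]_(x in `[u, v]) g x = A v - A u.
  move=> au uv; apply: Rintegral_FTC => // x /andP[ux _]; apply: dA.
  by rewrite (lt_le_trans _ (le_trans au ux))// ltrBlDr ltrDl.
have c0 : - `|c| <= c by rewrite lerNl -normrN ler_norm.
have n0 : - `|c| <= 0 by rewrite oppr_le0.
(* The increment of the antiderivative over one period has derivative [g (x + T) - g x = 0], so it
   is the same from every starting point. *)
have BE (u v : R) : - `|c| <= u -> u <= v -> A (u + T) - A u = A (v + T) - A v.
  move=> cu uv; apply/esym/eqP; rewrite -subr_eq0; apply/eqP.
  transitivity (\int[mu]_(x in `[u, v]) (0 : R)); last by rewrite Rintegral_cst// mul0r.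
  apply/esym/(Rintegral_FTC (F := fun u => A (u + T) - A u)) => //.
  - exact: cst_continuous.
  - move=> x /andP[ux xv].
    have cx : - `|c| - 1 < x by rewrite (lt_le_trans _ (le_trans cu ux))// ltrBlDr ltrDl.
    have d1 : is_derive x 1 (fun u => A (u + T)) (g (x + T)).
      have dT : is_derive (x + T) 1 A (g (x + T)).
        by apply: dA; rewrite (lt_le_trans cx)// lerDl.
      exact: is_derive_shift.
    have := is_deriveB d1 (dA x cx).
    by rewrite gT subrr.
rewrite (E 0 T)//.
transitivity (A (T + c) - A (0 + c)); last first.
  rewrite add0r [T + c]addrC -[in RHS](add0r T).
  by have [c00|c00] := leP 0 c; [rewrite (BE 0 c)|rewrite (BE c 0)// ltW].
apply: (Rintegral_FTC (F := fun t => A (t + c))) => //.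
  by ctn.
move=> x /andP[x0 xT].
have dT : is_derive (x + c) 1 A (g (x + c)).
  apply: dA; rewrite (lt_le_trans (y := - `|c|))// ?ltrBlDr ?ltrDl//.
  by rewrite (le_trans c0)// lerDr.
exact: is_derive_shift.
Qed.

Lemma SI_rotz c F : continuous F -> SI (F \o rotz c) = SI F.
Proof.
move=> cF; have cFr : continuous (F \o rotz c) by rewrite /rotz/comp; ctn.
rewrite /SI (Rintegral_rect12 _ _ _ _ (continuous_sph cFr)).
rewrite (Rintegral_rect12 _ _ _ _ (continuous_sph cF)).
apply: eq_Rintegral => p _.
have pi0 := pi_ge0 R.
rewrite -(@Rintegral_periodic (fun t => F (sph (p, t)) * sin p) c (2 * pi)).
- apply: eq_Rintegral => t _.
  by rewrite /rotz /sph/= cosD sinD; congr (F (_, _, _) * _); ring.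
- by rewrite mulr_ge0.
- by rewrite /sph; ctn.
- by move=> t; rewrite /sph/= mulr_natl cosD2pi sinD2pi.
Qed.
End sphere_symmetry.

(** * Integrals of functions of two inner products *)

Section two_dots.
Context {R : realType}.
Implicit Types (u v a b : R * R * R).

Definition dot3 u v : R := u.1.1 * v.1.1 + u.1.2 * v.1.2 + u.2 * v.2.

Lemma polar_coordinates (x y r : R) : 0 <= r -> r ^+ 2 = x ^+ 2 + y ^+ 2 ->
  exists t, x = r * cos t /\ y = r * sin t.
Proof.
move=> r0 rE; have [r00|rn0] := eqVneq r 0.
  move: rE; rewrite r00 expr0n/= => /esym/eqP.
  rewrite paddr_eq0 ?sqr_ge0// !sqrf_eq0 => /andP[/eqP-> /eqP->].
  by exists 0; rewrite !mul0r.
have rp : 0 < r by rewrite lt_neqAle eq_sym rn0.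
have x1 : -1 <= x / r <= 1.
  by rewrite ler_pdivlMr// ler_pdivrMr//; apply/andP; split; nra.
have sE : 1 - (x / r) ^+ 2 = (y / r) ^+ 2.
  by rewrite !expr_div_n -(divff (x := r ^+ 2)) ?expf_eq0 ?(negbTE rn0)// -mulrBl rE addrC addKr.
have cE : cos (acos (x / r)) = x / r by rewrite acosK// in_itv.
have [y0|y0] := leP 0 y.
  exists (acos (x / r)); rewrite cE sin_acos// sE sqrtr_sqr ger0_norm ?divr_ge0//.
  by split; field.
exists (- acos (x / r)); rewrite cosN sinN cE sin_acos// sE sqrtr_sqr ler0_norm.
  by split; field.
by rewrite pmulr_lle0 ?invr_gt0// ltW.
Qed.

Lemma dot3_rotz c u v : dot3 (rotz c u) (rotz c v) = dot3 u v.
Proof.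
rewrite /dot3 /rotz/=; have := cos2Dsin2 c; set p := cos c; set q := sin c => pq.
transitivity ((u.1.1 * v.1.1 + u.1.2 * v.1.2) * (p ^+ 2 + q ^+ 2) + u.2 * v.2); first ring.
by rewrite pq mulr1.
Qed.

Lemma dot3_swap13 u v : dot3 (swap13 u) (swap13 v) = dot3 u v.
Proof. rewrite /dot3 /swap13/=; ring. Qed.

Lemma SI_dot3_rotz (F : R * R -> R) c a b : continuous F ->
  SI (fun v => F (dot3 v a, dot3 v b)) =
  SI (fun v => F (dot3 v (rotz c a), dot3 v (rotz c b))).
Proof.
move=> cF; rewrite -(@SI_rotz _ c (fun v => F (dot3 v (rotz c a), dot3 v (rotz c b)))).
  by rewrite /comp; under [in RHS]eq_fun do rewrite !dot3_rotz.
by rewrite /dot3; ctn.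
Qed.

Lemma SI_dot3_swap13 (F : R * R -> R) a b : continuous F ->
  SI (fun v => F (dot3 v a, dot3 v b)) =
  SI (fun v => F (dot3 v (swap13 a), dot3 v (swap13 b))).
Proof.
move=> cF; rewrite [RHS]SI_swap13; last by rewrite /dot3; ctn.
by rewrite /comp; under [in RHS]eq_fun do rewrite !dot3_swap13.
Qed.

Lemma rotz_to_y (u : R * R * R) : exists c,
  rotz c u = (0, Num.sqrt (u.1.1 ^+ 2 + u.1.2 ^+ 2), u.2).
Proof.
have [||t [y x]] := @polar_coordinates u.1.2 u.1.1 (Num.sqrt (u.1.1 ^+ 2 + u.1.2 ^+ 2)).
- exact: sqrtr_ge0.
- by rewrite sqr_sqrtr ?addr_ge0 ?sqr_ge0// addrC.
exists t; rewrite /rotz; set r := Num.sqrt _ in x y *; congr (_, _, _).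
  by rewrite x y; ring.
by rewrite x y -[RHS]mulr1 -(cos2Dsin2 t); ring.
Qed.

Lemma rotz_to_x (u : R * R * R) : exists c,
  rotz c u = (Num.sqrt (u.1.1 ^+ 2 + u.1.2 ^+ 2), 0, u.2).
Proof.
have [||t [x y]] := @polar_coordinates u.1.1 u.1.2 (Num.sqrt (u.1.1 ^+ 2 + u.1.2 ^+ 2)).
- exact: sqrtr_ge0.
- by rewrite sqr_sqrtr ?addr_ge0 ?sqr_ge0// addrC.
exists (- t); rewrite /rotz sinN cosN; set r := Num.sqrt _ in x y *; congr (_, _, _).
  by rewrite x y -[RHS]mulr1 -(cos2Dsin2 t); ring.
by rewrite x y; ring.
Qed.

(** [rotz] and [swap13] suffice: [a] is rotated into the plane [x = 0], swapped into the equator,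
    rotated to [(1, 0, 0)] and swapped to the pole. A last [rotz] fixes the pole and moves the image
    of [b] to longitude 0. *)
Lemma SI_dot3_normal_form (F : R * R -> R) a b : continuous F ->
  dot3 a a = 1 -> dot3 b b = 1 ->
  SI (fun v => F (dot3 v a, dot3 v b)) =
  SI (fun v => F (v.2, v.1.1 * Num.sqrt (1 - dot3 a b ^+ 2) + v.2 * dot3 a b)).
Proof.
move=> cF; have [c1 E1] := rotz_to_y a.
rewrite (SI_dot3_rotz c1 a b cF) -(dot3_rotz c1 a a) -(dot3_rotz c1 b b) -(dot3_rotz c1 a b).
rewrite SI_dot3_swap13// -(dot3_swap13 (rotz c1 a) (rotz c1 a)).
rewrite -(dot3_swap13 (rotz c1 b)) -(dot3_swap13 (rotz c1 a)).
rewrite E1; set a1 := swap13 (0, _, _); set b1 := swap13 (rotz c1 b) => a11.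
have [c2 E2] := rotz_to_x a1.
have {E2}E2 : rotz c2 a1 = (1, 0, 0).
  rewrite E2; congr (_, _, _) => //; rewrite -[RHS]sqrtr1 -a11 /dot3/a1/=.
  by congr Num.sqrt; ring.
rewrite (SI_dot3_rotz c2 a1 b1 cF) -(dot3_rotz c2 b1 b1) -(dot3_rotz c2 a1 b1) E2.
rewrite SI_dot3_swap13// -(dot3_swap13 (rotz c2 b1)) -(dot3_swap13 (1, 0, 0)).
rewrite [swap13 (1, 0, 0)]/swap13/=; set b2 := swap13 _ => b21.
have [c3 E3] := rotz_to_x b2.
rewrite (SI_dot3_rotz c3 (0, 0, 1) b2 cF) -(dot3_rotz c3 (0, 0, 1) b2) E3.
rewrite /rotz/=.
have -> : Num.sqrt (b2.1.1 ^+ 2 + b2.1.2 ^+ 2) =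
  Num.sqrt (1 - b2.2 ^+ 2).
  by congr Num.sqrt; rewrite -b21 /dot3; ring.
congr SI; apply/funext => v.
by rewrite /dot3/= !(oppr0, mul0r, mulr0, mulr1, mul1r, add0r, addr0, subr0).
Qed.
End two_dots.

(** * Arc cosine and the spherical triangle inequality *)

Section arccos.
Context {R : realType}.
Implicit Types (u v w p : R).

Definition clamp1 u : R := Num.max (-1) (Num.min 1 u).
(* Unlike [acos], continuous on all of [R]. *)
Definition acosc u : R := acos (clamp1 u).

Lemma clamp1_itv u : -1 <= clamp1 u <= 1.
Proof. by rewrite /clamp1 le_max lexx/= ge_max ge_min lexx/= andbT; lra. Qed.

Lemma clamp1_id u : -1 <= u <= 1 -> clamp1 u = u.
Proof. by move=> /andP[u1 u2]; rewrite /clamp1 (min_idPr u2) (max_idPr u1). Qed.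

Lemma acosc_id u : -1 <= u <= 1 -> acosc u = acos u.
Proof. by move=> u1; rewrite /acosc clamp1_id. Qed.

Lemma acosc_cos p : 0 <= p <= pi -> acosc (cos p) = p.
Proof. by move=> p0; rewrite acosc_id ?cos_geN1 ?cos_le1// cosK// in_itv. Qed.

Lemma acosc_itv u : 0 <= acosc u <= pi.
Proof. by rewrite /acosc acos_ge0 ?acos_lepi ?clamp1_itv. Qed.

Lemma acoscN u : acosc (- u) = pi - acosc u.
Proof.
rewrite /acosc -acosN ?clamp1_itv//; congr acos.
have [u1|u1] := leP (-1) u; last first.
  rewrite /clamp1 [Num.min 1 u]min_r; last lra.
  by rewrite [Num.max _ u]max_l; [rewrite min_l ?max_r ?opprK//; lra|lra].
have [u2|u2] := leP u 1; first by rewrite !clamp1_id//; apply/andP; split; lra.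
rewrite /clamp1 min_r; last lra.
by rewrite max_l; [rewrite min_l ?max_r//; lra|lra].
Qed.

Lemma cos_mono_le p q : 0 <= p <= pi -> 0 <= q <= pi -> (cos p <= cos q) = (q <= p).
Proof.
by move=> p0 q0; rewrite !leNgt ltr_cos ?in_itv.
Qed.

Lemma acos_mono u v : -1 <= u <= 1 -> -1 <= v <= 1 -> (acos u <= acos v) = (v <= u).
Proof.
move=> u1 v1; rewrite -cos_mono_le ?acos_ge0 ?acos_lepi// !acosK// in_itv.
Qed.

(** A decreasing surjection between segments is continuous; this covers the end points -1 and 1,
    where [acos] is not differentiable. Composition with the continuous [clamp1] extends it to
    [R]. *)
Lemma continuous_acosc : continuous acosc.
Proof.
have ca : {within `[-1, 1], continuous (@acos R)}.
  apply: segment_dec_surj_continuous.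
    by move=> x y; rewrite !in_itv/= => x1 y1; exact: acos_mono.
  move=> y/=; rewrite acos1 acosN1 in_itv/= => y0; exists (cos y).
    by rewrite /= in_itv/= cos_geN1 cos_le1.
  by rewrite cosK// in_itv.
move=> u.
have cc : clamp1 t @[t --> u] --> within [set` `[-1, 1]] (nbhs (clamp1 u)).
  have c0 : continuous clamp1 by rewrite /clamp1; ctn.
  move=> A /= wA.
  have h : nbhs u (clamp1 @^-1` (fun t => `[-1, 1]%classic t -> A t)) := c0 u _ wA.
  change (nbhs u (clamp1 @^-1` A)); apply: filterS h => t /=; apply.
  by rewrite in_itv/=; exact: clamp1_itv.
have ca' : acos t @[t --> within [set` `[-1, 1]] (nbhs (clamp1 u))] --> acosc u.
  have /subspace_continuousP := ca; apply.
  by rewrite /= in_itv/= clamp1_itv.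
exact: (cvg_comp _ _ cc ca').
Qed.

(** The last hypothesis states that a Gram determinant is nonnegative, that is
    [(v w - u)^2 <= (1 - v^2) (1 - w^2)]; its right side is the square of the sine product in
    [cos (acos v + acos w)]. *)
Lemma acos_triangle u v w : -1 <= u <= 1 -> -1 <= v <= 1 -> -1 <= w <= 1 ->
  u ^+ 2 + v ^+ 2 + w ^+ 2 <= 1 + 2 * u * v * w -> acos u <= acos v + acos w.
Proof.
move=> u1 v1 w1 gram; have av0 := acos_ge0 v1; have aw0 := acos_ge0 w1.
have [spi|spi] := leP pi (acos v + acos w).
  by rewrite (le_trans _ spi)// acos_lepi.
rewrite -cos_mono_le ?acos_ge0 ?acos_lepi ?addr_ge0 ?(ltW spi)//.
rewrite cosD !acosK ?in_itv// !sin_acos// -sqrtrM; last first.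
  by move: v1 => /andP[? ?]; nra.
rewrite lerBlDr -lerBlDl (le_trans (ler_norm _))// -sqrtr_sqr ler_wsqrtr//.
rewrite -subr_ge0; apply: le_trans (_ : 1 + 2 * u * v * w - (u ^+ 2 + v ^+ 2 + w ^+ 2) <= _).
  by rewrite subr_ge0.
by rewrite le_eqVlt; apply/orP; left; apply/eqP; ring.
Qed.

(** The Gram determinant is the square of the triple product [D]. *)
Lemma dot3_gram (a b c : R * R * R) : dot3 a a = 1 -> dot3 b b = 1 -> dot3 c c = 1 ->
  dot3 a b ^+ 2 + dot3 a c ^+ 2 + dot3 b c ^+ 2 <= 1 + 2 * dot3 a b * dot3 a c * dot3 b c.
Proof.
move=> a1 b1 c1; rewrite -subr_ge0.
pose D := a.1.1 * (b.1.2 * c.2 - b.2 * c.1.2) - a.1.2 * (b.1.1 * c.2 - b.2 * c.1.1)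
  + a.2 * (b.1.1 * c.1.2 - b.1.2 * c.1.1).
suff -> : 1 + 2 * dot3 a b * dot3 a c * dot3 b c -
  (dot3 a b ^+ 2 + dot3 a c ^+ 2 + dot3 b c ^+ 2) = D ^+ 2 by exact: sqr_ge0.
(* Restoring the squared norms makes the claim a polynomial identity in the coordinates. *)
transitivity (dot3 a a * dot3 b b * dot3 c c + 2 * dot3 a b * dot3 a c * dot3 b c -
  (dot3 a b ^+ 2 * dot3 c c + dot3 a c ^+ 2 * dot3 b b + dot3 b c ^+ 2 * dot3 a a)).
  by rewrite a1 b1 c1 !mulr1.
by rewrite /dot3 /D; ring.
Qed.

Lemma dot3_cauchy (a b : R * R * R) : dot3 a a = 1 -> dot3 b b = 1 -> -1 <= dot3 a b <= 1.
Proof.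
move=> a1 b1.
have s0 : 0 <= dot3 (a.1.1 - b.1.1, a.1.2 - b.1.2, a.2 - b.2) (a.1.1 - b.1.1, a.1.2 - b.1.2, a.2 - b.2).
  by rewrite /dot3 !addr_ge0// -expr2 sqr_ge0.
have s1 : 0 <= dot3 (a.1.1 + b.1.1, a.1.2 + b.1.2, a.2 + b.2) (a.1.1 + b.1.1, a.1.2 + b.1.2, a.2 + b.2).
  by rewrite /dot3 !addr_ge0// -expr2 sqr_ge0.
by move: a1 b1 s0 s1; rewrite /dot3/= => a1 b1 s0 s1; apply/andP; split; nra.
Qed.

Lemma angle_triangle (x a b : R * R * R) : dot3 x x = 1 -> dot3 a a = 1 -> dot3 b b = 1 ->
  `|acosc (dot3 x a) - acosc (dot3 x b)| <= acosc (dot3 a b).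
Proof.
move=> x1 a1 b1.
rewrite !acosc_id; [|exact: dot3_cauchy..].
have g := dot3_gram x1 a1 b1.
rewrite ler_norml lerBlDr lerBrDl; apply/andP; split.
  rewrite lerBlDr; apply: acos_triangle; try exact: dot3_cauchy.
  by move: g; lra.
by rewrite addrC; apply: acos_triangle; try exact: dot3_cauchy; lra.
Qed.
End arccos.

(** * The truncated angle under a small displacement of the point *)

Section two_point.
Context {R : realType}.
Implicit Types (th u p q d : R).

(* The slope is 1 on the two polar caps of radius [th] and 0 between them. *)
Definition polar_trunc th p : R := Num.min p th + Num.max (p - (pi - th)) 0.

Lemma polar_truncE th p : 0 < th -> th <= pi / 2 ->
  polar_trunc th p =
  if p <= th then p else if p <= pi - th then th else p - (pi - 2 * th).
Proof.
move=> th0 thpi; have h : th <= pi - th by lra.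
rewrite /polar_trunc; have [p1|p1] := leP p th.
  by rewrite max_r ?addr0//; lra.
have [p2|p2] := leP p (pi - th); first by rewrite max_r ?addr0//; lra.
by rewrite max_l; lra.
Qed.

Lemma polar_trunc_le th p : 0 < th -> th <= pi / 2 ->
  polar_trunc th p <= p.
Proof. by move=> th0 thpi; rewrite polar_truncE//; case: (leP p) => ?; last case: (leP p) => ?; lra. Qed.

Lemma polar_truncN th p : 0 < th -> th <= pi / 2 ->
  polar_trunc th (pi - p) = 2 * th - polar_trunc th p.
Proof.
move=> th0 thpi; rewrite !polar_truncE//.
have [h1|h1] := leP p th; have [h2|h2] := leP (pi - p) th;
  have [h3|h3] := leP p (pi - th); have [h4|h4] := leP (pi - p) (pi - th); lra.
Qed.

Lemma polar_trunc_lipschitz th p q : 0 < th -> th <= pi / 2 ->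
  `|polar_trunc th p - polar_trunc th q| <= `|p - q|.
Proof.
move=> th0 thpi; wlog pq : p q / p <= q.
  move=> H; have [/H//|/ltW/H] := leP p q.
  by rewrite distrC [X in _ <= X]distrC.
rewrite [leRHS]ler0_norm ?subr_le0// ler_norml !polar_truncE//.
by have [h1|h1] := leP p th; have [h2|h2] := leP q th;
  have [h3|h3] := leP p (pi - th); have [h4|h4] := leP q (pi - th);
  apply/andP; split; lra.
Qed.

Definition angle_trunc th u : R := polar_trunc th (acosc u).

Lemma continuous_angle_trunc th : continuous (angle_trunc th).
Proof.
have ca := @continuous_acosc R.
by rewrite /angle_trunc /polar_trunc; ctn.
Qed.

Lemma angle_trunc_lipschitz th (x a b : R * R * R) : 0 < th -> th <= pi / 2 ->
  dot3 x x = 1 -> dot3 a a = 1 -> dot3 b b = 1 ->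
  `|angle_trunc th (dot3 x a) - angle_trunc th (dot3 x b)| <= acosc (dot3 a b).
Proof. by move=> *; rewrite (le_trans (polar_trunc_lipschitz _ _ _ _))// angle_triangle. Qed.

(* [sin p * cos t * sin d + cos p * cos d] is the cosine of the distance from the point
   [(p, t)] to the pole moved by [d] along the meridian of longitude [0]. *)
Lemma is_derive_angle_trunc th p t : 0 < th -> th <= pi / 2 ->
  0 < p < pi -> p != th -> p != pi - th ->
  is_derive (0 : R) 1 (fun d : R => angle_trunc th (sin p * cos t * sin d + cos p * cos d))
    (- cos t * ((p <= th) || (pi - th <= p))%:R).
Proof.
move=> th0 thpi p0 nth1 nth2.
have sp0 : 0 < sin p by exact: sin_gt0_pi.
have c1 : -1 < cos p < 1.
  case/andP: (p0) => p1 p2; apply/andP; split.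
    by rewrite -(cospi R) ltr_cos ?in_itv/= ?lexx ?pi_ge0 ?ltW.
  by rewrite -(cos0 R) ltr_cos ?in_itv/= ?lexx ?pi_ge0 ?ltW.
have dg : is_derive (0 : R) 1 (fun d : R => sin p * cos t * sin d + cos p * cos d) (sin p * cos t).
  have := is_deriveD (is_deriveZ (sin p * cos t) (is_derive_sin 0))
    (is_deriveZ (cos p) (is_derive_cos 0)).
  by rewrite cos0 sin0 oppr0 scaler0 addr0 /GRing.scale/= mulr1.
have g0 : sin p * cos t * sin 0 + cos p * cos 0 = cos p.
  by rewrite sin0 cos0 mulr0 mulr1 add0r.
have dacos : is_derive (cos p) 1 acosc (- (sin p)^-1).
  apply: (@near_eq_is_derive _ _ _ (@acos R)); last first.
    have := is_derive1_acos c1.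
    by rewrite -sin2cos2 sqrtr_sqr ger0_norm// ltW.
  have : \forall u \near cos p, u \in `]-1, 1[ by apply: near_in_itvoo; rewrite in_itv.
  apply: filterS => u; rewrite in_itv/= => /andP[u1 u2].
  by rewrite acosc_id// !ltW.
have near_p (P : set R) : nbhs p P -> \forall u \near cos p, P (acosc u).
  move=> Pp; apply: continuous_acosc; rewrite acosc_cos//.
  by case/andP: p0 => /ltW-> /ltW->.
(* Away from the two kinks, a neighbourhood of [p] lies in a single linear piece of [polar_trunc];
   the three cases are the three pieces. *)
have dtr : is_derive (cos p) 1 (angle_trunc th)
    (- (sin p)^-1 * ((p <= th) || (pi - th <= p))%:R).
  have [pth|pth|/eqP] := ltgtP p th; last by rewrite (negbTE nth1).
    rewrite mulr1; apply: near_eq_is_derive dacos.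
    have := near_p _ (lt_nbhsl pth); apply: filterS => u uth.
    by rewrite /angle_trunc polar_truncE// (ltW uth).
  have [pth2|pth2|/eqP/esym] := ltgtP p (pi - th); last by rewrite (negbTE nth2).
    rewrite mulr0; apply: near_eq_is_derive (is_derive_cst th (cos p) 1).
    apply: filterS2 (near_p _ (lt_nbhsl pth2)) (near_p _ (lt_nbhsr pth)) => u u2 u1.
    by rewrite /angle_trunc polar_truncE// leNgt u1/= ltW.
  rewrite mulr1; apply: (near_eq_is_derive (f := fun u => acosc u - (pi - 2 * th))).
    apply: filterS2 (near_p _ (lt_nbhsr pth2)) (near_p _ (lt_nbhsr pth)) => u u2 u1.
    by rewrite /angle_trunc polar_truncE// leNgt u1/= leNgt u2.
  have := is_deriveB dacos (is_derive_cst (pi - 2 * th) (cos p) 1).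
  by rewrite subr0.
rewrite -g0 in dtr.
have := is_derive1_comp
  (g := fun d : R => sin p * cos t * sin d + cos p * cos d) dtr dg.
set e := (p <= th) || _; have -> : - (sin p)^-1 * e%:R * (sin p * cos t) = - cos t * e%:R.
  by field; rewrite gt_eqF.
by [].
Qed.
End two_point.

Section two_point_limit.
Context {R : realType}.
Local Notation mu := (@lebesgue_measure R).
Local Notation mu2 := (@lebesgue_measure R \x @lebesgue_measure R)%E.
Implicit Types (th u p q d : R).

(** On the caps, the absolute rate of change of the truncated angle as the pole starts to move,
    times the area factor. *)
Definition pole_density (w : R * R) : R := `|cos w.2| * sin w.1.

(** Where [sin p = 0] both sides vanish; elsewhere the limit is the absolute value of the derivative
    at 0, read along the sequence [u]. *)
Lemma pole_quotient_cvg th (u : nat -> R) p t : 0 < th -> th <= pi / 2 ->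
  (forall n, 0 < u n) -> u n @[n --> \oo] --> 0 -> 0 <= p <= pi -> p != th -> p != pi - th ->
  `|angle_trunc th (cos p) -
    angle_trunc th (sin p * cos t * sin (u n) + cos p * cos (u n))| * sin p / u n
    @[n --> \oo] -->
  ((p <= th) || (pi - th <= p))%:R * (`|cos t| * sin p).
Proof.
move=> th0 thpi u0 uc p0 nth1 nth2.
have [sp0|sp0] := eqVneq (sin p) 0.
  rewrite sp0 !mulr0; under eq_fun do rewrite mulr0 mul0r; exact: cvg_cst.
have p0' : 0 < p < pi.
  case/andP: p0; rewrite !le_eqVlt => /predU1P[p00|->].
    by move: sp0; rewrite -p00 sin0 eqxx.
  by case/predU1P => // ppi; move: sp0; rewrite ppi sinpi eqxx.
have [dd de] := @is_derive_angle_trunc R th p t th0 thpi p0' nth1 nth2.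
move: dd; rewrite /derivable => /cvg_ex[/= l cl].
have lE : l = - cos t * ((p <= th) || (pi - th <= p))%:R.
  by rewrite -de; apply/esym/cvg_lim.
move: cl => /cvgr_dnbhsP /(_ u) cu.
have {}cu := cu (conj (fun n => lt0r_neq0 (u0 n)) uc).
have cL : `|(u n)^-1 *: (angle_trunc th (sin p * cos t * sin (u n *: 1 + 0) +
   cos p * cos (u n *: 1 + 0)) - angle_trunc th (sin p * cos t * sin 0 + cos p * cos 0))|
   * sin p @[n --> \oo] --> `|l| * sin p.
  by apply: cvgM; [exact: cvg_norm|exact: cvg_cst].
have -> : ((p <= th) || (pi - th <= p))%:R * (`|cos t| * sin p) = `|l| * sin p.
  by rewrite lE normrM normrN normr_nat mulrA [_%:R * _]mulrC.
apply: cvg_trans cL; apply: near_eq_cvg; apply: nearW => n /=.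
rewrite [u n *: 1](_ : _ = u n); last by rewrite /GRing.scale/= mulr1.
rewrite addr0 sin0 cos0 mulr0 mulr1 add0r normrZ normfV (ger0_norm (ltW (u0 n))).
by rewrite [in RHS]distrC [RHS]mulrAC; congr (_ * _); rewrite mulrC.
Qed.

Lemma continuous_pole_density : continuous pole_density.
Proof. by rewrite /pole_density; ctn. Qed.

Lemma Rintegral_abs_cos : \int[mu]_(t in `[0, 2 * pi]) `|cos t| = 4 :> R.
Proof.
have pi0 := pi_gt0 R.
have cc : continuous (fun t : R => `|cos t|) by ctn.
have ccos : continuous (fun t : R => - cos t) by ctn.
rewrite (Rintegral_cat (b := pi / 2))//; [|lra|lra].
rewrite (Rintegral_cat (a := pi / 2) (b := 3 * (pi / 2)))//; [|lra|lra].
have cE (t : R) : cos t = - cos (t - pi).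
  by rewrite -[in LHS](subrK pi t) cosDpi.
have e1 : \int[mu]_(t in `[0, pi / 2]) `|cos t| = 1 :> R.
  transitivity (\int[mu]_(t in `[0, pi / 2]) (cos t : R)).
    apply: eq_Rintegral => t /set_mem; rewrite /= in_itv/= => /andP[t1 t2].
    rewrite ger0_norm// cos_ge0_pihalf//; apply/andP; split; lra.
  rewrite (@Rintegral_FTC _ _ sin) ?sin_pihalf ?sin0 ?subr0//; first lra.
  exact: continuous_cos.
have e2 : \int[mu]_(t in `[pi / 2, 3 * (pi / 2)]) `|cos t| = 2 :> R.
  transitivity (\int[mu]_(t in `[pi / 2, 3 * (pi / 2)]) (- cos t : R)).
    apply: eq_Rintegral => t /set_mem; rewrite /= in_itv/= => /andP[t1 t2].
    rewrite ler0_norm// cE oppr_le0 cos_ge0_pihalf//; apply/andP; split; lra.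
  rewrite (@Rintegral_FTC _ _ (- sin))//; last lra.
    have -> : 3 * (pi / 2) = pi / 2 + pi :> R by field.
    by rewrite /= !fctE sinDpi sin_pihalf opprK; ring.
have H3 (s : R) : 3 * (pi / 2) <= s -> s <= 2 * pi -> 0 <= cos s.
  move=> s1 s2; rewrite -[s](subrK (pi *+ 2)) cosD2pi cos_ge0_pihalf//.
  by rewrite [pi *+ 2]mulr2n; apply/andP; split; lra.
have e3 : \int[mu]_(t in `[3 * (pi / 2), 2 * pi]) `|cos t| = 1 :> R.
  transitivity (\int[mu]_(t in `[3 * (pi / 2), 2 * pi]) (cos t : R)).
    apply: eq_Rintegral => t /set_mem; rewrite /= in_itv/= => /andP[t1 t2].
    by rewrite ger0_norm// H3.
  rewrite (@Rintegral_FTC _ _ sin)//; [|lra|exact: continuous_cos].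
    have -> : 3 * (pi / 2) = pi / 2 + pi :> R by field.
    by rewrite mulr_natl sin2pi sinDpi sin_pihalf; ring.
by rewrite e1 e2 e3; ring.
Qed.

Lemma Rintegral_pole_density a b : a <= b ->
  \int[mu2]_(w in `[a, b] `*` `[0, 2 * pi]) pole_density w = 4 * (cos a - cos b).
Proof.
move=> ab; rewrite (Rintegral_rect12 _ _ _ _ continuous_pole_density).
transitivity (\int[mu]_(p in `[a, b]) (4 * sin p)).
  apply: eq_Rintegral => p _; rewrite -Rintegral_abs_cos /pole_density/= RintegralZr//.
  by apply: continuous_integrable_itv; ctn.
rewrite RintegralZl//; last exact/continuous_integrable_itv/continuous_sin.
congr (_ * _); rewrite -[cos a]opprK addrC.
apply: (Rintegral_FTC (F := - cos)) => //; first exact: continuous_sin.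
by move=> x _; have := is_deriveN (is_derive_cos x); rewrite opprK.
Qed.

(** The total change, over all viewpoints, of the truncated angle between two points at distance
    [d], placed in normal form: the pole and the point of colatitude [d] at longitude 0. *)
Definition pole_shift_integral th d : R :=
  SI (fun v => `|angle_trunc th v.2 - angle_trunc th (v.1.1 * sin d + v.2 * cos d)|).

Lemma dot3_sph (w : R * R) : dot3 (sph w) (sph w) = 1.
Proof.
rewrite /dot3 /sph/= -[RHS](cos2Dsin2 w.1).
transitivity (sin w.1 ^+ 2 * (cos w.2 ^+ 2 + sin w.2 ^+ 2) + cos w.1 ^+ 2); first ring.
by rewrite cos2Dsin2 mulr1 addrC.
Qed.

(** Provides the constant bound 1 on the difference quotients for dominated convergence. Beyond
    [d = pi] it holds because angles lie in [[0, pi]]. *)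
Lemma pole_shift_le th p t d : 0 < th -> th <= pi / 2 -> 0 <= d ->
  `|angle_trunc th (cos p) - angle_trunc th (sin p * cos t * sin d + cos p * cos d)| <= d.
Proof.
move=> th0 thpi d0; have [dpi|dpi] := leP d pi; last first.
  rewrite (le_trans (polar_trunc_lipschitz _ _ th0 thpi))// (le_trans _ (ltW dpi))//.
  have /andP[h1 h2] := acosc_itv (cos p).
  have /andP[h3 h4] := acosc_itv (sin p * cos t * sin d + cos p * cos d).
  rewrite ler_norml; apply/andP; split; lra.
have := @angle_trunc_lipschitz _ th (sph (p, t)) (sph (0, 0)) (sph (d, 0)) th0 thpi
  (dot3_sph _) (dot3_sph _) (dot3_sph _).
rewrite /dot3/sph/= sin0 cos0 !(mul0r, mulr0, mulr1, add0r, addr0, mul1r).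
by rewrite acosc_cos ?d0.
Qed.

Lemma pole_shift_integral_cvg th : 0 < th -> th <= pi / 2 ->
  pole_shift_integral th d / d @[d --> 0^'+] --> 8 * (1 - cos th).
Proof.
move=> th0 thpi; apply/cvg_at_rightP => u [u0 uc].
have pi0 := pi_gt0 R.
pose D : set (R * R) := `[0, pi] `*` `[0, 2 * pi].
pose P1 : set (R * R) := `]-oo, th] `*` setT.
pose P2 : set (R * R) := `[pi - th, +oo[ `*` setT.
pose f w := (pole_density \_ P1) w + (pole_density \_ P2) w.
have D1 : D `&` P1 = `[0, th] `*` `[0, 2 * pi].
  rewrite eqEsubset; split=> -[p t] /=; rewrite /D /P1/= !in_itv/=.
    by move=> [[/andP[-> _] ->] [-> _]].
  by move=> [/andP[-> h] ->]; rewrite h; split => //; split => //=; lra.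
have D2 : D `&` P2 = `[pi - th, pi] `*` `[0, 2 * pi].
  rewrite eqEsubset; split=> -[p t] /=; rewrite /D /P2/= !in_itv/=.
    by move=> [[/andP[_ ->] ->]]; rewrite andbT => -[-> _].
  by move=> [/andP[h ->] ->]; rewrite h; split => //; split => //=; rewrite andbT; lra.
have mD : measurable (D : set (measurableTypeR R * measurableTypeR R)).
  exact: measurable_rect.
have mP1 : measurable (P1 : set (measurableTypeR R * measurableTypeR R)) by exact: measurableX.
have mP2 : measurable (P2 : set (measurableTypeR R * measurableTypeR R)) by exact: measurableX.
have ch := continuous_pole_density.
have int1 : mu2.-integrable D (EFin \o (pole_density \_ P1)).
  rewrite -restrict_EFin; apply: (integrable_restrict _ mP1 mD _).1; rewrite D1.
  exact: continuous_integrable_rect.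
have int2 : mu2.-integrable D (EFin \o (pole_density \_ P2)).
  rewrite -restrict_EFin; apply: (integrable_restrict _ mP2 mD _).1; rewrite D2.
  exact: continuous_integrable_rect.
have intf : mu2.-integrable D (EFin \o f) by exact: (integrableD mD int1 int2).
have fE : \int[mu2]_(w in D) f w = 8 * (1 - cos th).
  rewrite RintegralD// -!Rintegral_mkcondr D1 D2 !Rintegral_pole_density; [|lra|lra].
  by rewrite cos0 cospi -[pi - th]addrC cosDpi cosN; ring.
have ca := @continuous_angle_trunc R th.
pose f_ n (w : R * R) := `|angle_trunc th (cos w.1) -
    angle_trunc th (sin w.1 * cos w.2 * sin (u n) + cos w.1 * cos (u n))| * sin w.1 / u n.
have f_E n : pole_shift_integral th (u n) / u n = \int[mu2]_(w in D) f_ n w.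
  rewrite /pole_shift_integral /SI /f_ -RintegralZr//.
  by apply: continuous_integrable_rect; rewrite /sph; ctn.
under eq_fun do rewrite f_E; rewrite -fE.
apply: (@Rintegral_rect_cvg _ f_ f (([set th] `*` setT) `|` ([set (pi - th)] `*` setT))
  0 pi 0 (2 * pi) 1).
- by move=> n; rewrite /f_; ctn.
- by apply/measurable_EFinP; case/integrableP: intf.
- move=> n [p t] [/=]; rewrite !in_itv/= => p0 _.
  have sp0 := sin_ge0_pi p0.
  rewrite /f_/= ger0_norm; last by rewrite divr_ge0 ?mulr_ge0 ?(ltW (u0 n)).
  rewrite ler_pdivrMr// mul1r -[leRHS]mulr1 ler_pM ?sin_le1//.
  exact: pole_shift_le th0 thpi (ltW (u0 n)).
- by apply: negligibleU; exact: negligible_setX1.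
- move=> [p t] [/=]; rewrite !in_itv/= => p0 t0 nN.
  have nth1 : p != th by apply/eqP => pE; apply: nN; left.
  have nth2 : p != pi - th by apply/eqP => pE; apply: nN; right.
  have := @pole_quotient_cvg th u p t th0 thpi u0 uc p0 nth1 nth2.
  rewrite /f_/= /f; suff -> : (pole_density \_ P1) (p, t) + (pole_density \_ P2) (p, t) =
    ((p <= th) || (pi - th <= p))%:R * (`|cos t| * sin p) by [].
  rewrite !patchE !in_setX !in_setT !andbT !mem_setE !in_itv/= andbT.
  (* Both caps can contain [p] only when [p = th = pi / 2], which is excluded here; hence the two
     restrictions never count a point twice. *)
  have [h1|h1] := leP p th; have [h2|h2] := leP (pi - th) p; rewrite ?(mul1r, mul0r, addr0, add0r)//.
  by move/eqP: nth1; case; lra.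
Qed.
End two_point_limit.

(** * From the limit to an estimate by chords *)

Section chord_estimate.
Context {R : realType}.
Implicit Types (th d e : R) (a b v : R * R * R).

Definition sub3 a b : R * R * R := (a.1.1 - b.1.1, a.1.2 - b.1.2, a.2 - b.2).

Definition norm3 a : R := Num.sqrt (dot3 a a).

(** Used at [x = d / 2]: the chord [2 sin (d / 2)] is at least [cos (d / 2)] times the arc [d]. *)
Lemma sin_ge_cos (x : R) : 0 <= x <= pi / 2 -> x * cos x <= sin x.
Proof.
have pi0 := pi_gt0 R.
move=> /andP[]; rewrite le_eqVlt => /predU1P[<-|x0 x1]; first by rewrite mul0r sin0.
have [|c] := @MVT R sin cos 0 x x0.
- exact/continuous_subspaceT/continuous_sin.
rewrite in_itv/= sin0 !subr0 => /andP[c0 cx] ->.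
rewrite mulrC ler_wpM2r ?ltW// ltr_cos// ?in_itv/=; apply/andP; split; lra.
Qed.

Lemma norm3_chord a b : dot3 a a = 1 -> dot3 b b = 1 ->
  norm3 (sub3 a b) = 2 * sin (acosc (dot3 a b) / 2).
Proof.
move=> a1 b1; have ab := dot3_cauchy a1 b1; have pi0 := pi_gt0 R.
have /andP[d0 dpi] := acosc_itv (dot3 a b).
have cE : cos (acosc (dot3 a b)) = dot3 a b by rewrite acosc_id// acosK// in_itv.
have E : dot3 (sub3 a b) (sub3 a b) = 2 - 2 * dot3 a b.
  transitivity (dot3 a a + dot3 b b - 2 * dot3 a b); last by rewrite a1 b1.
  by rewrite /dot3/sub3/=; ring.
rewrite /norm3 E -[in LHS]cE; set d := acosc _.
have -> : 2 - 2 * cos d = (2 * sin (d / 2)) ^+ 2.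
  have -> : d = (d / 2) *+ 2 by rewrite -mulr_natr; field.
  rewrite cos_mulr2n [in RHS](_ : (d / 2) *+ 2 / 2 = d / 2); last by rewrite -mulr_natr; field.
  by rewrite exprMn sin2cos2 -mulr_natr; ring.
rewrite sqrtr_sqr ger0_norm// mulr_ge0// sin_ge0_pi//; apply/andP; split; rewrite /d; lra.
Qed.

Lemma SI_angle_trunc th a b : dot3 a a = 1 -> dot3 b b = 1 ->
  SI (fun v => `|angle_trunc th (dot3 v a) - angle_trunc th (dot3 v b)|) =
  pole_shift_integral th (acosc (dot3 a b)).
Proof.
move=> a1 b1; have ca := @continuous_angle_trunc R th.
have ab := dot3_cauchy a1 b1.
have cF : continuous (fun w : R * R => `|angle_trunc th w.1 - angle_trunc th w.2|) by ctn.
rewrite (SI_dot3_normal_form cF a1 b1).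
by rewrite /pole_shift_integral (acosc_id ab) (sin_acos ab) acosK// in_itv.
Qed.

(** Polygon lengths are measured in chords while the limit concerns arcs; [e] pays for both the
    error in the limit and the ratio of chord to arc. *)
Lemma SI_angle_trunc_chord th e : 0 < th -> th <= pi / 2 -> 0 < e ->
  exists2 r, 0 < r & forall a b, dot3 a a = 1 -> dot3 b b = 1 -> norm3 (sub3 a b) < r ->
    SI (fun v => `|angle_trunc th (dot3 v a) - angle_trunc th (dot3 v b)|) <=
    (8 * (1 - cos th) + e) * norm3 (sub3 a b).
Proof.
move=> th0 thpi e0; have pi0 := pi_gt0 R.
set c := 8 * (1 - cos th); have c0 : 0 <= c by rewrite mulr_ge0// subr_ge0 cos_le1.
have near1 : \forall d \near 0^'+, pole_shift_integral th d / d < c + e / 2.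
  have /cvgrPdist_lt/(_ (e / 2)) := pole_shift_integral_cvg th0 thpi.
  move=> /(_ ltac:(lra)); apply: filterS => d; rewrite ltr_norml => /andP[h1 h2].
  by rewrite /c; lra.
(* The first half of [e] bounds the quotient by [c + e / 2]; this threshold for the chord-to-arc
   ratio turns [c + e / 2] into [c + e]. *)
have near2 : \forall d \near 0^'+, (c + e / 2) / (c + e) < cos (d / 2).
  have ch : continuous (fun d : R => cos (d / 2)) by ctn.
  have cv : cos (d / 2) @[d --> (0:R)^'+] --> cos (0 / 2) := cvg_at_right_filter (ch 0).
  rewrite mul0r cos0 in cv; apply: (cvgr_gt _ cv); rewrite ltr_pdivrMr ?mul1r; lra.
have near3 : \forall d \near (0:R)^'+, d <= pi by exact: nbhs_right_le.
have [d0 /= d00 H] : exists2 d0 : R, 0 < d0 & forall d, 0 < d < d0 ->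
   pole_shift_integral th d <= (c + e) * (2 * sin (d / 2)).
  have [d0 d00 H] := filterI near1 (filterI near2 near3).
  exists d0 => // d /andP[dp dd0].
  have [|//|h1 [h2 h3]] := H d; first by rewrite /= sub0r normrN gtr0_norm.
  have cd0 : 0 < c + e by lra.
  move: h1 h2; rewrite ltr_pdivrMr// ltr_pdivrMr// => h1 h2.
  have h4 : (d / 2) * cos (d / 2) <= sin (d / 2).
    by apply: sin_ge_cos; apply/andP; split; lra.
  apply: le_trans (ltW h1) _.
  apply: (@le_trans _ _ ((c + e) * (2 * ((d / 2) * cos (d / 2))))); last first.
    by rewrite ler_pM2l// ler_pM2l.
  have -> : (c + e) * (2 * ((d / 2) * cos (d / 2))) = cos (d / 2) * (c + e) * d by field.
  by rewrite ler_pM2r// ltW.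
(* Half-arcs stay in [[0, pi / 2]], where [sin] increases; so a chord below this value forces an arc
   below [d0]. *)
exists (2 * sin (Num.min d0 pi / 2)).
  rewrite mulr_gt0// sin_gt0_pi//; case: (leP d0 pi) => ?; apply/andP; split; lra.
move=> a b a1 b1; rewrite norm3_chord// SI_angle_trunc//.
have /andP[] := acosc_itv (dot3 a b); set d := acosc _.
rewrite le_eqVlt => /predU1P[<- _ _|dp dpi].
  rewrite mul0r sin0 !mulr0 /pole_shift_integral sin0 cos0 /SI.
  rewrite /Rintegral integral0_eq// => w _.
  by rewrite mulr0 mulr1 add0r subrr normr0 mul0r.
rewrite ltr_pM2l// ltr_sin; first last.
- by rewrite in_itv/=; case: (leP d0 pi) => ?; apply/andP; split; lra.
- by rewrite in_itv/=; apply/andP; split; lra.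
rewrite ltr_pM2r ?invr_gt0// lt_min => /andP[dd0 _].
by apply: H; rewrite dp.
Qed.
End chord_estimate.

(** * Row vectors versus coordinate triples; distance to a set *)

Section sphere_layer.
Context {R : realType}.
Local Notation mu := (@lebesgue_measure R).
Local Notation mu2 := (@lebesgue_measure R \x @lebesgue_measure R)%E.
Implicit Types (x y u v : 'rV[R]_3) (C : set 'rV[R]_3).

Definition tr x : R * R * R := (xcoord x, ycoord x, zcoord x).

Lemma tr_vec3 (a b c : R) : tr (vec3 a b c) = (a, b, c).
Proof. by rewrite /tr /xcoord /ycoord /zcoord /vec3 !mxE !inordK. Qed.

Lemma vec3_tr x : vec3 (xcoord x) (ycoord x) (zcoord x) = x.
Proof.
apply/rowP => i; rewrite /vec3 mxE /xcoord /ycoord /zcoord.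
case: i => -[|[|[|//]]] i3 /=; congr (x _ _); apply/val_inj; rewrite /= inordK//.
Qed.

Lemma tr_inj : injective tr.
Proof. by move=> x y [hx hy hz]; rewrite -(vec3_tr x) -(vec3_tr y) hx hy hz. Qed.

Lemma dotE u v : dot u v = dot3 (tr u) (tr v).
Proof.
rewrite -{1}(vec3_tr u) -{1}(vec3_tr v) /dot !big_ord_recl big_ord0 addr0.
by rewrite /vec3 !mxE/= /dot3 /tr/= addrA.
Qed.

Lemma trB u v : tr (u - v) = sub3 (tr u) (tr v).
Proof. by rewrite /tr /sub3 /xcoord /ycoord /zcoord !mxE. Qed.

Lemma enormE u : enorm u = norm3 (tr u).
Proof. by rewrite /enorm /norm3 dotE. Qed.

Lemma enorm_ge0 u : 0 <= enorm u.
Proof. exact: sqrtr_ge0. Qed.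

Lemma sphereP x : sphere x <-> dot3 (tr x) (tr x) = 1.
Proof.
rewrite /sphere /= /enorm dotE; split => [h|->]; last exact: sqrtr1.
have h0 : 0 <= dot3 (tr x) (tr x) by rewrite /dot3 !addr_ge0// -expr2 sqr_ge0.
by rewrite -(sqr_sqrtr h0) h expr1n.
Qed.

Lemma tr_spherical (p t : R) : tr (spherical p t) = sph (p, t).
Proof. by rewrite /spherical tr_vec3. Qed.

Lemma sphere_spherical (p t : R) : sphere (spherical p t).
Proof. by apply/sphereP; rewrite tr_spherical dot3_sph. Qed.

Lemma trN x : tr (- x) = (- xcoord x, - ycoord x, - zcoord x).
Proof. by rewrite /tr /xcoord /ycoord /zcoord !mxE. Qed.

Lemma dotNl x y : dot (- x) y = - dot x y.
Proof. by rewrite !dotE trN /dot3 /tr/=; ring. Qed.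

Lemma sphereN x : sphere x -> sphere (- x).
Proof. by move=> /sphereP; rewrite -dotE => h; apply/sphereP; rewrite -dotE dotNl !dotE trN /dot3/=; move: h; rewrite dotE /dot3/=; lra. Qed.

Lemma acos_dot x y : sphere x -> sphere y -> acos (dot x y) = acosc (dot3 (tr x) (tr y)).
Proof. by move=> /sphereP x1 /sphereP y1; rewrite dotE acosc_id// dot3_cauchy. Qed.

Lemma sdist_le C x y : C `<=` sphere -> sphere x -> C y ->
  sdist x C <= acosc (dot3 (tr x) (tr y)).
Proof.
move=> CS xS Cy; rewrite -acos_dot//; last exact: CS.
apply: ge_inf; last by exists y.
exists 0 => _ [z Cz <-]; rewrite acos_dot//; last exact: CS.
by case/andP: (acosc_itv (dot3 (tr x) (tr z))).
Qed.

Lemma sdist_ge C x (m : R) : C `<=` sphere -> sphere x -> C !=set0 ->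
  (forall y, C y -> m <= acosc (dot3 (tr x) (tr y))) -> m <= sdist x C.
Proof.
move=> CS xS [y0 Cy0] h; apply: lb_le_inf; first by exists (acos (dot x y0)), y0.
by move=> _ [z Cz <-]; rewrite acos_dot ?h//; exact: CS.
Qed.

Lemma sdist_lipschitz C x y : C `<=` sphere -> C !=set0 -> sphere x -> sphere y ->
  `|sdist x C - sdist y C| <= acosc (dot3 (tr x) (tr y)).
Proof.
move=> CS C0.
suff H u v : sphere u -> sphere v -> sdist u C - sdist v C <= acosc (dot3 (tr u) (tr v)).
  move=> xS yS; rewrite ler_norml lerNl opprB H// andbT.
  by have := H y x yS xS; rewrite /dot3 [(tr y).1.1 * _]mulrC [(tr y).1.2 * _]mulrC [(tr y).2 * _]mulrC.
move=> uS vS; rewrite lerBlDr -lerBlDl; apply: sdist_ge => // z Cz.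
rewrite lerBlDl (le_trans (sdist_le CS uS Cz))// -lerBlDr.
have zS := CS _ Cz.
have := @angle_triangle R (tr z) (tr u) (tr v) (iffLR (sphereP _) zS)
  (iffLR (sphereP _) uS) (iffLR (sphereP _) vS).
have sym a b : @dot3 R a b = dot3 b a by rewrite /dot3; ring.
by rewrite !(sym (tr z)); apply: le_trans; exact: ler_norm.
Qed.

Lemma continuous_sdist_spherical C : C `<=` sphere -> C !=set0 ->
  continuous (fun w : R * R => sdist (spherical w.1 w.2) C).
Proof.
move=> CS C0 w; apply/cvgrPdist_le => /= e e0.
have ca := @continuous_acosc R.
have cd : continuous (fun v : R * R => acosc (dot3 (sph w) (sph v))).
  by rewrite /dot3 /sph; ctn.
have := cd w; rewrite /continuous_at dot3_sph -[X in acosc X]cos0 acosc_cos ?lexx ?pi_ge0//.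
move=> /cvgrPdist_le/(_ e e0); apply: filterS => v; rewrite sub0r normrN => ve.
rewrite (le_trans (sdist_lipschitz CS C0 (sphere_spherical _ _) (sphere_spherical _ _)))//.
by rewrite !tr_spherical (le_trans (ler_norm _))//; case: (v) (w) ve => ? ? [].
Qed.

Lemma sphericalN (p t : R) : - spherical p t = spherical (pi - p) (t + pi).
Proof.
apply/tr_inj; rewrite trN /xcoord /ycoord /zcoord !mxE !inordK//= tr_spherical /sph/=.
rewrite sinDpi cosDpi [pi - p]addrC sinDpi cosDpi sinN cosN.
by congr (_, _, _); ring.
Qed.

(** In coordinates the antipode is [(pi - p, t + pi)]: periodicity absorbs the shift of [t], then
    the integrals are exchanged and [p] is reflected. *)
Lemma sphere_integralN (f : 'rV[R]_3 -> R) : continuous (fun w : R * R => f (spherical w.1 w.2)) ->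
  sphere_integral (fun x => f (- x)) = sphere_integral f.
Proof.
move=> cf.
pose h (w : R * R) := f (spherical w.1 w.2).
have ch : continuous h by [].
have pi0 := pi_ge0 R.
have -> : sphere_integral (fun x => f (- x)) =
    \int[mu2]_(w in `[0, pi] `*` `[0, 2 * pi]) (h (pi - w.1, w.2 + pi) * sin w.1).
  by apply: eq_Rintegral => w _; rewrite /h sphericalN.
rewrite Rintegral_rect12; last by ctn.
transitivity (\int[mu]_(p in `[0, pi]) \int[mu]_(t in `[0, 2 * pi]) (h (pi - p, t) * sin p)).
  apply: eq_Rintegral => p _.
  apply: (@Rintegral_periodic _ (fun t => h (pi - p, t) * sin p) pi).
  - by rewrite mulr_ge0.
  - by ctn.
  - by move=> t; rewrite /h/= /spherical mulr_natl cosD2pi sinD2pi.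
rewrite /sphere_integral.
have c1 : continuous (fun w : R * R => h (pi - w.1, w.2) * sin w.1) by ctn.
have c2 : continuous (fun w : R * R => h (w.1, w.2) * sin w.1) by ctn.
rewrite -(Rintegral_rect12 _ _ _ _ c1) (Rintegral_rect21 _ _ _ _ c1).
rewrite [RHS](Rintegral_rect21 _ _ _ _ c2).
apply: eq_Rintegral => t _ /=.
have c3 : continuous (fun p : R => h (p, t) * sin p) by ctn.
have c4 : continuous (fun _ : R => 1 : R) by ctn.
have dF (x : R) : is_derive x 1 (fun p : R => pi - p) (- 1).
  have := is_deriveB (is_derive_cst (pi : R) x 1) (is_derive_id x 1).
  by rewrite sub0r.
have := Rintegral_subst_decr pi0 c3 c4 dF.
rewrite subrr subr0 => <-//.
by apply: eq_Rintegral => p _; rewrite mulr1 [pi - p]addrC sinDpi sinN opprK.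
Qed.

Lemma spherical_flipy (p t : R) :
  vec3 (xcoord (spherical p t)) (- ycoord (spherical p t)) (zcoord (spherical p t)) =
  spherical p (2 * pi - t).
Proof.
apply/tr_inj; rewrite tr_vec3 tr_spherical /sph/=.
have /= [-> -> ->] := tr_spherical p t.
rewrite cosB sinB mulr_natl cos2pi sin2pi.
by congr (_, _, _); ring.
Qed.

Lemma sphere_integral_flipy (f : 'rV[R]_3 -> R) : continuous (fun w : R * R => f (spherical w.1 w.2)) ->
  sphere_integral (fun x => f (vec3 (xcoord x) (- ycoord x) (zcoord x))) = sphere_integral f.
Proof.
move=> cf.
pose h (w : R * R) := f (spherical w.1 w.2).
have ch : continuous h by [].
have pi0 := pi_ge0 R.
have -> : sphere_integral (fun x => f (vec3 (xcoord x) (- ycoord x) (zcoord x))) =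
    \int[mu2]_(w in `[0, pi] `*` `[0, 2 * pi]) (h (w.1, 2 * pi - w.2) * sin w.1).
  by apply: eq_Rintegral => w _; rewrite /h spherical_flipy.
have c1 : continuous (fun w : R * R => h (w.1, 2 * pi - w.2) * sin w.1) by ctn.
have c2 : continuous (fun w : R * R => h (w.1, w.2) * sin w.1) by ctn.
rewrite /sphere_integral (Rintegral_rect12 _ _ _ _ c1) [RHS](Rintegral_rect12 _ _ _ _ c2).
apply: eq_Rintegral => p _ /=.
have c3 : continuous (fun t : R => h (p, t) * sin p) by ctn.
have c4 : continuous (fun _ : R => 1 : R) by ctn.
have dF (x : R) : is_derive x 1 (fun t : R => 2 * pi - t) (- 1).
  have := is_deriveB (is_derive_cst (2 * pi : R) x 1) (is_derive_id x 1).
  by rewrite sub0r.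
have p20 : 0 <= 2 * pi :> R by rewrite mulr_ge0.
have := Rintegral_subst_decr p20 c3 c4 dF.
rewrite subrr subr0 => <-//.
by apply: eq_Rintegral => t _; rewrite mulr1.
Qed.

Lemma SI_cst (c : R) : SI (fun=> c) = 4 * pi * c.
Proof.
have pi0 := pi_ge0 R.
have c1 : continuous (fun w : R * R => c * sin w.1) by ctn.
rewrite /SI (Rintegral_rect12 _ _ _ _ c1).
transitivity (\int[mu]_(p in `[0, pi]) (2 * pi * c * sin p)).
  apply: eq_Rintegral => p _; rewrite /= Rintegral_cst//.
  rewrite [X in _ * fine X](_ : _ = (2 * pi)%:E) /=; first by ring.
  rewrite [LHS]lebesgue_measure_itv/= lte_fin mulr_gt0//; last exact: pi_gt0.
  by rewrite oppr0 addr0.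
rewrite RintegralZl//; last exact/continuous_integrable_itv/continuous_sin.
rewrite (_ : \int[mu]_(p in `[0, pi]) sin p = 2); first by ring.
transitivity ((- cos) pi - (- cos) 0 : R); last first.
  by rewrite !fctE cospi cos0; ring.
apply: Rintegral_FTC => //; first exact: continuous_sin.
by move=> x _; have := is_deriveN (is_derive_cos x); rewrite opprK.
Qed.

Lemma continuous_sum {T : topologicalType} (F : nat -> T -> R) N :
  (forall k, continuous (F k)) -> continuous (fun t => \sum_(k < N) F k t).
Proof.
move=> cF; elim: N => [|N IH]; first by under eq_fun do rewrite big_ord0; exact: cst_continuous.
by under eq_fun do rewrite big_ord_recr/=; move=> t; apply: contD; [exact: IH|exact: cF].
Qed.

Lemma SI_sum N (F : nat -> R * R * R -> R) : (forall k, continuous (F k)) ->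
  SI (fun w => \sum_(k < N) F k w) = \sum_(k < N) SI (F k).
Proof.
move=> cF; elim: N => [|N IH].
  by under eq_fun do rewrite big_ord0; rewrite SI_cst mulr0 big_ord0.
have cS : continuous (fun w => \sum_(k < N) F k w) by exact: continuous_sum.
have cFN := cF N.
rewrite big_ord_recr/= -IH /SI -RintegralD//.
- by apply: eq_Rintegral => w _; rewrite big_ord_recr/= mulrDl.
- exact: measurable_rect.
- exact: continuous_integrable_rect (continuous_sph cS).
- exact: continuous_integrable_rect (continuous_sph cFN).
Qed.
End sphere_layer.

(** * The lower bound for closed curves *)

Section lower_bound.
Context {R : realType}.
Implicit Types (C : set 'rV[R]_3) (a b r : R).

(** The near-covering form of compactness merges the local statements, valid for [s] near [x] and
    small [d], into one [d] for the whole segment. *)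
Lemma heine_cantor (f : R -> R) a b r : {within `[a, b], continuous f} -> 0 < r ->
  exists2 d, 0 < d & forall s t, s \in `[a, b] -> t \in `[a, b] -> `|s - t| < d ->
    `|f s - f t| < r.
Proof.
move=> cf r0.
have cov := (compact_near_coveringP `[a, b]%classic).1 (@segment_compact R a b).
pose P (d s : R) := s \in `[a, b] -> forall t, t \in `[a, b] -> `|s - t| < d -> `|f s - f t| < r.
have H : \forall d \near (0 : R)^'+, `[a, b]%classic `<=` P d.
  apply: cov => x xab.
  have /subspace_continuousP/(_ x xab) := cf.
  move=> /cvgrPdist_lt/(_ (r / 2)); rewrite divr_gt0// => /(_ isT).
  move=> [e /= e0 He].
  have e20 : 0 < e / 2 by rewrite divr_gt0.
  exists (ball x (e / 2), [set d | d < e / 2]) => /=.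
    by split; [exact: nbhsx_ballx|exact: nbhs_right_lt].
  move=> [s d] /= [xs de] sab t tab st.
  have h1 : `|f x - f s| < r / 2.
    by apply: He; rewrite //= ?(lt_trans xs)// ltr_pdivrMr// ltr_pMr// ltr1n.
  have h2 : `|f x - f t| < r / 2.
    apply: He; rewrite //=; have -> : x - t = (x - s) + (s - t) by ring.
    by rewrite (le_lt_trans (ler_normD _ _))// [ltRHS]splitr ltrD// (lt_trans st).
  have -> : f s - f t = (f x - f t) - (f x - f s) by ring.
  by rewrite (le_lt_trans (ler_normB _ _))// [ltRHS]splitr ltrD.
have [e /= e0 He] := H.
exists (e / 2); first by rewrite divr_gt0.
move=> s t sab tab st; apply: (He (e / 2)) => //=.
  by rewrite sub0r normrN gtr0_norm ?divr_gt0// ltr_pdivrMr// ltr_pMr// ltr1n.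
by rewrite divr_gt0.
Qed.

(** The indices [i] and [j] cut the closed chain into two arcs, one of them through the base point
    [u 0 = u N]. Each has variation at least [|u i - u j|], so twice the gap is at most the
    total. *)
Lemma closed_chain_gap (u : nat -> R) N i j : u N = u 0%N -> (i <= N)%N -> (j <= N)%N ->
  u i - u j <= 2^-1 * \sum_(k < N) `|u k.+1 - u k|.
Proof.
move=> uN iN jN.
have tel m n : (m <= n)%N -> `|u n - u m| <= \sum_(m <= k < n) `|u k.+1 - u k|.
  by move=> mn; rewrite -telescope_sumr//; exact: ler_norm_sum.
have H i' j' : (i' <= j')%N -> (j' <= N)%N ->
    `|u i' - u j'| <= 2^-1 * \sum_(k < N) `|u k.+1 - u k|.
  move=> ij jN'; have iN' := leq_trans ij jN'.
  rewrite -(big_mkord xpredT (fun k => `|u k.+1 - u k|)).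
  rewrite (big_cat_nat (leq0n i') iN')/= (big_cat_nat ij jN')/=.
  have h1 := tel _ _ (leq0n i'); have h2 := tel _ _ ij; have h3 := tel _ _ jN'.
  rewrite uN in h3.
  have h4 : `|u i' - u j'| <= `|u i' - u 0%N| + `|u 0%N - u j'|.
    by rewrite -[X in `|X| <= _](subrKA (u 0%N)); exact: ler_normD.
  rewrite distrC in h2; lra.
have [ij|ij] := leqP i j; first exact: le_trans (ler_norm _) (H _ _ ij jN).
by apply: le_trans (ler_norm _) _; rewrite distrC; exact: H (ltnW ij) iN.
Qed.

Lemma uniform_partition a b N : a < b ->
  itv_partition a b [seq a + (b - a) * (k%:R / N.+1%:R) | k <- iota 1 N.+1].
Proof.
move=> ab; pose f (k : nat) := a + (b - a) * (k%:R / N.+1%:R).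
have fa : f 0%N = a by rewrite /f mul0r mulr0 addr0.
have fb : f N.+1 = b by rewrite /f divff ?pnatr_eq0// mulr1 addrCA subrr addr0.
have pf : path <%R (f 0%N) (map f (iota 1 N.+1)).
  rewrite path_map; have := iota_ltn_sorted 0 N.+2; apply: sub_path => i j /= ij.
  rewrite /f ltrD2l ltr_pM2l ?subr_gt0//.
  by rewrite ltr_pM2r ?invr_gt0 ?ltr0n// ltr_nat.
have lf : last (f 0%N) (map f (iota 1 N.+1)) = f N.+1.
  by rewrite last_map -[X in iota _ X]addn1 iotaD last_cat/= add1n.
by rewrite fa in pf lf; split; rewrite // lf fb.
Qed.
End lower_bound.

Section lower_bound_curve.
Context {R : realType}.
Implicit Types (C : set 'rV[R]_3) (a b r th e : R).

Lemma norm3_le_sum (v : R * R * R) : norm3 v <= `|v.1.1| + `|v.1.2| + `|v.2|.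
Proof.
have s0 : 0 <= `|v.1.1| + `|v.1.2| + `|v.2| by rewrite !addr_ge0.
rewrite /norm3 -[leRHS](ger0_norm s0) -sqrtr_sqr ler_wsqrtr// /dot3 -!expr2.
rewrite -(real_normK (num_real v.1.1)) -(real_normK (num_real v.1.2)) -(real_normK (num_real v.2)).
have := normr_ge0 v.1.1; have := normr_ge0 v.1.2; have := normr_ge0 v.2.
by move: `|v.1.1| `|v.1.2| `|v.2| => x y z *; nra.
Qed.

Lemma curve_uniform_continuity (g : R -> 'rV[R]_3) a b r : {within `[a, b], continuous g} -> 0 < r ->
  exists2 d, 0 < d & forall s t, s \in `[a, b] -> t \in `[a, b] -> `|s - t| < d ->
    norm3 (sub3 (tr (g s)) (tr (g t))) < r.
Proof.
move=> cg r0; have r30 : 0 < r / 3 by rewrite divr_gt0.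
have cc (i : 'I_3) : {within `[a, b], continuous (fun s => g s 0 i)}.
  move=> s; apply: (@continuous_comp (subspace `[a, b]%classic) _ _ g
    (fun M : 'rV[R]_3 => M 0 i) s (cg s)).
  exact: coord_continuous.
have [d1 d10 H1] := heine_cantor (cc (inord 0)) r30.
have [d2 d20 H2] := heine_cantor (cc (inord 1)) r30.
have [d3 d30 H3] := heine_cantor (cc (inord 2)) r30.
exists (Num.min d1 (Num.min d2 d3)); first by rewrite !lt_min d10 d20.
move=> s t sab tab; rewrite !lt_min => /andP[h1 /andP[h2 h3]].
apply: (le_lt_trans (norm3_le_sum _)); rewrite /sub3 /tr /xcoord /ycoord /zcoord/=.
have -> : r = r / 3 + r / 3 + r / 3 by field.
by rewrite !ltrD ?H1 ?H2 ?H3.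
Qed.

Lemma acosc_small e : 0 < e -> exists2 r, 0 < r & forall p q : R * R * R,
  dot3 p p = 1 -> dot3 q q = 1 -> norm3 (sub3 p q) < r -> acosc (dot3 p q) < e.
Proof.
move=> e0; have := @continuous_acosc R 1; rewrite /continuous_at -[X in _ --> acosc X]cos0.
rewrite acosc_cos ?lexx ?pi_ge0// => /cvgrPdist_lt/(_ e e0)[d /= d0 H].
(* A chord below 1 exceeds its own square, and [1 - dot3 p q] is half of that square; so it is below
   [d] as well. *)
exists (Num.min 1 d); first by rewrite lt_min ltr01.
move=> p q p1 q1; rewrite lt_min => /andP[n1 nd].
have pq := dot3_cauchy p1 q1.
have n0 : 0 <= norm3 (sub3 p q) by exact: sqrtr_ge0.
have nE : norm3 (sub3 p q) ^+ 2 = 2 - 2 * dot3 p q.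
  rewrite sqr_sqrtr; last by rewrite /dot3 !addr_ge0// -expr2 sqr_ge0.
  transitivity (dot3 p p + dot3 q q - 2 * dot3 p q); last by rewrite p1 q1.
  by rewrite /dot3/sub3/=; ring.
have := H (dot3 p q); rewrite sub0r normrN ger0_norm; last by case/andP: (acosc_itv (dot3 p q)).
apply; rewrite /= ger0_norm; last by case/andP: pq; lra.
by nra.
Qed.

Lemma polygon_length_uniform (g : R -> 'rV[R]_3) a b N (f : nat -> R) :
  f 0%N = a ->
  polygon_length g a [seq f k | k <- iota 1 N] =
  \sum_(k < N) norm3 (sub3 (tr (g (f k.+1))) (tr (g (f k)))).
Proof.
move=> fa; rewrite /polygon_length size_map size_iota big_mkord.
have nf i : (i <= N)%N -> nth a (a :: [seq f k | k <- iota 1 N]) i = f i.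
  case: i => [|i] iN; first by rewrite fa.
  by rewrite /= (nth_map 0%N) ?size_iota// nth_iota.
by apply: eq_bigr => i _; rewrite !nf ?enormE ?trB// ltnW.
Qed.

Lemma SI_affine (c k : R) (F : R * R * R -> R) : continuous F ->
  SI (fun v => c - k * F v) = 4 * pi * c - k * SI F.
Proof.
move=> cF; rewrite -SI_cst.
have cF' : continuous (fun v => k * F v) by ctn.
have -> : k * SI F = SI (fun v => k * F v).
  rewrite /SI -RintegralZl//; [|exact: measurable_rect|].
    by apply: eq_Rintegral => w _; rewrite mulrA.
  exact: continuous_integrable_rect (continuous_sph cF).
rewrite /SI -RintegralB//.
- by apply: eq_Rintegral => w _; rewrite mulrBl.
- exact: measurable_rect.
- by apply: continuous_integrable_rect; ctn.
- exact: continuous_integrable_rect (continuous_sph cF').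
Qed.

(** The bound for one fine subdivision of the curve. The factor 2 on the right comes from adding the
    distances of [x] and [-x], the term [2 * e] from replacing two curve points by vertices, and
    [2^-1] from [closed_chain_gap]. *)
Lemma avg_dist_ge_aux C (L th e : R) : simple_closed_curve C L -> 0 < th -> th <= pi / 2 -> 0 < e ->
  4 * pi * (2 * th - 2 * e) - 2^-1 * ((8 * (1 - cos th) + e) * L) <= 2 * (4 * pi * avg_dist C).
Proof.
move=> [CS [a [b [g [[ab cg gab _ gC] gL]]]]] th0 thpi e0.
have pi0 := pi_gt0 R.
have gS s : s \in `[a, b] -> sphere (g s) by move=> sab; apply: CS; rewrite -gC; exists s.
have gS3 s : s \in `[a, b] -> dot3 (tr (g s)) (tr (g s)) = 1 by move=> /gS/sphereP.
have C0 : C !=set0 by exists (g a); rewrite -gC; exists a => //=; rewrite in_itv/= lexx ltW.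
have [r1 r10 H1] := SI_angle_trunc_chord th0 thpi e0.
have [r2 r20 H2] := acosc_small e0.
have r0 : 0 < Num.min r1 r2 by rewrite lt_min r10.
have [d d0 Hd] := curve_uniform_continuity cg r0.
have ba0 : 0 < b - a by rewrite subr_gt0.
(* Rounding down and using [N.+1] pieces makes the mesh strictly smaller than [d]. *)
pose N := Num.truncn ((b - a) / d).
have Nd : (b - a) / N.+1%:R < d.
  have /truncn_itv/andP[_] : 0 <= (b - a) / d by rewrite divr_ge0// ltW.
  by rewrite -/N ltr_pdivrMr// ltr_pdivrMr ?ltr0n// mulrC.
have N0 : 0 < N.+1%:R :> R by rewrite ltr0n.
pose f (k : nat) := a + (b - a) * (k%:R / N.+1%:R).
have fa : f 0%N = a by rewrite /f mul0r mulr0 addr0.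
have fb : f N.+1 = b by rewrite /f divff ?pnatr_eq0// mulr1 addrCA subrr addr0.
have fab k : (k <= N.+1)%N -> f k \in `[a, b].
  move=> kN; rewrite in_itv/= -[X in _ && (_ <= X)]fb /f lerDl lerD2l; apply/andP; split.
    by rewrite mulr_ge0 ?divr_ge0 ?ler0n// ltW.
  by rewrite ler_pM2l// ler_pM2r ?invr_gt0// ler_nat.
have fS k : f k.+1 - f k = (b - a) / N.+1%:R.
  by rewrite /f -natr1; field.
pose P k := tr (g (f k)).
have PS k : (k <= N.+1)%N -> dot3 (P k) (P k) = 1 by move=> kN; apply: gS3; exact: fab.
have sumL : \sum_(k < N.+1) norm3 (sub3 (P k.+1) (P k)) <= L.
  rewrite -lee_fin -gL; apply: ereal_sup_ubound; eexists; last first.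
    by rewrite -(@polygon_length_uniform _ _ b _ f fa).
  exact: uniform_partition.
(* The vertex index is the rescaled parameter rounded down, so [s] is within one mesh width of
   [f k]. *)
have near_pt s : s \in `[a, b] -> exists2 k, (k <= N.+1)%N & acosc (dot3 (tr (g s)) (P k)) < e.
  move=> sab; have := sab; rewrite in_itv/= => /andP[as_ sb].
  have x0 : 0 <= (s - a) / (b - a) * N.+1%:R.
    by rewrite mulr_ge0 ?divr_ge0 ?subr_ge0// ltW.
  have /andP[k1 k2] := truncn_itv x0; set k := Num.truncn _ in k1 k2.
  have kN : (k <= N.+1)%N.
    rewrite -(ler_nat R) (le_trans k1)// ler_piMl ?ler0n// ler_pdivrMr// mul1r.
    by rewrite lerD2r.
  exists k => //; apply: H2; [exact: gS3|exact: PS|].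
  apply: (lt_le_trans (Hd _ _ sab (fab _ kN) _)); last by rewrite ge_min lexx orbT.
  have sE : s = a + (b - a) * ((s - a) / (b - a) * N.+1%:R / N.+1%:R).
    by rewrite mulfK ?gt_eqF// [(b - a) * _]mulrC divfK ?gt_eqF// addrC subrK.
  apply: le_lt_trans Nd; rewrite {1}sE /f; set x := _ * N.+1%:R in x0 k1 k2 *.
  have -> : a + (b - a) * (x / N.+1%:R) - (a + (b - a) * (k%:R / N.+1%:R)) =
     (b - a) / N.+1%:R * (x - k%:R) by field.
  have m0 : 0 <= (b - a) / N.+1%:R by rewrite divr_ge0 ?(ltW ba0) ?(ltW N0).
  rewrite ger0_norm; last by rewrite mulr_ge0 ?subr_ge0.
  rewrite ler_piMr//.
  by rewrite lerBlDr addrC natr1 ltW.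
pose S (v : R * R * R) := \sum_(k < N.+1)
  `|angle_trunc th (dot3 v (P k.+1)) - angle_trunc th (dot3 v (P k))|.
have pointwise x : sphere x -> 2 * th - 2 * e - 2^-1 * S (tr x) <= sdist x C + sdist (- x) C.
  move=> xS; have xS3 := iffLR (sphereP _) xS; have nxS := sphereN xS.
  pose u k := angle_trunc th (dot3 (tr x) (P k)).
  have uN : u N.+1 = u 0%N by rewrite /u /P fb fa gab.
  have near_u s : s \in `[a, b] -> exists2 k, (k <= N.+1)%N &
      `|acosc (dot3 (tr x) (tr (g s))) - acosc (dot3 (tr x) (P k))| <= e.
    move=> sab; have [k kN ke] := near_pt s sab; exists k => //.
    by rewrite (le_trans (angle_triangle xS3 (gS3 _ sab) (PS _ kN)))// ltW.
  have dN (y : 'rV[R]_3) : dot3 (tr (- x)) (tr y) = - dot3 (tr x) (tr y).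
    by rewrite -!dotE dotNl.
  (* The curve points are replaced by the vertices [i] and [j]. Truncation bounds the angle to [P i]
     below by [u i], and the supplement of the angle to [P j] below by [2 * th - u j]. *)
  have main y y' : C y -> C y' -> 2 * th - 2 * e - 2^-1 * S (tr x) <=
      acosc (dot3 (tr x) (tr y)) + acosc (dot3 (tr (- x)) (tr y')).
    rewrite -gC => -[s sab <-] [s' sab' <-]; rewrite dN acoscN.
    have [i iN] := near_u s sab; have [j jN] := near_u s' sab'.
    rewrite !ler_norml => /andP[_ h1] /andP[h2 _].
    have gap := closed_chain_gap uN jN iN; rewrite -/(S (tr x)) in gap.
    have hi : u i <= acosc (dot3 (tr x) (P i)) by exact: polar_trunc_le.
    have hj : 2 * th - u j <= pi - acosc (dot3 (tr x) (P j)).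
      by rewrite -polar_truncN//; exact: polar_trunc_le.
    by move: gap h1 h2 hi hj; move: (S (tr x)) (u i) (u j) => *; lra.
  rewrite -lerBlDl; apply: sdist_ge => // y' Cy'.
  rewrite lerBlDl -lerBlDr; apply: sdist_ge => // y Cy.
  by rewrite lerBlDr; exact: main.
have ca := @continuous_angle_trunc R th.
have cK k : continuous (fun v : R * R * R =>
   `|angle_trunc th (dot3 v (P k.+1)) - angle_trunc th (dot3 v (P k))|).
  by rewrite /dot3; ctn.
have cS : continuous S by exact: (continuous_sum (N := N.+1) cK).
have cSd := continuous_sdist_spherical CS C0.
have -> : 4 * pi * avg_dist C = sphere_integral (fun x => sdist x C).
  by rewrite /avg_dist mulVKf// mulf_neq0 ?gt_eqF.
(* Each edge costs its chord by the choice of [r1], and the chords form an inscribed polygon, of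
   length at most [L]. *)
have SIS : SI S <= (8 * (1 - cos th) + e) * L.
  have -> : SI S = _ := SI_sum N.+1 cK; apply: le_trans (_ : _ <= \sum_(k < N.+1)
     (8 * (1 - cos th) + e) * norm3 (sub3 (P k.+1) (P k))) _.
    apply: ler_sum => k _; apply: H1; [exact: PS|by apply: PS; rewrite ltnW|].
    apply: (lt_le_trans (Hd _ _ (fab _ _) (fab _ _) _)) => //.
    - by rewrite ltnW.
    - by rewrite fS ger0_norm// divr_ge0// ltW.
    - by rewrite ge_min lexx.
  rewrite -mulr_sumr ler_wpM2l// addr_ge0 ?(ltW e0)// mulr_ge0// subr_ge0 cos_le1.
have low : SI (fun v => 2 * th - 2 * e - 2^-1 * S v) <=
    sphere_integral (fun x => sdist x C) + sphere_integral (fun x => sdist (- x) C).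
  have cSd' : continuous (fun w : R * R => sdist (- spherical w.1 w.2) C).
    pose h (w : R * R) := sdist (spherical w.1 w.2) C.
    have ch : continuous h by [].
    have -> : (fun w : R * R => sdist (- spherical w.1 w.2) C) =
        (fun w : R * R => h (pi - w.1, w.2 + pi)).
      by apply/funext => w; rewrite sphericalN.
    by ctn.
  have cA : continuous (fun v : R * R * R => 2 * th - 2 * e - 2^-1 * S v) by ctn.
  rewrite /sphere_integral -RintegralD//; first last.
  - by apply: continuous_integrable_rect; ctn.
  - by apply: continuous_integrable_rect; ctn.
  - exact: measurable_rect.
  apply: le_Rintegral.
  - exact: measurable_rect.
  - exact: continuous_integrable_rect (continuous_sph cA).
  - by apply: continuous_integrable_rect; ctn.
  - move=> [p t] [/=]; rewrite !in_itv/= => p0 _.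
    rewrite -mulrDl ler_wpM2r ?sin_ge0_pi// -tr_spherical.
    exact: pointwise (sphere_spherical p t).
have sN : sphere_integral (fun x => sdist (- x) C) = sphere_integral (fun x => sdist x C).
  exact: (sphere_integralN (f := fun x => sdist x C) cSd).
rewrite sN (SI_affine _ _ cS) in low.
by move: low SIS; move: (SI S) (sphere_integral _) => *; lra.
Qed.
End lower_bound_curve.

Section lower_bound_final.
Context {R : realType}.
Implicit Types (C : set 'rV[R]_3).

Lemma avg_dist_ge C (L th : R) : simple_closed_curve C L -> 0 < th -> th <= pi / 2 ->
  th - L * (1 - cos th) / (2 * pi) <= avg_dist C.
Proof.
move=> CL th0 thpi; have pi0 := pi_gt0 R.
rewrite leNgt; apply/negP => lt.
(* With a deficit [X], the previous estimate would give [8 pi X <= (8 pi + L / 2) e]. The constant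
   [M] exceeds this coefficient of [e], so [e = X / M] is contradictory. *)
pose M := 8 * pi + 2^-1 * `|L| + 1.
have M0 : 0 < M by rewrite ltr_wpDl// addr_ge0// mulr_ge0// ltW.
pose X := th - L * (1 - cos th) / (2 * pi) - avg_dist C.
have X0 : 0 < X by rewrite /X subr_gt0.
have e0 : 0 < X / M by rewrite divr_gt0.
have := avg_dist_ge_aux CL th0 thpi e0; set e := X / M.
have eM : e * M = X by rewrite /e divfK ?gt_eqF.
have Le : e * L <= e * `|L| by rewrite ler_pM2l ?ler_norm.
have -> : avg_dist C = th - L * (1 - cos th) / (2 * pi) - X by rewrite /X; ring.
have -> : 2 * (4 * pi * (th - L * (1 - cos th) / (2 * pi) - X)) =
  8 * pi * th - 4 * L * (1 - cos th) - 8 * pi * X.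
  have pin0 : pi != 0 :> R by rewrite gt_eqF.
  by move: (X) (cos th) (@pi R) pin0 => x c p p0; field.
have piX : X <= pi * X by rewrite ler_peMl ?(ltW X0)//; have := pi_ge2 R; lra.
have {}eM : 8 * pi * e + 2^-1 * (e * `|L|) + e = X by rewrite -eM /M; ring.
rewrite -/e in e0.
move: eM Le e0 X0 piX; move: X e (`|L|) (cos th) => X' e' L' c' *; lra.
Qed.
End lower_bound_final.

(** * The constants [theta_ n], [L_ n] and [jbound (L_ n)] *)

Section ropes_numerics.
Context {R : realType}.
Implicit Types (th : R).

Lemma theta_itv n : (0 < n)%N -> 0 < theta_ n :> R /\ theta_ n <= pi / 2 :> R.
Proof.
move=> n0; have pi0 := pi_gt0 R; have n1 : 1 <= n%:R :> R by rewrite ler1n.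
have n00 : 0 < n%:R :> R by rewrite ltr0n.
rewrite /theta_; split; first by rewrite divr_gt0// mulr_gt0.
by rewrite ler_pM2l// lef_pV2 ?posrE ?mulr_gt0// ler_peMr.
Qed.

Lemma theta_nat n : (0 < n)%N -> 2 * n%:R * theta_ n = pi :> R.
Proof.
move=> n0; rewrite /theta_; have : n%:R != 0 :> R by rewrite pnatr_eq0 -lt0n.
by move: (@pi R) => p h; field.
Qed.

Lemma sin_theta_gt0 n : (0 < n)%N -> 0 < sin (theta_ n) :> R.
Proof.
move=> /theta_itv[h1 h2]; have pi0 := pi_gt0 R; apply: sin_gt0_pi; apply/andP; split; lra.
Qed.

Lemma tan_half th : 0 < th -> th <= pi / 2 -> tan (th / 2) = (1 - cos th) / sin th.
Proof.
move=> th0 thpi; have pi0 := pi_gt0 R.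
have -> : th = (th / 2) *+ 2 by rewrite -mulr_natr; field.
rewrite [in LHS](_ : (th / 2) *+ 2 / 2 = th / 2); last by rewrite -mulr_natr; field.
have s0 : 0 < sin (th / 2) by apply: sin_gt0_pi; apply/andP; split; lra.
have c0 : 0 < cos (th / 2) by apply: cos_gt0_pihalf; apply/andP; split; lra.
rewrite cos_mulr2n sin_mulr2n /tan.
have sc := sin2cos2 (th / 2).
have s0' := lt0r_neq0 s0; have c0' := lt0r_neq0 c0.
have -> : 1 - (cos (th / 2) ^+ 2 *+ 2 - 1) = sin (th / 2) ^+ 2 *+ 2 by rewrite sc; ring.
by move: (sin (th / 2)) (cos (th / 2)) s0' c0' => s c s0' c0'; field; rewrite s0'.
Qed.

Lemma theta_L n : (0 < n)%N -> theta (L_ n) = theta_ n :> R.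
Proof.
move=> n0; have [h1 h2] := theta_itv n0; have pi0 := pi_gt0 R.
rewrite /theta /L_ invf_div mulrC divfK ?mulf_neq0 ?gt_eqF// sinK// in_itv/=.
apply/andP; split; lra.
Qed.

Lemma jbound_L n : (0 < n)%N ->
  jbound (L_ n) = theta_ n - (1 - cos (theta_ n)) / sin (theta_ n) :> R.
Proof. by move=> n0; rewrite /jbound theta_L// tan_half//; have [] := theta_itv n0. Qed.

Lemma avg_dist_ge_jbound n (C : set 'rV[R]_3) L : (0 < n)%N ->
  simple_closed_curve C L -> L <= L_ n ->
  jbound (L_ n) <= avg_dist C /\ (avg_dist C = jbound (L_ n) -> L = L_ n).
Proof.
move=> n0 CL Ln; have [h1 h2] := theta_itv n0; have pi0 := pi_gt0 R.
have := avg_dist_ge CL h1 h2; rewrite jbound_L//.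
have s0 := sin_theta_gt0 n0; set th := theta_ n in h1 h2 s0 *.
have c1 : cos th < 1.
  by rewrite -(cos0 R) ltr_cos// in_itv/=; apply/andP; split; lra.
have LE : (1 - cos th) / sin th = L_ n * (1 - cos th) / (2 * pi).
  rewrite /L_ -/th; have pin := lt0r_neq0 pi0; have sn := lt0r_neq0 s0.
  by move: (@pi R) (sin th) (cos th) pin sn => p s c pin sn; field; rewrite pin.
rewrite LE; have P20 : 0 < 2 * pi :> R by rewrite mulr_gt0.
have mono : L * (1 - cos th) / (2 * pi) <= L_ n * (1 - cos th) / (2 * pi).
  by rewrite ler_pM2r ?invr_gt0// ler_pM2r// subr_gt0.
move=> lb; split; first by lra.
(* [lb] and [eqn] give [L_ n <= L] after multiplication by [(1 - cos th) / (2 * pi)], which is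
   positive because [cos th < 1]. *)
move=> eqn; apply/eqP; rewrite eq_le Ln/=.
rewrite -(ler_pM2r (x := (1 - cos th) / (2 * pi))) ?divr_gt0 ?subr_gt0// !mulrA; lra.
Qed.

(** The sum telescopes by [sin (x + y) sin (y - x) = sin^2 y - sin^2 x] with [x = m th] and
    [y = (m + 1) th]. *)
Lemma sum_sin_odd (th : R) m :
  (\sum_(i < m) sin ((2 * i + 1)%:R * th)) * sin th = sin (m%:R * th) ^+ 2.
Proof.
elim: m => [|m IH]; first by rewrite big_ord0 !mul0r sin0 expr0n.
rewrite big_ord_recr/= mulrDl IH.
have -> : (2 * m + 1)%:R * th = m%:R * th + m.+1%:R * th.
  by rewrite natrD natrM -natr1; ring.
rewrite [X in _ * sin X](_ : th = m.+1%:R * th - m%:R * th); last by rewrite -natr1; ring.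
rewrite sinD sinB; set x := m%:R * th; set y := m.+1%:R * th.
transitivity (sin x ^+ 2 + (cos x ^+ 2 * sin y ^+ 2 - sin x ^+ 2 * cos y ^+ 2)); first ring.
by rewrite !cos2sin2; ring.
Qed.
End ropes_numerics.

(** * Average distance to a rope: upper bound *)

Section rope_upper_bound.
Context {R : realType}.
Local Notation mu := (@lebesgue_measure R).
Implicit Types (th p c : R).

(** There are [m + 1] target points, so the [n] latitudes of a rope correspond to [m = n.-1]. *)
Fixpoint odd_dist th m p : R :=
  if m is m'.+1 then Num.min (odd_dist th m' p) `|p - (2 * m + 1)%:R * th| else `|p - th|.

Lemma continuous_odd_dist th m : continuous (odd_dist th m).
Proof.
elim: m => [|m IH] /=; first by ctn.
by move=> x; apply: contmin; [exact: IH|]; move: x; ctn.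
Qed.

Lemma odd_dist_le th m i p : (i <= m)%N -> odd_dist th m p <= `|p - (2 * i + 1)%:R * th|.
Proof.
elim: m => [|m IH]; first by rewrite leqn0 => /eqP->; rewrite mul1r.
by rewrite leq_eqVlt => /predU1P[->|/IH h] /=; rewrite ge_min ?lexx ?orbT// h.
Qed.

Lemma le_odd_dist th m p (d : R) :
  (forall i, (i <= m)%N -> d <= `|p - (2 * i + 1)%:R * th|) -> d <= odd_dist th m p.
Proof.
elim: m => [|m IH] h /=; first by have := h 0%N isT; rewrite mul1r.
by rewrite le_min h// andbT IH// => i im; exact/h/leqW.
Qed.

Lemma Rintegral_abs_sin c th : 0 < th ->
  \int[mu]_(p in `[c - th, c + th]) (`|p - c| * sin p) =
  2 * sin c * (th * sin th + cos th - 1).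
Proof.
move=> th0.
have cf : continuous (fun p : R => `|p - c| * sin p) by ctn.
have dF (x : R) : is_derive x 1 (fun p : R => sin p - (p - c) * cos p) ((x - c) * sin x).
  have dl : is_derive x 1 (fun p : R => p - c) 1.
    have := is_deriveB (is_derive_id x 1) (is_derive_cst (c : R) x 1).
    by rewrite subr0.
  have := is_deriveB (is_derive_sin x) (is_deriveM dl (is_derive_cos x)).
  have -> : cos x - ((x - c) *: - sin x + cos x *: 1) = (x - c) * sin x.
    by rewrite /GRing.scale/=; ring.
  by [].
rewrite (Rintegral_cat (b := c))//; [|lra|lra].
have -> : \int[mu]_(p in `[c, c + th]) (`|p - c| * sin p) =
    sin (c + th) - th * cos (c + th) - sin c.
  transitivity (\int[mu]_(p in `[c, c + th]) ((p - c) * sin p)).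
    apply: eq_Rintegral => p /set_mem; rewrite /= in_itv/= => /andP[p1 p2].
    by rewrite ger0_norm// subr_ge0.
  transitivity ((sin (c + th) - (c + th - c) * cos (c + th)) - (sin c - (c - c) * cos c)).
    apply: (Rintegral_FTC (F := fun p : R => sin p - (p - c) * cos p)) => //.
      by rewrite lerDl ltW.
    by ctn.
  by ring.
have -> : \int[mu]_(p in `[c - th, c]) (`|p - c| * sin p) =
    - (sin c) + sin (c - th) + th * cos (c - th).
  transitivity (\int[mu]_(p in `[c - th, c]) (- ((p - c) * sin p))).
    apply: eq_Rintegral => p /set_mem; rewrite /= in_itv/= => /andP[p1 p2].
    by rewrite ler0_norm ?mulNr// subr_le0.
  transitivity (- (sin c - (c - c) * cos c) - - (sin (c - th) - (c - th - c) * cos (c - th))).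
    apply: (Rintegral_FTC (F := - (fun p : R => sin p - (p - c) * cos p))) => //.
      by rewrite gerBl ltW.
    by ctn.
  by ring.
by rewrite !sinD !cosD !sinN !cosN; ring.
Qed.

(** The interval is cut into [n] bands of width [2 th] centred at the odd multiples; on each band
    the distance to its own centre is an upper bound. *)
Lemma Rintegral_odd_dist th n m : 0 < th -> (n <= m.+1)%N -> 2 * n%:R * th <= pi ->
  \int[mu]_(p in `[0, 2 * n%:R * th]) (odd_dist th m p * sin p) <=
  2 * (\sum_(i < n) sin ((2 * i + 1)%:R * th)) * (th * sin th + cos th - 1).
Proof.
move=> th0; have cd : continuous (odd_dist th m) by exact: continuous_odd_dist.
have cf : continuous (fun p : R => odd_dist th m p * sin p) by ctn.
elim: n => [|n IH] nm npi.
  by rewrite big_ord0 !(mulr0, mul0r) set_itv1 Rintegral_set1.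
have n0 : 0 <= 2 * n%:R * th by rewrite !mulr_ge0 ?ler0n ?(ltW th0).
have nS : 2 * n.+1%:R * th = 2 * n%:R * th + 2 * th by rewrite -natr1; ring.
rewrite (Rintegral_cat (b := 2 * n%:R * th))//; last by rewrite nS; lra.
rewrite big_ord_recr/= [leRHS](_ : _ = 2 * (\sum_(i < n) sin ((2 * i + 1)%:R * th)) *
   (th * sin th + cos th - 1) + 2 * sin ((2 * n + 1)%:R * th) * (th * sin th + cos th - 1)).
  2: by ring.
rewrite lerD//.
  by apply: IH; [exact: ltnW|rewrite nS in npi; lra].
rewrite -Rintegral_abs_sin//.
set c := (2 * n + 1)%:R * th.
have -> : c - th = 2 * n%:R * th by rewrite /c natrD natrM; ring.
have -> : c + th = 2 * n.+1%:R * th by rewrite /c natrD natrM -natr1; ring.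
apply: le_Rintegral => //.
- exact: continuous_integrable_itv.
- by apply: continuous_integrable_itv; ctn.
- move=> p /=; rewrite in_itv/= => /andP[p1 p2]; apply: ler_wpM2r.
    by apply: sin_ge0_pi; rewrite (le_trans n0 p1) (le_trans p2 npi).
  exact: odd_dist_le.
Qed.

Lemma SI_odd_dist n : (0 < n)%N ->
  SI (fun v : R * R * R => odd_dist (theta_ n) n.-1 (acosc v.2)) <= 4 * pi * jbound (L_ n).
Proof.
move=> n0; have [h1 h2] := @theta_itv R _ n0; set th := theta_ n in h1 h2 *.
have pi0 := pi_gt0 R.
have cd : continuous (odd_dist th n.-1) by exact: continuous_odd_dist.
have ca := @continuous_acosc R.
have cF : continuous (fun v : R * R * R => odd_dist th n.-1 (acosc v.2)) by ctn.
rewrite /SI (Rintegral_rect12 _ _ _ _ (continuous_sph cF)).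
have npi : 2 * n%:R * th = pi by exact: theta_nat.
have := @Rintegral_odd_dist th n n.-1 h1; rewrite npi prednK// => /(_ (leqnn _) (lexx _)).
have s0 := @sin_theta_gt0 R _ n0; rewrite -/th in s0.
have sE : \sum_(i < n) sin ((2 * i + 1)%:R * th) = (sin th)^-1.
  apply: (mulIf (lt0r_neq0 s0)); rewrite sum_sin_odd mulVf ?gt_eqF//.
  have -> : n%:R * th = pi / 2 by rewrite -npi; field.
  by rewrite sin_pihalf expr1n.
rewrite sE => le1.
have -> : \int[mu]_(x in `[0, pi]) \int[mu]_(y in `[0, 2 * pi])
    (odd_dist th n.-1 (acosc (sph (x, y)).2) * sin (x, y).1) =
    2 * pi * \int[mu]_(x in `[0, pi]) (odd_dist th n.-1 x * sin x).
  rewrite -RintegralZl//; last by apply: continuous_integrable_itv; ctn.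
  apply: eq_Rintegral => p /set_mem; rewrite /= in_itv/= => p0.
  rewrite acosc_cos// Rintegral_cst// mulrC; congr (_ * _).
  rewrite [X in fine X](_ : _ = (2 * pi)%:E) //=.
  rewrite [LHS]lebesgue_measure_itv/= lte_fin mulr_gt0//.
  by rewrite oppr0 addr0.
rewrite jbound_L// -/th.
have -> : 4 * pi * (th - (1 - cos th) / sin th) =
   2 * pi * (2 * (sin th)^-1 * (th * sin th + cos th - 1)).
  have sn := lt0r_neq0 s0.
  by move: (@pi R) (sin th) (cos th) sn => p s c sn; field.
by rewrite ler_pM2l// mulr_gt0.
Qed.
End rope_upper_bound.

Section rope_avg_dist.
Context {R : realType}.
Implicit Types (x y : 'rV[R]_3).

Lemma ycoord_spherical (p t : R) : ycoord (spherical p t) = sin p * sin t.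
Proof. by have [] := tr_spherical p t. Qed.

Lemma zcoord_spherical (p t : R) : zcoord (spherical p t) = cos p.
Proof. by have [] := tr_spherical p t. Qed.

Lemma spherical_longitude x : sphere x -> exists t,
  [/\ x = spherical (acosc (zcoord x)) t, 0 <= ycoord x -> 0 <= sin t &
      ycoord x <= 0 -> sin t <= 0].
Proof.
move=> /sphereP xS; rewrite /dot3/= in xS.
have z1 : -1 <= zcoord x <= 1.
  have := sqr_ge0 (xcoord x); have := sqr_ge0 (ycoord x).
  move: xS; move: (xcoord x) (ycoord x) (zcoord x) => a b c *; apply/andP; split; nra.
have cE : cos (acosc (zcoord x)) = zcoord x by rewrite acosc_id// acosK// in_itv.
have s0 : 0 <= sin (acosc (zcoord x)) by rewrite sin_ge0_pi// acosc_itv.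
have sE : sin (acosc (zcoord x)) ^+ 2 = xcoord x ^+ 2 + ycoord x ^+ 2.
  by rewrite sin2cos2 cE -xS; ring.
have [r0|rn0] := eqVneq (sin (acosc (zcoord x))) 0.
  (* At a pole every longitude represents [x]; [t = 0] meets both sign conditions. *)
  exists 0; rewrite sin0; split=> //; apply: tr_inj; rewrite tr_spherical /sph/= r0 cE !mul0r.
  move: sE; rewrite r0 expr0n/= => /esym/eqP; rewrite paddr_eq0 ?sqr_ge0// !sqrf_eq0.
  by rewrite /tr => /andP[/eqP-> /eqP->].
have rp : 0 < sin (acosc (zcoord x)) by rewrite lt_neqAle eq_sym rn0.
have [t [xE yE]] := polar_coordinates s0 sE.
exists t; split.
- by apply: tr_inj; rewrite tr_spherical /sph/= -xE -yE cE.
- by rewrite yE pmulr_rge0.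
- by rewrite yE pmulr_rle0.
Qed.

Lemma tr_rot_y (f : R) x : tr (rot_y f x) =
  (xcoord x * cos f + zcoord x * sin f, ycoord x, - xcoord x * sin f + zcoord x * cos f).
Proof. by rewrite /rot_y tr_vec3. Qed.

Lemma dot3_rot_y (f : R) x y : dot3 (tr (rot_y f x)) (tr (rot_y f y)) = dot3 (tr x) (tr y).
Proof.
rewrite !tr_rot_y /dot3/=; have := cos2Dsin2 f; move: (cos f) (sin f) => c s cs.
move: (xcoord x) (ycoord x) (zcoord x) (xcoord y) (ycoord y) (zcoord y) => x1 x2 x3 y1 y2 y3.
transitivity ((x1 * y1 + x3 * y3) * (c ^+ 2 + s ^+ 2) + x2 * y2); first ring.
by rewrite cs; ring.
Qed.

Lemma sphere_rot_y (f : R) x : sphere x -> sphere (rot_y f x).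
Proof. by move=> /sphereP xS; apply/sphereP; rewrite dot3_rot_y. Qed.

Lemma rot_yK (f : R) : cancel (rot_y f) (rot_y (- f)).
Proof.
move=> x; apply: tr_inj; rewrite tr_rot_y cosN sinN.
have := tr_rot_y f x; rewrite {1}/tr => -[-> -> ->].
have := cos2Dsin2 f; move: (cos f) (sin f) => c s cs.
rewrite /tr; move: (xcoord x) (ycoord x) (zcoord x) => x1 x2 x3.
congr (_, _, _).
  by transitivity (x1 * (c ^+ 2 + s ^+ 2)); [ring|rewrite cs mulr1].
by transitivity (x3 * (c ^+ 2 + s ^+ 2)); [ring|rewrite cs mulr1].
Qed.

Lemma latitude_spherical (c t : R) : 0 <= c <= pi -> latitude c (spherical c t).
Proof.
move=> c0; split; first exact: sphere_spherical.
by rewrite dotE tr_spherical tr_vec3 /dot3/= !mulr0 !add0r mulr1 cosK// in_itv.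
Qed.

Lemma odd_theta_itv n i : (i < n)%N -> 0 < (2 * i + 1)%:R * (theta_ n : R) < pi.
Proof.
move=> iN; have n0 : (0 < n)%N by exact: leq_ltn_trans iN.
have [h1 h2] := @theta_itv R _ n0.
rewrite mulr_gt0 ?ltr0n ?addn1//= -(@theta_nat R _ n0) ltr_pM2r// -natrM ltr_nat; lia.
Qed.

Lemma rope_sphere n k : @rope R n k `<=` sphere.
Proof.
by move=> x [i /= _ [[[+ _] _]|[y [[+ _] _] <-]]]//; exact: sphere_rot_y.
Qed.

Lemma dot3_spherical_meridian (p c t : R) :
  dot3 (tr (spherical p t)) (tr (spherical c t)) = cos (p - c).
Proof.
rewrite !tr_spherical /sph /dot3/= cosB.
transitivity (cos p * cos c + sin p * sin c * (cos t ^+ 2 + sin t ^+ 2)); first ring.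
by rewrite cos2Dsin2 mulr1.
Qed.

Lemma acosc_cosB (p c : R) : 0 <= p <= pi -> 0 <= c <= pi -> acosc (cos (p - c)) = `|p - c|.
Proof.
move=> /andP[p1 p2] /andP[c1 c2]; rewrite -cos_norm acosc_cos// normr_ge0/= ler_norml.
by apply/andP; split; lra.
Qed.

(** On each latitude the comparison point is the one on the meridian of [x]: it stays in [y >= 0],
    hence on the rope, and is at distance [|p - c|]. *)
Lemma sdist_rope_up n k x : (0 < n)%N -> sphere x -> 0 <= ycoord x ->
  sdist x (rope n k) <= odd_dist (theta_ n) n.-1 (acosc (zcoord x)).
Proof.
move=> n0 xS y0; have [t [xE /(_ y0) st _]] := spherical_longitude xS.
apply: le_odd_dist => i iN; have {}iN : (i < n)%N by rewrite -(prednK n0) ltnS.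
have /andP[c1 c2] := odd_theta_itv iN; set c := _ * theta_ n in c1 c2 *.
rewrite -acosc_cosB ?acosc_itv ?(ltW c1) ?(ltW c2)// -(dot3_spherical_meridian _ _ t) -xE.
apply: sdist_le => //; first exact: rope_sphere.
exists i => //; left; split; first by apply: latitude_spherical; rewrite !ltW.
rewrite /= ycoord_spherical.
by rewrite mulr_ge0// sin_ge0_pi// !ltW.
Qed.

Lemma sdist_rope_down n k x : (0 < n)%N -> sphere x -> ycoord x <= 0 ->
  sdist x (rope n k) <=
  odd_dist (theta_ n) n.-1 (acosc (zcoord (rot_y (- (2 * k%:R * theta_ n)) x))).
Proof.
move=> n0 xS y0; set f := 2 * k%:R * theta_ n.
have xS' := sphere_rot_y (- f) xS.
have y0' : ycoord (rot_y (- f) x) <= 0.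
  by have [_ -> _] : tr (rot_y (- f) x) = _ := tr_rot_y (- f) x.
have [t [xE _ /(_ y0') st]] := spherical_longitude xS'.
apply: le_odd_dist => i iN; have {}iN : (i < n)%N by rewrite -(prednK n0) ltnS.
have /andP[c1 c2] := odd_theta_itv iN; set c := _ * theta_ n in c1 c2 *.
rewrite -acosc_cosB ?acosc_itv ?(ltW c1) ?(ltW c2)// -(dot3_spherical_meridian _ _ t) -xE.
have -> : dot3 (tr (rot_y (- f) x)) (tr (spherical c t)) = dot3 (tr x) (tr (rot_y f (spherical c t))).
  by rewrite -(dot3_rot_y f) -{1}[f]opprK rot_yK.
apply: sdist_le => //; first exact: rope_sphere.
exists i => //; right; exists (spherical c t) => //; split.
  by apply: latitude_spherical; rewrite !ltW.
rewrite /= ycoord_spherical.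
by rewrite mulr_ge0_le0// sin_ge0_pi// !ltW.
Qed.

Lemma rope_nonempty n k : (0 < n)%N -> @rope R n k !=set0.
Proof.
move=> n0; have /andP[c1 c2] := @odd_theta_itv n 0 n0.
exists (spherical ((2 * 0 + 1)%:R * theta_ n) 0), 0%N => //; left; split.
  by apply: latitude_spherical; rewrite !ltW.
rewrite /= ycoord_spherical.
by rewrite sin0 mulr0.
Qed.

(** The two hemispheres have different axes. Pairing [x] with its mirror image [fl x] puts one point
    in each, so a single pointwise bound, with one term per axis, holds on the whole sphere. *)
Lemma avg_dist_rope_le n k : (0 < n)%N -> avg_dist (rope n k) <= jbound (L_ n) :> R.
Proof.
move=> n0; have pi0 := pi_gt0 R.
set C := rope n k; set f := 2 * k%:R * theta_ n : R.
have CS : C `<=` sphere by exact: rope_sphere.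
have C0 : C !=set0 by exact: rope_nonempty.
pose H p := odd_dist (theta_ n : R) n.-1 (acosc p).
have cH : continuous H.
  have cd : continuous (odd_dist (theta_ n : R) n.-1) by exact: continuous_odd_dist.
  by have ca := @continuous_acosc R; rewrite /H; ctn.
have cG := continuous_sdist_spherical CS C0.
(* The north pole rotated by [f]: the axis of the half in [y <= 0]. It lies in the plane [y = 0], so
   [fl] preserves inner products with it. *)
pose e : R * R * R := (sin f, 0, cos f).
have e1 : dot3 e e = 1 by rewrite /dot3/= -[RHS](cos2Dsin2 f); ring.
pose fl x := vec3 (xcoord x) (- ycoord x) (zcoord x) : 'rV[R]_3.
have flE x : tr (fl x) = (xcoord x, - ycoord x, zcoord x) by rewrite tr_vec3.
have zE x : zcoord (rot_y (- f) x) = dot3 (tr x) e.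
  have [_ _ ->] : tr (rot_y (- f) x) = _ := tr_rot_y (- f) x.
  by rewrite cosN sinN /dot3/=; ring.
have pointwise x : sphere x -> sdist x C + sdist (fl x) C <= H (zcoord x) + H (dot3 (tr x) e).
  move=> xS.
  have flS : sphere (fl x).
    by apply/sphereP; move/sphereP: xS; rewrite flE /dot3/= => <-; ring.
  have yfl : ycoord (fl x) = - ycoord x by have [_ -> _] : tr (fl x) = _ := flE x.
  have zfl : zcoord (fl x) = zcoord x by have [_ _ ->] : tr (fl x) = _ := flE x.
  have dfl : dot3 (tr (fl x)) e = dot3 (tr x) e by rewrite flE /dot3/=; ring.
  have [y0|y0] := leP 0 (ycoord x).
    rewrite lerD//; first exact: sdist_rope_up.
    rewrite -dfl -zE; apply: sdist_rope_down => //.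
    by rewrite yfl oppr_le0.
  rewrite addrC lerD//.
    by rewrite -zfl; apply: sdist_rope_up => //; rewrite yfl oppr_ge0 ltW.
  by rewrite -zE; apply: sdist_rope_down => //; rewrite ltW.
have cHz : continuous (fun v : R * R * R => H v.2) by ctn.
have cHe : continuous (fun v : R * R * R => H (dot3 v e)) by rewrite /dot3; ctn.
(* Rotation invariance, used with both points equal to [e]. *)
have SIe : SI (fun v => H (dot3 v e)) = SI (fun v => H v.2).
  have cF : continuous (fun w : R * R => H w.1) by ctn.
  exact: (SI_dot3_normal_form cF e1 e1).
have cGf : continuous (fun w : R * R => sdist (fl (spherical w.1 w.2)) C).
  pose h (w : R * R) := sdist (spherical w.1 w.2) C.
  have ch : continuous h by [].
  have -> : (fun w : R * R => sdist (fl (spherical w.1 w.2)) C) =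
      (fun w : R * R => h (w.1, 2 * pi - w.2)).
    by apply/funext => w; rewrite /h -spherical_flipy.
  by ctn.
have ints := sphere_integral_flipy (f := fun x => sdist x C) cG.
have main : sphere_integral (fun x => sdist x C) + sphere_integral (fun x => sdist (fl x) C) <=
    SI (fun v => H v.2) + SI (fun v => H (dot3 v e)).
  rewrite /sphere_integral /SI -!RintegralD//; first last.
  - by apply: continuous_integrable_rect; ctn.
  - by apply: continuous_integrable_rect; ctn.
  - exact: measurable_rect.
  - exact: continuous_integrable_rect (continuous_sph cHe).
  - exact: continuous_integrable_rect (continuous_sph cHz).
  - exact: measurable_rect.
  have c1 := continuous_sph cHe; have c2 := continuous_sph cHz.
  apply: le_Rintegral.
  - exact: measurable_rect.
  - by apply: continuous_integrable_rect; ctn.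
  - apply: continuous_integrable_rect => w.
    by apply: contD; [exact: c2|exact: c1].
  - move=> [p t] [/=]; rewrite !in_itv/= => p0 _.
    rewrite -!mulrDl ler_wpM2r ?sin_ge0_pi// -tr_spherical.
    by have := pointwise _ (sphere_spherical p t); rewrite zcoord_spherical.
rewrite SIe ints in main.
have le1 : sphere_integral (fun x => sdist x C) <= SI (fun v => H v.2).
  by move: main; move: (sphere_integral _) (SI _) => *; lra.
have le2 := le_trans le1 (@SI_odd_dist R n n0).
by rewrite /avg_dist mulrC ler_pdivrMr ?mulr_gt0// mulrC.
Qed.
End rope_avg_dist.

(** * Arithmetic of the rope angles *)

Section rope_angles.
Context {R : realType}.
Variables (n k : nat).
Hypothesis n0 : (0 < n)%N.
Local Notation th := (theta_ n : R).

Lemma sin_mul_theta_eq0 (c : nat) : sin (c%:R * th) = 0 -> (2 * n %| c)%N.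
Proof.
have [h1 h2] := @theta_itv R _ n0; have nth := @theta_nat R _ n0.
have n2 : (0 < 2 * n)%N by rewrite muln_gt0.
rewrite {1}(divn_eq c (2 * n)); move: (c %/ (2 * n))%N => d.
have -> : (d * (2 * n) + c %% (2 * n))%:R * th = (c %% (2 * n))%:R * th + pi *+ d.
  by rewrite natrD mulrDl !natrM -[pi *+ d]mulr_natl -nth; ring.
have E : forall m x, `|sin (x + pi *+ m)| = `|sin x| :> R.
  elim=> [|m IH] x; first by rewrite mulr0n addr0.
  by rewrite mulrSr addrA sinDpi normrN IH.
move=> s0; have : `|sin ((c %% (2 * n))%:R * th)| = 0 by rewrite -(E d) s0 normr0.
move=> /normr0_eq0 s1; rewrite /dvdn.
have [//|r0] := eqVneq (c %% (2 * n))%N 0%N.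
have : 0 < sin ((c %% (2 * n))%:R * th).
  apply: sin_gt0_pi; rewrite mulr_gt0 ?ltr0n ?lt0n//= -nth ltr_pM2r// -natrM.
  by rewrite ltr_nat ltn_mod.
by rewrite s1 ltxx.
Qed.

Lemma cos_eq_half (a b : R) : cos a = cos b -> sin ((a + b) / 2) * sin ((a - b) / 2) = 0.
Proof.
move=> ab; set x := (a + b) / 2; set y := (a - b) / 2.
have aE : a = x + y by rewrite /x /y; field.
have bE : b = x - y by rewrite /x /y; field.
by move: ab; rewrite aE bE cosD cosB; move: (sin x * sin y) (cos x * cos y) => *; lra.
Qed.

Definition rope_angle (q : nat) : R := (2 * (k * q) + 1)%:R * th.

(** Equal cosines make the half-sum or the half-difference of the angles a multiple of
    [pi = 2 n th]. The half-sum is an odd multiple of [th], as [q + q'] is even, so it is ruled out.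
    The half-difference gives [n] dividing [(q - q') / 2], as [k] is prime to [n], and this number
    is below [n]. *)
Lemma rope_angle_inj q q' : coprime k n -> odd q = odd q' -> (q < 2 * n)%N -> (q' < 2 * n)%N ->
  cos (rope_angle q) = cos (rope_angle q') -> q = q'.
Proof.
wlog qq : q q' / (q' <= q)%N.
  move=> H kn o q1 q2 E; have [qq|/ltnW qq] := leqP q' q; first exact: H.
  exact/esym/H.
move=> kn o q1 q2 /cos_eq_half/eqP; rewrite mulf_eq0 => /orP[] /eqP.
  have -> : (rope_angle q + rope_angle q') / 2 = (k * (q + q') + 1)%:R * th.
    by rewrite /rope_angle !natrD !natrM natrD; field.
  move=> /sin_mul_theta_eq0 /dvdnP[d dE].
  have : odd (k * (q + q') + 1) by rewrite oddD oddM oddD o addbb andbF.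
  by rewrite dE !oddM andbF.
have -> : (rope_angle q - rope_angle q') / 2 = (k * (q - q'))%:R * th.
  by rewrite /rope_angle !natrD !natrM natrB//; field.
move=> /sin_mul_theta_eq0 d.
have e : ~~ odd (q - q') by rewrite oddB// o addbb.
have qE : (q - q' = 2 * (q - q')./2)%N by rewrite mul2n even_halfK.
move: d; rewrite qE mulnCA dvdn_pmul2l// Gauss_dvdr; last by rewrite coprime_sym.
have : ((q - q')./2 < n)%N by lia.
case: (posnP (q - q')./2) => [z _ _|z lt /(dvdn_leq z)]; last by rewrite leqNgt lt.
by move: qE; rewrite z muln0; lia.
Qed.

(** The angle [(2 j + 1) th] is reduced modulo [2 pi = 4 n th] and, if it exceeds [pi], replaced by
    its reflection [2 pi - angle]; the result is again an odd multiple of [th]. *)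
Definition rope_index (j : nat) : nat :=
  if (j %% (2 * n) < n)%N then (j %% (2 * n))%N else (2 * n - 1 - j %% (2 * n))%N.

Lemma rope_index_lt j : (rope_index j < n)%N.
Proof.
rewrite /rope_index; case: (ltnP (j %% (2 * n)) n) => // h; have := ltn_pmod j (_ : 0 < 2 * n)%N.
rewrite muln_gt0 n0 => /(_ isT); lia.
Qed.

Lemma cos_rope_index j :
  cos ((2 * j + 1)%:R * th) = cos ((2 * rope_index j + 1)%:R * th).
Proof.
have nth := @theta_nat R _ n0.
have E : forall m x, cos (x + pi *+ 2 *+ m) = cos x :> R.
  by elim=> [|m IH] x; rewrite ?mulr0n ?addr0// mulrSr addrA cosD2pi IH.
have -> : (2 * j + 1)%:R * th = (2 * (j %% (2 * n)) + 1)%:R * th + pi *+ 2 *+ (j %/ (2 * n)).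
  rewrite {1}(divn_eq j (2 * n)); move: (j %/ _)%N (j %% _)%N => d r.
  have -> : pi *+ 2 *+ d = 2 * d%:R * pi :> R by rewrite -[LHS]mulr_natl -[pi *+ 2]mulr_natl; ring.
  by rewrite -nth natrD natrM natrD !natrM natrD natrM; ring.
rewrite E /rope_index; case: (ltnP (j %% (2 * n)) n) => // h.
have jl : (j %% (2 * n) < 2 * n)%N by rewrite ltn_pmod// muln_gt0 n0.
rewrite -[RHS]cosN -[RHS](E 1%N); congr cos.
rewrite mulr1n -[pi *+ 2]mulr_natl -nth.
have -> : (2 * (2 * n - 1 - j %% (2 * n)) + 1 = 4 * n - (2 * (j %% (2 * n)) + 1))%N by lia.
rewrite natrB; last by lia.
by rewrite natrM; ring.
Qed.

Lemma rope_angle_index q :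
  cos (rope_angle q) = cos ((2 * rope_index (k * q) + 1)%:R * th) /\
  `|sin (rope_angle q)| = sin ((2 * rope_index (k * q) + 1)%:R * th).
Proof.
have cE := cos_rope_index (k * q); split => //.
have /andP[c1 c2] := @odd_theta_itv R n _ (rope_index_lt (k * q)).
have s0 := sin_gt0_pi (introT andP (conj c1 c2)).
apply/eqP; rewrite -(@eqrXn2 _ 2)// ?(ltW s0)//; apply/eqP.
by rewrite real_normK ?num_real// !sin2cos2 /rope_angle cE.
Qed.

Lemma abs_sin_rope_angle_gt0 q : 0 < `|sin (rope_angle q)|.
Proof.
have [_ ->] := rope_angle_index q; apply: sin_gt0_pi; apply: odd_theta_itv.
exact: rope_index_lt.
Qed.

(** [b] is the parity of [q], that is, the hemisphere; an injective self-map of a finite set is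
    bijective. *)
Lemma rope_index_bij (b : bool) : coprime k n ->
  bijective (fun m : 'I_n => Ordinal (rope_index_lt (k * (2 * m + b)))).
Proof.
move=> kn; apply: injF_bij => m m' [E].
have : (2 * m + b = 2 * m' + b)%N; last by move=> h; apply: val_inj => /=; lia.
apply: rope_angle_inj => //.
- by rewrite !mul2n !oddD !odd_double.
- by have := ltn_ord m; case: (b); lia.
- by have := ltn_ord m'; case: (b); lia.
by rewrite (rope_angle_index _).1 (rope_angle_index (2 * m' + b)).1 E.
Qed.

Lemma rope_index_onto (b : bool) i : coprime k n -> (i < n)%N ->
  exists q, [/\ (q < 2 * n)%N, odd q = b & rope_index (k * q) = i].
Proof.
move=> kn iN; have [f fK Kf] := rope_index_bij b kn.
have [] := Kf (Ordinal iN); set m := f _ => mE; exists (2 * m + b)%N; split => //.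
  by have := ltn_ord m; case: (b); lia.
by rewrite oddD oddM; case: (b).
Qed.

(** Each parity class runs through all latitudes once and contributes [1 / sin th]. Times [pi], the
    total is the sum of the semicircle lengths, [L_ n]. *)
Lemma sum_abs_sin_rope_angle : coprime k n ->
  (\sum_(q < 2 * n) `|sin (rope_angle q)|) * sin th = 2.
Proof.
move=> kn.
have par (b : bool) : \sum_(m < n) `|sin (rope_angle (2 * m + b))| =
    \sum_(i < n) sin ((2 * i + 1)%:R * th).
  rewrite [RHS](reindex (fun m : 'I_n => Ordinal (rope_index_lt (k * (2 * m + b))))).
    by apply: eq_bigr => m _; rewrite (rope_angle_index _).2.
  exact: onW_bij (rope_index_bij b kn).
have -> : \sum_(q < 2 * n) `|sin (rope_angle q)| =
   \sum_(m < n) `|sin (rope_angle (2 * m + false))| +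
   \sum_(m < n) `|sin (rope_angle (2 * m + true))|.
  rewrite -(big_mkord xpredT (fun q => `|sin (rope_angle q)|)).
  rewrite -(big_mkord xpredT (fun m => `|sin (rope_angle (2 * m + false))|)).
  rewrite -(big_mkord xpredT (fun m => `|sin (rope_angle (2 * m + true))|)).
  elim: (n) => [|m IH]; first by rewrite muln0 !big_nil addr0.
  have -> : (2 * m.+1 = (2 * m).+2)%N by lia.
  by rewrite !big_nat_recr//= IH addn0 addn1 -!addrA; congr (_ + _); rewrite addrCA.
rewrite !par -mulr2n mulrnAl sum_sin_odd.
have -> : n%:R * th = pi / 2 by rewrite -(@theta_nat R _ n0); field.
by rewrite sin_pihalf expr1n.
Qed.
End rope_angles.

(** * Glued paths and bounds on their length *)

Section gluing.
Context {R : realType}.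
Implicit Types (u v x y : 'rV[R]_3).

Lemma dot3_ge0 (a : R * R * R) : 0 <= dot3 a a.
Proof. by rewrite /dot3 !addr_ge0// -expr2 sqr_ge0. Qed.

Lemma enorm_sqr u : enorm u ^+ 2 = dot3 (tr u) (tr u).
Proof. by rewrite enormE sqr_sqrtr// dot3_ge0. Qed.

Lemma trD u v : tr (u + v) = ((tr u).1.1 + (tr v).1.1, (tr u).1.2 + (tr v).1.2, (tr u).2 + (tr v).2).
Proof. by rewrite /tr /xcoord /ycoord /zcoord !mxE. Qed.

Lemma enorm_triangle u v : enorm (u + v) <= enorm u + enorm v.
Proof.
have u0 := enorm_ge0 u; have v0 := enorm_ge0 v.
rewrite -(@ler_pXn2r _ 2)// ?nnegrE ?enorm_ge0 ?addr_ge0// sqrrD !enorm_sqr trD.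
set a := tr u; set b := tr v.
have cs : dot3 a b <= enorm u * enorm v.
  rewrite (le_trans (ler_norm _))// -(@ler_pXn2r _ 2)// ?nnegrE ?mulr_ge0//.
  rewrite real_normK ?num_real// exprMn !enorm_sqr -/a -/b -subr_ge0.
  (* Lagrange's identity: the right side is the squared norm of the cross product. *)
  have -> : dot3 a a * dot3 b b - dot3 a b ^+ 2 =
     (a.1.1 * b.1.2 - a.1.2 * b.1.1) ^+ 2 + (a.1.1 * b.2 - a.2 * b.1.1) ^+ 2 +
     (a.1.2 * b.2 - a.2 * b.1.2) ^+ 2 by rewrite /dot3; ring.
  by rewrite !addr_ge0// sqr_ge0.
move: cs; rewrite -mulr_natr /dot3/= => cs; lra.
Qed.

Lemma enorm0 : enorm (0 : 'rV[R]_3) = 0.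
Proof. by rewrite enormE /norm3 /dot3 /tr /xcoord /ycoord /zcoord/= !mxE !mulr0 !addr0 sqrtr0. Qed.

Lemma enorm_sum N (F : nat -> 'rV[R]_3) : enorm (\sum_(q < N) F q) <= \sum_(q < N) enorm (F q).
Proof.
elim: N => [|N IH]; first by rewrite !big_ord0 enorm0.
by rewrite !big_ord_recr/= (le_trans (enorm_triangle _ _))// lerD2r.
Qed.

Definition clamp01 (s : R) : R := Num.max 0 (Num.min 1 s).

Lemma clamp01_ge1 s : 1 <= s -> clamp01 s = 1.
Proof. by move=> s1; rewrite /clamp01 min_l// max_r. Qed.

Lemma clamp01_le0 s : s <= 0 -> clamp01 s = 0.
Proof. by move=> s0; rewrite /clamp01 min_r ?(le_trans s0)// max_l. Qed.

Lemma clamp01_id s : 0 <= s <= 1 -> clamp01 s = s.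
Proof. by move=> /andP[s0 s1]; rewrite /clamp01 min_r// max_r. Qed.

Lemma clamp01_mono s t : s <= t -> clamp01 s <= clamp01 t.
Proof. by move=> st; rewrite /clamp01 ge_max le_max lexx/= le_max le_min !ge_min lexx st !orbT. Qed.

(* Consecutive pieces [P q] on [0, 1] share endpoints, so the sum telescopes: on
   [q, q + 1] the glued curve is [P q] shifted by [q]. *)
Definition glue (N : nat) (P : nat -> R -> 'rV[R]_3) (s : R) : 'rV[R]_3 :=
  P 0%N 0 + \sum_(q < N) (P q (clamp01 (s - q%:R)) - P q 0).

Lemma glueE N P q f : (forall j, (j.+1 < N)%N -> P j 1 = P j.+1 0) -> (q < N)%N ->
  0 <= f <= 1 -> glue N P (q%:R + f) = P q f.
Proof.
move=> PP qN f01; rewrite /glue -(big_mkord xpredT (fun j => P j (clamp01 (q%:R + f - j%:R)) - P j 0)).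
rewrite (big_cat_nat (leq0n q) (ltnW qN))/= (big_ltn qN).
have -> : \sum_(0 <= j < q) (P j (clamp01 (q%:R + f - j%:R)) - P j 0) =
   \sum_(0 <= j < q) (P j.+1 0 - P j 0).
  apply: eq_big_nat => j /= jq; rewrite clamp01_ge1 ?PP ?(leq_ltn_trans jq qN)//.
  have : j.+1%:R <= q%:R :> R by rewrite ler_nat.
  by rewrite -natr1; case/andP: f01; lra.
rewrite telescope_sumr// [X in _ + (_ + (_ + X))](_ : _ = 0) ?addr0.
  have -> : q%:R + f - q%:R = f by ring.
  by rewrite clamp01_id// addrA [P 0%N 0 + _]addrC subrK addrC subrK.
rewrite big_nat_cond big1// => j /andP[/andP[qj _] _]; rewrite clamp01_le0 ?subrr//.
have : q.+1%:R <= j%:R :> R by rewrite ler_nat.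
by rewrite -natr1; case/andP: f01; lra.
Qed.

(** The bound has the form [V t - V s], so it telescopes along every partition and yields both
    continuity and a length bound. *)
Lemma glue_lipschitz N P (r : nat -> R) s t :
  (forall q f f', enorm (P q f - P q f') <= r q * `|f - f'|) -> s <= t ->
  enorm (glue N P t - glue N P s) <=
  \sum_(q < N) r q * clamp01 (t - q%:R) - \sum_(q < N) r q * clamp01 (s - q%:R).
Proof.
move=> Pr st; rewrite /glue opprD addrACA subrr add0r -!sumrB.
apply: (le_trans (enorm_sum _ (fun q => P q (clamp01 (t - q%:R)) - P q 0 -
  (P q (clamp01 (s - q%:R)) - P q 0)))).
apply: ler_sum => q _; rewrite opprB subrKA (le_trans (Pr _ _ _))// ger0_norm ?mulrBr//.
by rewrite subr_ge0 clamp01_mono// lerD2r.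
Qed.
End gluing.

Section curve_of_variation.
Context {R : realType}.
Implicit Types (g : R -> 'rV[R]_3) (V : R -> R).

Lemma norm_le_enorm (u : 'rV[R]_3) : `|u| <= enorm u.
Proof.
rewrite [`|u|]mx_normrE; apply/bigmax_leP; split; first exact: enorm_ge0.
move=> [i j] _ /=; rewrite (ord1 i) -(@ler_pXn2r _ 2)// ?nnegrE ?enorm_ge0//.
rewrite real_normK ?num_real// enorm_sqr -dotE /dot (bigD1 j)//= -expr2 lerDl.
by apply: sumr_ge0 => l _; rewrite -expr2 sqr_ge0.
Qed.

Lemma enorm_distC (u v : 'rV[R]_3) : enorm (u - v) = enorm (v - u).
Proof.
apply/eqP; rewrite -(@eqrXn2 _ 2)// ?enorm_ge0// !enorm_sqr !trB /dot3 /sub3/=.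
by apply/eqP; ring.
Qed.

Lemma variation_continuous g V : continuous V ->
  (forall s t, s <= t -> enorm (g t - g s) <= V t - V s) -> continuous g.
Proof.
move=> cV gV s; apply/cvgrPdist_le => /= e e0.
have /cvgrPdist_le/(_ e e0) := cV s; apply: filterS => t Vst.
rewrite (le_trans (norm_le_enorm _))// (le_trans _ Vst)//.
have [st|/ltW ts] := leP s t; last by rewrite (le_trans (gV _ _ ts))// ler_norm.
rewrite distrC (le_trans _ (ler_norm _))// (le_trans _ (gV _ _ st))//.
by rewrite enorm_distC.
Qed.

Lemma polygon_length_cons g (a x : R) (s : seq R) :
  polygon_length g a (x :: s) = enorm (g x - g a) + polygon_length g x s.
Proof.
rewrite /polygon_length /= big_nat_recl//=; congr (_ + _).
apply: eq_big_nat => i /= iN; congr (enorm (g _ - g _)).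
  by apply: set_nth_default.
by apply: (@set_nth_default _ (x :: s)); rewrite /= ltnW.
Qed.

Lemma polygon_length_le g V (a b : R) (s : seq R) :
  (forall s t, s <= t -> enorm (g t - g s) <= V t - V s) -> itv_partition a b s ->
  polygon_length g a s <= V b - V a.
Proof.
move=> gV; elim: s a => [|x s IH] a.
  by move=> /itv_partition_nil ->; rewrite /polygon_length/= big_geq// subrr.
move=> /[dup] /itv_partition_cons/IH h [/= /andP[ax _] _].
rewrite polygon_length_cons; have := gV _ _ (ltW ax); lra.
Qed.

Lemma curve_length_le g V (a b : R) : a < b ->
  (forall s t, s <= t -> enorm (g t - g s) <= V t - V s) ->
  exists2 L, curve_length a b g = L%:E & L <= V b - V a.
Proof.
move=> ab gV.
have le : (curve_length a b g <= (V b - V a)%:E)%E.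
  by apply: ge_ereal_sup => _ [s /= sab <-]; rewrite lee_fin; exact: polygon_length_le.
have ge : (0%:E <= curve_length a b g)%E.
  apply: (le_trans (y := (polygon_length g a [:: b])%:E)).
    by rewrite lee_fin /polygon_length sumr_ge0// => i _; exact: enorm_ge0.
  by apply: ereal_sup_ubound; exists [:: b] => //; exact: itv_partition1.
exists (fine (curve_length a b g)).
  by rewrite fineK// ge0_fin_numE// (le_lt_trans le)// ltry.
by rewrite -lee_fin fineK// ge0_fin_numE// (le_lt_trans le)// ltry.
Qed.

Lemma abs_sin_le (x : R) : `|sin x| <= `|x|.
Proof.
wlog x0 : x / 0 <= x.
  by move=> H; have [/H//|/ltW x0] := leP 0 x; rewrite -normrN -sinN -[`|x|]normrN H// oppr_ge0.
have [|c _] := @MVT_segment R sin cos 0 x x0.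
  exact/continuous_subspaceT/continuous_sin.
rewrite sin0 !subr0 => ->; rewrite normrM ler_piMl// ler_norml cos_geN1 cos_le1//.
Qed.

Lemma chord_le_arc (x y : R) : (cos x - cos y) ^+ 2 + (sin x - sin y) ^+ 2 <= (x - y) ^+ 2.
Proof.
have -> : (cos x - cos y) ^+ 2 + (sin x - sin y) ^+ 2 = (2 * sin ((x - y) / 2)) ^+ 2.
  transitivity (2 - 2 * cos (x - y)).
    by rewrite cosB; have := cos2Dsin2 x; have := cos2Dsin2 y; move: (cos x) (cos y) (sin x) (sin y) => *; nra.
  have {1}-> : x - y = ((x - y) / 2) *+ 2 by rewrite -mulr_natr; field.
  rewrite cos_mulr2n exprMn sin2cos2 -mulr_natr; ring.
rewrite -[leRHS]real_normK ?num_real// -[leLHS]real_normK ?num_real//.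
rewrite ler_pXn2r ?nnegrE// normrM (ger0_norm (ler0n _ 2)).
have := abs_sin_le ((x - y) / 2); rewrite normrM [`|2^-1|]ger0_norm// => h.
by rewrite mulrC -ler_pdivlMr.
Qed.
End curve_of_variation.

(** * Semicircles and the parametrization of a rope *)

Section rope_arcs.
Context {R : realType}.
Implicit Types (x y : 'rV[R]_3).

Lemma sphere_zcoord_itv x : sphere x -> -1 <= zcoord x <= 1.
Proof.
move=> /spherical_longitude[t [-> _ _]]; rewrite zcoord_spherical.
by rewrite cos_geN1 cos_le1.
Qed.

Lemma latitudeE (p : R) : 0 <= p <= pi ->
  latitude p = [set x | sphere x /\ zcoord x = cos p].
Proof.
have dE x : dot x (vec3 0 0 1) = zcoord x.
  by rewrite dotE tr_vec3 /dot3/= !mulr0 !add0r mulr1.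
move=> p0; rewrite /latitude; apply/seteqP; split => x /= [xS zE]; split=> //.
  by rewrite -zE dE acosK// in_itv; exact: sphere_zcoord_itv.
by rewrite dE zE cosK// in_itv.
Qed.

(* Half of the latitude circle through [(sin u, 0, cos u)], traversed from
   [(sin u, 0, cos u)] through [y >= 0] if [b] is false, and in the opposite half
   from [(- sin u, 0, cos u)] if [b] is true. *)
Definition half_latitude (b : bool) (u f : R) : 'rV[R]_3 :=
  vec3 ((-1) ^+ b * sin u * cos (pi * f)) ((-1) ^+ b * `|sin u| * sin (pi * f)) (cos u).

Lemma tr_half_latitude b u f : tr (half_latitude b u f) =
  ((-1) ^+ b * sin u * cos (pi * f), (-1) ^+ b * `|sin u| * sin (pi * f), cos u).
Proof. by rewrite tr_vec3. Qed.

Lemma sphere_half_latitude b u f : sphere (half_latitude b u f).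
Proof.
apply/sphereP; rewrite tr_half_latitude /dot3/= -!expr2 !exprMn sqrr_sign !mul1r.
rewrite real_normK ?num_real//; have := cos2Dsin2 u; have := cos2Dsin2 (pi * f) => h1 h2.
transitivity (sin u ^+ 2 * (cos (pi * f) ^+ 2 + sin (pi * f) ^+ 2) + cos u ^+ 2); first ring.
by rewrite h1 mulr1 addrC.
Qed.

Lemma half_latitude_lipschitz b u f f' :
  enorm (half_latitude b u f - half_latitude b u f') <= pi * `|sin u| * `|f - f'|.
Proof.
have pi0 := pi_ge0 R.
rewrite -(@ler_pXn2r _ 2)// ?nnegrE ?enorm_ge0 ?mulr_ge0// enorm_sqr trB !tr_half_latitude.
rewrite /sub3 /dot3/= subrr mulr0 addr0 -!expr2 -!mulrBr !exprMn sqrr_sign !mul1r.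
rewrite !real_normK ?num_real// -mulrDr.
have -> : pi ^+ 2 * sin u ^+ 2 * (f - f') ^+ 2 = sin u ^+ 2 * (pi * f - pi * f') ^+ 2 by ring.
by rewrite ler_wpM2l ?sqr_ge0// chord_le_arc.
Qed.

Lemma half_latitude_inj b (u f f' : R) : sin u != 0 -> 0 <= f <= 1 -> 0 <= f' <= 1 ->
  half_latitude b u f = half_latitude b u f' -> f = f'.
Proof.
have pi0 := pi_gt0 R; move=> su f01 f01' /(congr1 tr); rewrite !tr_half_latitude => -[+ _].
have h0 : (-1) ^+ b * sin u != 0 by rewrite mulf_neq0// signr_eq0.
move/(mulfI h0) => E; apply: (@mulfI _ pi); first by rewrite gt_eqF.
have itv (z : R) : 0 <= z <= 1 -> pi * z \in `[0, pi].
  by case/andP => z0 z1; rewrite in_itv/= mulr_ge0 ?ler_piMr ?pi_ge0.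
by apply: cos_inj; rewrite ?itv.
Qed.

Lemma half_latitude_onto (b : bool) (u : R) x : sin u != 0 -> sphere x -> zcoord x = cos u ->
  0 <= (-1) ^+ b * ycoord x -> exists2 f : R, 0 <= f <= 1 & half_latitude b u f = x.
Proof.
have pi0 := pi_gt0 R; move=> su /sphereP; rewrite /dot3/= => xS zE y0.
have sE : xcoord x ^+ 2 + ycoord x ^+ 2 = sin u ^+ 2 by rewrite sin2cos2 -zE -xS; ring.
pose e : R := (-1) ^+ b; have e2 : e ^+ 2 = 1 by rewrite sqrr_sign.
(* Cosine and sine of the position on the semicircle; [v >= 0] makes [v] equal to [sin (acos w)]. *)
pose w := e * xcoord x / sin u; pose v := e * ycoord x / `|sin u|.
have v0 : 0 <= v by rewrite divr_ge0.
have wv : w ^+ 2 + v ^+ 2 = 1.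
  rewrite /w /v !exprMn e2 !mul1r !exprVn real_normK ?num_real// -mulrDl sE divff//.
  by rewrite sqrf_eq0.
have w1 : w \in `[-1, 1].
  by rewrite in_itv/=; have := sqr_ge0 v; move: (w) (v) wv => w' v' *; apply/andP; split; nra.
exists (acos w / pi).
  by rewrite ler_pdivrMr// mul1r acos_lepi// divr_ge0 ?acos_ge0 ?pi_ge0.
apply: tr_inj; rewrite tr_half_latitude mulrCA divff ?gt_eqF// mulr1 acosK// sin_acos//.
  have -> : 1 - w ^+ 2 = v ^+ 2 by rewrite -wv; ring.
  rewrite sqrtr_sqr (ger0_norm v0) -zE /w /v -/e.
  have su' : `|sin u| != 0 by rewrite normr_eq0.
  congr (_, _, _).
    by transitivity (e ^+ 2 * xcoord x); [field|rewrite e2 mul1r].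
  by transitivity (e ^+ 2 * ycoord x); [field|rewrite e2 mul1r].
Qed.

Lemma half_latitude0 b u : tr (half_latitude b u 0) = ((-1) ^+ b * sin u, 0, cos u).
Proof. by rewrite tr_half_latitude mulr0 cos0 sin0 mulr1 mulr0. Qed.

Lemma half_latitude1 b u : tr (half_latitude b u 1) = (- ((-1) ^+ b * sin u), 0, cos u).
Proof. by rewrite tr_half_latitude mulr1 cospi sinpi mulrN1 mulr0. Qed.

Lemma rot_yB (f : R) x y : rot_y f (x - y) = rot_y f x - rot_y f y.
Proof.
apply: tr_inj; rewrite trB !tr_rot_y /sub3/= /xcoord /ycoord /zcoord !mxE.
by congr (_, _, _); ring.
Qed.

Lemma enorm_rot_y (f : R) x : enorm (rot_y f x) = enorm x.
Proof. by apply/eqP; rewrite -(@eqrXn2 _ 2)// ?enorm_ge0// !enorm_sqr dot3_rot_y. Qed.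

Lemma ycoord_rot_y (f : R) x : ycoord (rot_y f x) = ycoord x.
Proof. by have [_ -> _] := tr_rot_y f x. Qed.

End rope_arcs.

Section rope_curve.
Context {R : realType}.
Variables (n k : nat).
Hypothesis n0 : (0 < n)%N.
Local Notation th := (theta_ n : R).
Local Notation phi := (2 * k%:R * th).
Implicit Types (x y : 'rV[R]_3) (s t f : R).

(* Following the rope, halves in [y >= 0] alternate with rotated halves in [y <= 0];
   each crossing of the cut shifts the angle by [phi]. *)
Definition rope_piece (q : nat) f : 'rV[R]_3 :=
  let x := half_latitude (odd q) (rope_angle n k q) f in if odd q then rot_y phi x else x.

Lemma sin_rope_angle_neq0 q : sin (rope_angle n k q : R) != 0.
Proof. by rewrite -normr_gt0 abs_sin_rope_angle_gt0. Qed.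

Lemma rope_angleS q : rope_angle n k q.+1 = rope_angle n k q + phi.
Proof.
rewrite /rope_angle.
have -> : (2 * (k * q.+1) + 1 = 2 * (k * q) + 1 + 2 * k)%N by rewrite mulnS mulnDr -addnA addnC.
by rewrite [in LHS]natrD mulrDl [in X in _ + X]natrM.
Qed.

Lemma rope_piece_lipschitz q f f' :
  enorm (rope_piece q f - rope_piece q f') <= pi * `|sin (rope_angle n k q)| * `|f - f'|.
Proof.
rewrite /rope_piece; case: (odd q); last exact: half_latitude_lipschitz.
by rewrite -rot_yB enorm_rot_y; exact: half_latitude_lipschitz.
Qed.

(** On the cut the rotation shifts angles: [(sin u, 0, cos u)] goes to angle [u + phi], and
    [(- sin u, 0, cos u)] to the same form with [u - phi]. Entering and leaving a rotated half thus
    both advance [u] by [phi]. *)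
Lemma rope_piece_join q : rope_piece q 1 = rope_piece q.+1 0.
Proof.
have trE x : tr x = (xcoord x, ycoord x, zcoord x) by [].
apply: tr_inj; rewrite /rope_piece/=; case: (odd q) => /=.
  rewrite tr_rot_y half_latitude0 rope_angleS.
  have := half_latitude1 true (rope_angle n k q : R); rewrite {1}trE => -[-> -> ->].
  by rewrite !expr1 !expr0 sinD cosD; congr (_, _, _); ring.
rewrite tr_rot_y half_latitude1 rope_angleS.
have := half_latitude0 true (rope_angle n k q + phi); rewrite {1}trE => -[-> -> ->].
rewrite !expr1 !expr0 !mul1r sinD cosD; have := cos2Dsin2 phi.
move: (cos phi) (sin phi) (cos (rope_angle n k q)) (sin (rope_angle n k q)) => c s C S cs; congr (_, _, _).
  by transitivity (- S * (c ^+ 2 + s ^+ 2)); [rewrite cs mulr1|ring].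
by transitivity (C * (c ^+ 2 + s ^+ 2)); [rewrite cs mulr1|ring].
Qed.

(** The total advance [2 n * 2 k th] is [2 k pi], and the number of pieces is even. *)
Lemma rope_piece_closed : rope_piece (2 * n) 0 = rope_piece 0 0.
Proof.
apply: tr_inj; rewrite /rope_piece/= oddM/= !half_latitude0 /rope_angle muln0 add0n.
have -> : (2 * (k * (2 * n)) + 1)%:R * th = (1 : nat)%:R * th + pi *+ 2 *+ k.
  have -> : pi *+ 2 *+ k = 2 * k%:R * pi :> R by rewrite -[LHS]mulr_natl -[pi *+ 2]mulr_natl; ring.
  by rewrite -(@theta_nat R _ n0) natrD !natrM; ring.
have C : forall m (x : R), cos (x + pi *+ 2 *+ m) = cos x :> R.
  by elim=> [|m IH] x; rewrite ?mulr0n ?addr0// mulrSr addrA cosD2pi IH.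
have S : forall m (x : R), sin (x + pi *+ 2 *+ m) = sin x :> R.
  by elim=> [|m IH] x; rewrite ?mulr0n ?addr0// mulrSr addrA sinD2pi IH.
by rewrite C S.
Qed.

Lemma ycoord_rope_piece q f : ycoord (rope_piece q f) =
  (-1) ^+ odd q * `|sin (rope_angle n k q)| * sin (pi * f).
Proof.
have yE b u : ycoord (half_latitude b u f) = (-1) ^+ b * `|sin u| * sin (pi * f).
  by have [_ -> _] := tr_half_latitude b u f.
by rewrite /rope_piece; case: (odd q); rewrite ?ycoord_rot_y yE.
Qed.

Lemma rope_piece_rope q f : 0 <= f <= 1 -> rope n k (rope_piece q f).
Proof.
move=> f01; have s0 : 0 <= sin (pi * f).
  case/andP: f01 => f0 f1; rewrite sin_ge0_pi// mulr_ge0 ?pi_ge0//=.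
  by rewrite ler_piMr ?pi_ge0.
set u := rope_angle n k q : R; have [cu _] := @rope_angle_index R n k n0 q.
exists (rope_index n (k * q)); first exact: rope_index_lt.
have lat : latitude ((2 * rope_index n (k * q) + 1)%:R * th) (half_latitude (odd q) u f).
  have /andP[c1 c2] := @odd_theta_itv R n _ (rope_index_lt n0 (k * q)).
  rewrite latitudeE ?(ltW c1) ?(ltW c2)//=; split; first exact: sphere_half_latitude.
  by rewrite -cu; have [_ _ ->] := tr_half_latitude (odd q) u f.
have := ycoord_rope_piece q f; rewrite /rope_piece -/u; case: (odd q) lat => lat yE /=.
  right; exists (half_latitude true u f) => //; split => //=.
  by move: yE; rewrite ycoord_rot_y => ->; rewrite expr1 mulN1r mulNr oppr_le0 mulr_ge0.
by left; split => //=; rewrite yE expr0 mul1r mulr_ge0.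
Qed.

Lemma rope_piece_onto x : coprime k n -> rope n k x ->
  exists q, (q < 2 * n)%N /\ exists2 f, 0 <= f <= 1 & rope_piece q f = x.
Proof.
move=> kn [i /= iN].
have /andP[c1 c2] := @odd_theta_itv R n _ iN.
rewrite latitudeE ?(ltW c1) ?(ltW c2)//=.
have half (b : bool) y : sphere y -> zcoord y = cos ((2 * i + 1)%:R * th) ->
    0 <= (-1) ^+ b * ycoord y -> exists q, [/\ (q < 2 * n)%N, odd q = b &
    exists2 f : R, 0 <= f <= 1 & half_latitude b (rope_angle n k q) f = y].
  move=> yS yz y0; have [q [q1 q2 q3]] := @rope_index_onto R n k n0 b i kn iN.
  exists q; split => //; apply: half_latitude_onto => //.
    exact: sin_rope_angle_neq0.
  by rewrite yz (@rope_angle_index R n k n0 q).1 q3.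
move=> [[[xS xz] y0]|[y [[yS yz] y0] <-]].
  have [|q [q1 q2 [f f01 E]]] := half false x xS xz; first by rewrite expr0 mul1r.
  by exists q; split => //; exists f => //; rewrite /rope_piece q2.
have [|q [q1 q2 [f f01 E]]] := half true y yS yz; first by rewrite expr1 mulN1r oppr_ge0.
by exists q; split => //; exists f => //; rewrite /rope_piece q2 E.
Qed.

(** For equal parity, the height (after undoing the rotation) determines the piece by
    [rope_angle_inj]. For different parity, the pieces lie in opposite closed hemispheres, so a
    common point is on the cut and both parameters are 0. *)
Lemma rope_piece_inj q q' f f' : coprime k n -> (q < 2 * n)%N -> (q' < 2 * n)%N ->
  0 <= f < 1 -> 0 <= f' < 1 -> rope_piece q f = rope_piece q' f' -> q = q' /\ f = f'.
Proof.
have cl (h : R) : 0 <= h < 1 -> 0 <= h <= 1 by case/andP => -> /ltW ->.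
have same p p' (h h' : R) : coprime k n -> (p < 2 * n)%N -> (p' < 2 * n)%N -> odd p = odd p' ->
    0 <= h <= 1 -> 0 <= h' <= 1 -> rope_piece p h = rope_piece p' h' -> p = p' /\ h = h'.
  move=> kn pn pn' o hh hh' E.
  have {E} : half_latitude (odd p) (rope_angle n k p) h = half_latitude (odd p) (rope_angle n k p') h'.
    by move: E; rewrite /rope_piece -o; case: (odd p) => // E; exact: (can_inj (rot_yK phi) E).
  move=> /[dup] /(congr1 tr); rewrite !tr_half_latitude => -[_ _].
  move=> /(rope_angle_inj n0 kn o pn pn') <- /half_latitude_inj -> //.
  exact: sin_rope_angle_neq0.
wlog o : q q' f f' / ~~ odd q /\ odd q' => [H kn q1 q2 f1 f2 E|].
  have [qo|qo] := eqVneq (odd q) (odd q'); first by apply: same => //; exact: cl.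
  have [oq|oq] := boolP (odd q); last first.
    by apply: H => //; split=> //; move: qo oq; case: (odd q); case: (odd q').
  have o : ~~ odd q' /\ odd q by move: qo oq; case: (odd q); case: (odd q').
  by have [-> ->] := H q' q f' f o kn q2 q1 f2 f1 (esym E).
case: o => oq oq' kn q1 q2 f1 f2 E; exfalso.
have ge0 (h : R) : 0 <= h < 1 -> 0 <= sin (pi * h) :> R.
  case/andP => h0 h1; rewrite sin_ge0_pi// mulr_ge0 ?pi_ge0//=.
  by rewrite ler_piMr ?pi_ge0// ltW.
have s1 := @abs_sin_rope_angle_gt0 R n k n0 q; have s2 := @abs_sin_rope_angle_gt0 R n k n0 q'.
have f0 (h : R) : 0 <= h < 1 -> sin (pi * h) = 0 :> R -> h = 0.
  move=> /andP[h0 h1] s0; apply/eqP; apply: contra_eqT s0 => hn.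
  rewrite gt_eqF// sin_gt0_pi// mulr_gt0 ?pi_gt0 ?lt0r ?hn//=.
  by rewrite -[ltRHS]mulr1 ltr_pM2l ?pi_gt0.
have := congr1 ycoord E; rewrite !ycoord_rope_piece oq' (negbTE oq) expr0 mul1r expr1 mulN1r mulNr.
move=> yE; have := mulr_ge0 (ltW s1) (ge0 _ f1); have := mulr_ge0 (ltW s2) (ge0 _ f2).
move=> h2 h1.
have z1 : `|sin (rope_angle n k q)| * sin (pi * f) = 0 by apply/eqP; rewrite eq_le h1 yE oppr_le0 h2.
have z2 : `|sin (rope_angle n k q')| * sin (pi * f') = 0 by move: yE; rewrite z1 => /eqP; rewrite eq_sym oppr_eq0 => /eqP.
move: z1 z2; move=> /eqP; rewrite mulf_eq0 gt_eqF//= => /eqP/(f0 _ f1) fE.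
move=> /eqP; rewrite mulf_eq0 gt_eqF//= => /eqP/(f0 _ f2) fE'.
(* An odd piece starts where the preceding even one ends; comparing that end with the start of an
   even piece gives [1 = 0]. *)
move: E; rewrite fE fE'; case: q' oq' q2 {s2 yE h2} => [//|p] /= op p1.
rewrite -rope_piece_join => /same[] //; rewrite ?lexx ?ler01 ?(ltnW p1) ?(negbTE op) ?(negbTE oq)//.
by move=> _ /eqP; rewrite eq_sym oner_eq0.
Qed.
End rope_curve.

Section rope_closed_curve.
Context {R : realType}.
Variables (n k : nat).
Hypothesis n0 : (0 < n)%N.
Hypothesis kn : coprime k n.

Definition rope_path : R -> 'rV[R]_3 := glue (2 * n) (rope_piece n k).

(** Its slope on [[q, q + 1]] is the length of the [q]-th semicircle. *)
Definition rope_variation (s : R) : R :=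
  \sum_(q < 2 * n) pi * `|sin (rope_angle n k q)| * clamp01 (s - q%:R).

Lemma rope_path_lipschitz s t : s <= t ->
  enorm (rope_path t - rope_path s) <= rope_variation t - rope_variation s.
Proof.
apply: (@glue_lipschitz _ (2 * n) (rope_piece n k) (fun q => pi * `|sin (rope_angle n k q)|)).
by move=> q f f'; exact: rope_piece_lipschitz.
Qed.

Lemma continuous_rope_path : continuous rope_path.
Proof.
apply: (variation_continuous _ rope_path_lipschitz).
apply: (@continuous_sum R R (fun q (s : R) => pi * `|sin (rope_angle n k q)| * clamp01 (s - q%:R))).
by move=> q; rewrite /clamp01; ctn.
Qed.

Lemma rope_variation_total : rope_variation (2 * n)%:R - rope_variation 0 = L_ n.
Proof.
have s0 := @sin_theta_gt0 R n n0.
have -> : rope_variation 0 = 0.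
  by rewrite /rope_variation big1// => q _; rewrite clamp01_le0 ?mulr0// sub0r oppr_le0.
have -> : rope_variation (2 * n)%:R = pi * \sum_(q < 2 * n) `|sin (rope_angle n k q)|.
  rewrite mulr_sumr; apply: eq_bigr => q _; rewrite clamp01_ge1 ?mulr1//.
  rewrite lerBrDl natr1 ler_nat; exact: ltn_ord.
rewrite subr0 /L_ -(@sum_abs_sin_rope_angle R n k n0 kn); field; exact: lt0r_neq0.
Qed.

Lemma rope_pathE q f : (q < 2 * n)%N -> 0 <= f <= 1 -> rope_path (q%:R + f) = rope_piece n k q f.
Proof. by apply: glueE => j _; exact: rope_piece_join. Qed.

Lemma rope_param : simple_closed_param 0 (2 * n)%:R rope_path (rope n k).
Proof.
have n2 : (0 < 2 * n)%N by rewrite muln_gt0.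
have split_lt (s : R) : 0 <= s < (2 * n)%:R -> exists q f,
    [/\ (q < 2 * n)%N, 0 <= f < 1 & s = q%:R + f].
  move=> /andP[s0 s1]; have /andP[q1 q2] := truncn_itv s0.
  exists (Num.truncn s), (s - (Num.truncn s)%:R); split; last ring.
    by rewrite -(ltr_nat R) (le_lt_trans q1).
  by rewrite subr_ge0 q1 ltrBlDl natr1.
have end_eq : rope_path 0 = rope_path (2 * n)%:R.
  have -> : 0 = 0%N%:R + 0 :> R by rewrite addr0.
  rewrite rope_pathE ?lexx ?ler01// -[in RHS](prednK n2) -natr1 rope_pathE ?ler01 ?lexx ?prednK//.
  by have := @rope_piece_join R n k (2 * n).-1; rewrite (prednK n2) rope_piece_closed.
have cl (f : R) : 0 <= f < 1 -> 0 <= f <= 1 by case/andP => -> /ltW ->.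
split=> //.
- by rewrite ltr0n.
- exact/continuous_subspaceT/continuous_rope_path.
- move=> s t; rewrite !in_itv/= => /split_lt[q [f [q1 f1 ->]]] /split_lt[q' [f' [q1' f1' ->]]].
  rewrite !rope_pathE ?cl// => E.
  by have [-> ->] := rope_piece_inj n0 kn q1 q1' f1 f1' E.
apply/seteqP; split => [_ [s /=] + <-|x /rope_piece_onto].
  rewrite in_itv/= => /andP[s0]; rewrite le_eqVlt => /orP[/eqP->|s1].
    rewrite -end_eq; have -> : 0 = 0%N%:R + 0 :> R by rewrite addr0.
    by rewrite rope_pathE ?lexx ?ler01//; apply: rope_piece_rope; rewrite ?lexx ?ler01.
  have [|q [f [q1 f1 ->]]] := split_lt s; first by rewrite s0.
  by rewrite rope_pathE ?cl//; apply: rope_piece_rope => //; exact: cl.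
move=> /(_ n0 kn)[q [q1 [f f1 <-]]]; exists (q%:R + f); last by rewrite rope_pathE.
rewrite /= in_itv/=; case/andP: f1 => f0 f1; rewrite addr_ge0//=.
by rewrite (le_trans (y := q.+1%:R))// ?ler_nat// -natr1 lerD2l.
Qed.

Lemma rope_curve : simple_closed_curve (rope n k) (L_ n : R) /\
  avg_dist (rope n k) = jbound (L_ n) :> R.
Proof.
have [] := curve_length_le _ rope_path_lipschitz (a := 0) (b := (2 * n)%:R).
  by rewrite ltr0n muln_gt0.
rewrite rope_variation_total => L LE LL.
have scc : simple_closed_curve (rope n k) L.
  by split; [exact: rope_sphere|exists 0, (2 * n)%:R, rope_path; split => //; exact: rope_param].
have [ge eqL] := avg_dist_ge_jbound n0 scc LL.
have E : avg_dist (rope n k) = jbound (L_ n) :> R.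
  by apply/eqP; rewrite eq_le ge (avg_dist_rope_le _ n0).
by split => //; rewrite -(eqL E).
Qed.
End rope_closed_curve.

(** * Explicit values and the infimum *)

Section special_values.
Context {R : realType}.

Lemma sin_pi6 : sin (pi / 6) = 2^-1 :> R.
Proof.
have pi0 := pi_gt0 R; set t : R := pi / 6.
have s0 : 0 < sin t by apply: sin_gt0_pi; rewrite /t; apply/andP; split; lra.
have s3 : sin (t + t *+ 2) = 1.
  have -> : t + t *+ 2 = pi / 2 by rewrite /t -mulr_natr; field.
  by rewrite sin_pihalf.
rewrite sinD sin_mulr2n cos_mulr2n !mulr2n in s3.
have c2 := cos2sin2 t; move: (sin t) (cos t) s0 s3 c2 => x c x0 + c2.
have -> : x * (c ^+ 2 + c ^+ 2 - 1) + c * (c * x + c * x) =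
  x * (2 * c ^+ 2 - 1) + 2 * c ^+ 2 * x by ring.
(* The triple angle formula with [sin (3 t) = 1] reads [4 x^3 - 3 x + 1 = 0], which factors as
   stated; the root -1 is negative. *)
rewrite c2 => E; have : (2 * x - 1) ^+ 2 * (x + 1) = 0 by lra.
move/eqP; rewrite mulf_eq0 sqrf_eq0 => /orP[] /eqP; lra.
Qed.

Lemma cos_pi6 : cos (pi / 6) = Num.sqrt 3 / 2 :> R.
Proof.
have pi0 := pi_gt0 R; apply/eqP; rewrite -(@eqrXn2 _ 2)// ?divr_ge0 ?sqrtr_ge0//; last first.
  by apply: cos_ge0_pihalf; apply/andP; split; lra.
by rewrite cos2sin2 sin_pi6 expr_div_n sqr_sqrtr//; apply/eqP; field.
Qed.

Lemma sin_pi3 : sin (pi / 3) = Num.sqrt 3 / 2 :> R.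
Proof.
rewrite -[RHS]cos_pi6 -cosBpihalf -cosN; congr cos.
by move: (@pi R) => p; field.
Qed.

Lemma cos_pi3 : cos (pi / 3) = 2^-1 :> R.
Proof.
rewrite -[LHS]opprK -sinBpihalf -sinN -[RHS]sin_pi6; congr sin.
by move: (@pi R) => p; field.
Qed.

Lemma theta_3 : theta_ 3 = pi / 6 :> R.
Proof. by rewrite /theta_ -natrM. Qed.

Lemma L_3 : L_ 3 = 4 * pi :> R.
Proof. by rewrite /L_ theta_3 sin_pi6 invrK; ring. Qed.

Lemma jbound_3 : jbound (L_ 3) = pi / 6 + Num.sqrt 3 - 2 :> R.
Proof. by rewrite jbound_L// theta_3 sin_pi6 cos_pi6 invrK; field. Qed.

Lemma jbound_tan n : (0 < n)%N ->
  jbound (L_ n) = pi / (2 * n%:R) - tan (pi / (4 * n%:R)) :> R.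
Proof.
move=> n0; rewrite /jbound theta_L// /theta_; congr (_ - tan _).
have : n%:R != 0 :> R by rewrite pnatr_eq0 -lt0n.
by move: (@pi R) => p h; field.
Qed.

Lemma inf_avg_dist_L n : (0 < n)%N -> inf_avg_dist (L_ n) = jbound (L_ n) :> R.
Proof.
(* The choice [k = 1] is coprime to every [n], including [n = 1]. *)
move=> n0; have [k kn] : exists k, coprime k n by exists 1%N; rewrite coprime1n.
have [scc E] := @rope_curve R n k n0 kn.
apply/eqP; rewrite eq_le -{1}E ge_inf//=.
- apply: lb_le_inf; first by exists (avg_dist (rope n k)), (rope n k).
  by move=> _ [C CL <-]; have [] := avg_dist_ge_jbound n0 CL (lexx _).
- exists (jbound (L_ n)) => _ [C CL <-].
  by have [] := avg_dist_ge_jbound n0 CL (lexx _).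
by exists (rope n k).
Qed.
End special_values.

(** * The six-arc curve as a reparametrized rope *)

Section six_arcs.
Context {R : realType}.
Local Notation pi := (@pi R).

Lemma simple_closed_param_comp (a b c d : R) (g h : R -> 'rV[R]_3) (r : R -> R) C :
  simple_closed_param a b g C -> continuous g -> c < d -> continuous r ->
  {homo r : x y / x < y} -> r c = a -> r d = b ->
  (forall s, c <= s <= d -> h s = g (r s)) -> simple_closed_param c d h C.
Proof.
move=> [ab _ gab ginj gC] cg cd cr rinc rc rd hE.
have rle := le_mono rinc; have rlt := leW_mono rle.
have cE : c <= c <= d by rewrite lexx ltW.
have dE : c <= d <= d by rewrite lexx ltW.
split => //.
- apply: (@subspace_eq_continuous _ _ _ (g \o r)).
    by move=> s; rewrite inE/= in_itv/= => /hE /= <-.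
  by apply: continuous_subspaceT => s; apply: continuous_comp; [exact: cr|exact: cg].
- by rewrite !hE// rc rd.
- have inr s : s \in `[c, d[ -> r s \in `[a, b[.
    by rewrite !in_itv/= -{1}rc -rd rle rlt.
  move=> s t si ti; have [si' ti'] := (inr _ si, inr _ ti).
  move: si ti; rewrite !in_itv/= => /andP[s1 s2] /andP[t1 t2].
  rewrite !hE ?s1 ?t1 ?ltW// => /(ginj _ _ si' ti'); exact: (inc_inj rle).
rewrite -gC; apply/seteqP; split => [_ [s /= si <-]|_ [t /= ti <-]].
  move: si; rewrite in_itv/= => si; exists (r s); last by rewrite hE.
  by rewrite /= in_itv/= -{1}rc -rd !rle.
have [||s] := @IVT R r c d t (ltW cd).
- exact/continuous_subspaceT.
- move: ti; rewrite in_itv/= rc rd => /andP[t1 t2].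
  by rewrite ge_min t1/= le_max t2 orbT.
rewrite in_itv/= => si <-; exists s; first by rewrite /= in_itv.
by rewrite hE.
Qed.

Lemma half_latitudeE b (u f t s0 c0 : R) : pi * f = t -> sin u = s0 -> cos u = c0 ->
  half_latitude b u f = vec3 ((-1) ^+ b * s0 * cos t) ((-1) ^+ b * `|s0| * sin t) c0.
Proof. by rewrite /half_latitude => -> -> ->. Qed.

Lemma Qsix_rot_y : Qsix = rot_y (2 * 1%:R * theta_ 3) :> ('rV[R]_3 -> 'rV[R]_3).
Proof.
apply/funext => x; rewrite /Qsix /rot_y theta_3.
have -> : 2 * 1 * (pi / 6) = pi / 3 by move: pi => p; field.
rewrite sin_pi3 cos_pi3; apply: tr_inj; rewrite !tr_vec3; congr (_, _, _); ring.
Qed.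

(* The pieces of [rope_path 3 1] have domains of length 1, whereas [six_arc] runs through
   the arcs of radius 1/2 in half the time needed for the arcs of radius 1. *)
Definition six_arc_time (s : R) : R :=
  pi^-1 * (s + Num.min s (pi / 2) +
    (Num.max (3 * pi / 2) (Num.min (5 * pi / 2) s) - 3 * pi / 2) +
    (Num.max (7 * pi / 2) s - 7 * pi / 2)).

Lemma sinNpi (x : R) : sin (pi - x) = sin x /\ cos (pi - x) = - cos x.
Proof. by rewrite sinB cosB sinpi cospi; split; ring. Qed.

(** The six pieces have angles [(2 q + 1) pi / 6]. Their cosines give the sequence [c0], [c1], [c2],
    [c2], [c1], [c0]; from [q = 3] on the sine is negative, which reverses the direction in which
    the arcs are traversed. *)
Lemma six_arcE (s : R) : 0 <= s <= 4 * pi -> six_arc s = rope_path 3 1 (six_arc_time s).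
Proof.
have pi0 := pi_gt0 R; have pin := lt0r_neq0 pi0.
have [sp cp] := (@sin_pi6 R, @cos_pi6 R).
have path (q : nat) (t r : R) : (q < 6)%N -> 0 <= t <= pi -> pi * r = q%:R * pi + t ->
    rope_path 3 1 r = rope_piece 3 1 q (t / pi).
  move=> q6 /andP[t0 t1] E; rewrite -rope_pathE//; last first.
    by rewrite divr_ge0 ?(ltW pi0)//= ler_pdivrMr// mul1r.
  congr (rope_path _ _ _); apply: (mulfI pin); rewrite E.
  by move: pi pin => p pn; field.
have tm x : pi * (pi^-1 * x) = x by rewrite mulrA divff// mul1r.
have tE (t : R) : pi * (t / pi) = t by rewrite mulrCA divff// mulr1.
have ang q : rope_angle 3 1 q = (2 * q + 1)%:R * (pi / 6) by rewrite /rope_angle mul1n theta_3.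
have n12 : `|2^-1| = 2^-1 :> R by rewrite ger0_norm.
move=> /andP[s0 s4]; rewrite /six_arc.
have [s1|s1] := leP s (pi / 2).
  rewrite (path 0%N (2 * s)) //; first last.
  - rewrite /six_arc_time tm min_l// min_r; last lra.
    rewrite max_l; last lra. rewrite max_l; last lra. ring.
  - apply/andP; split; lra.
  rewrite /rope_piece/= (half_latitudeE _ (tE _) (s0 := 2^-1) (c0 := Num.sqrt 3 / 2)) ?ang ?mul1r//.
  by rewrite n12.
have [s2|s2] := leP s (3 * pi / 2).
  rewrite (path 1%N (s - pi / 2)) //; first last.
  - rewrite /six_arc_time tm min_r; last lra. rewrite min_r; last lra.
    rewrite max_l; last lra. rewrite max_l; last lra. by rewrite mul1r; field.
  - apply/andP; split; lra.
  have a : rope_angle 3 1 1 = pi / 2 by rewrite ang; move: pi => p; field.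
  rewrite /rope_piece/= (half_latitudeE _ (tE _) (s0 := 1) (c0 := 0)); first last.
  - by rewrite a cos_pihalf.
  - by rewrite a sin_pihalf.
  rewrite Qsix_rot_y; congr rot_y; rewrite /c1 normr1 !mulr1 expr1 !mulN1r -cosDpi -sinDpi.
  have -> : s - 3 * pi / 2 = s - pi / 2 + pi - pi *+ 2 by move: pi => p; rewrite -mulr_natr; field.
  by rewrite -[in LHS](cosD2pi) -[in LHS](sinD2pi) subrK.
have [s3|s3] := leP s (2 * pi).
  rewrite (path 2%N (2 * s - 3 * pi)) //; first last.
  - rewrite /six_arc_time tm min_r; last lra. rewrite min_r; last lra.
    rewrite max_r; last lra. rewrite max_l; last lra. by field.
  - apply/andP; split; lra.
  have a : rope_angle 3 1 2 = pi - pi / 6 by rewrite ang; move: pi => p; field.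
  rewrite /rope_piece/= (half_latitudeE _ (tE _) (s0 := 2^-1) (c0 := - (Num.sqrt 3 / 2))); first last.
  - by rewrite a (sinNpi _).2 cp.
  - by rewrite a (sinNpi _).1 sp.
  by rewrite n12 !mul1r.
have [s5|s5] := leP s (5 * pi / 2).
  rewrite (path 3%N (2 * s - 4 * pi)) //; first last.
  - rewrite /six_arc_time tm min_r; last lra. rewrite min_r; last lra.
    rewrite max_r; last lra. rewrite max_l; last lra. by field.
  - apply/andP; split; lra.
  have a : rope_angle 3 1 3 = pi / 6 + pi by rewrite ang; move: pi => p; field.
  rewrite /rope_piece/= (half_latitudeE _ (tE _) (s0 := - 2^-1) (c0 := - (Num.sqrt 3 / 2))); first last.
  - by rewrite a cosDpi cp.
  - by rewrite a sinDpi sp.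
  rewrite Qsix_rot_y; congr rot_y; rewrite /c2 normrN n12 expr1 -[2 * s - _]opprB sinN cosN.
  by rewrite !mulN1r opprK !mulrN mulNr opprK.
have [s6|s6] := leP s (7 * pi / 2).
  rewrite (path 4%N (s - 5 * pi / 2)) //; first last.
  - rewrite /six_arc_time tm min_r; last lra. rewrite min_l; last lra.
    rewrite max_r; last lra. rewrite max_l; last lra. by field.
  - apply/andP; split; lra.
  have a : rope_angle 3 1 4 = pi / 2 + pi by rewrite ang; move: pi => p; field.
  rewrite /rope_piece/= (half_latitudeE _ (tE _) (s0 := - 1) (c0 := 0)); first last.
  - by rewrite a cosDpi cos_pihalf oppr0.
  - by rewrite a sinDpi sin_pihalf.
  rewrite /c1; have -> : 7 * pi / 2 - s = pi - (s - 5 * pi / 2) by move: pi => p; field.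
  by rewrite (sinNpi _).1 (sinNpi _).2 normrN1 !mul1r mulN1r.
rewrite (path 5%N (2 * s - 7 * pi)) //; first last.
- rewrite /six_arc_time tm min_r; last lra. rewrite min_l; last lra.
  rewrite max_r; last lra. rewrite max_r; last lra. by field.
- apply/andP; split; lra.
have a : rope_angle 3 1 5 = - (pi / 6) + pi *+ 2 by rewrite ang -[pi *+ 2]mulr_natr; move: pi => p; field.
rewrite /rope_piece/= (half_latitudeE _ (tE _) (s0 := - 2^-1) (c0 := Num.sqrt 3 / 2)); first last.
- by rewrite a cosD2pi cosN cp.
- by rewrite a sinD2pi sinN sp.
rewrite Qsix_rot_y; congr rot_y; rewrite /Defs.c0 normrN n12 expr1 -[2 * s - _]opprB sinN cosN.
by rewrite !mulN1r opprK !mulrN mulNr opprK.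
Qed.

Lemma six_arc_param : simple_closed_param 0 (4 * pi) (@six_arc R) (rope 3 1).
Proof.
have pi0 := pi_gt0 R; have pin := lt0r_neq0 pi0.
apply: (simple_closed_param_comp (r := six_arc_time) (rope_param _ _)) six_arcE => //.
- exact: continuous_rope_path.
- by rewrite mulr_gt0.
- by rewrite /six_arc_time; ctn.
(* The summand [s] increases strictly and the clamped summands never decrease. *)
- move=> s t st; rewrite /six_arc_time ltr_pM2l ?invr_gt0//.
  rewrite -!addrA ltr_leD// !lerD// ?lerB//.
  + by rewrite le_min !ge_min (ltW st) lexx orbT.
  + by rewrite ge_max le_max lexx/= le_max le_min !ge_min lexx (ltW st) !orbT.
  + by rewrite ge_max !le_max lexx (ltW st) orbT.
- rewrite /six_arc_time min_l; last lra. rewrite min_r; last lra.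
  rewrite max_l; last lra. rewrite max_l; last lra. by rewrite !subrr !addr0 mulr0.
rewrite /six_arc_time min_r; last lra. rewrite min_l; last lra.
rewrite max_r; last lra. rewrite max_r; last lra. rewrite natrM.
by move: pi pin => p pn; field.
Qed.
End six_arcs.

(** * Mirror images of ropes *)

Section mirror.
Context {R : realType}.
Implicit Types (x y : 'rV[R]_3).

Definition flip_x x : 'rV[R]_3 := vec3 (- xcoord x) (ycoord x) (zcoord x).

Lemma tr_flip_x x : tr (flip_x x) = (- xcoord x, ycoord x, zcoord x).
Proof. by rewrite tr_vec3. Qed.

Lemma flip_xK : involutive flip_x.
Proof.
move=> x; apply: tr_inj; rewrite tr_flip_x.
have := tr_flip_x x; rewrite {1}/tr => -[-> -> ->].
by rewrite opprK.
Qed.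

Lemma reflection_x x : reflection (vec3 1 0 0) x = flip_x x.
Proof.
apply: tr_inj; rewrite tr_flip_x /reflection dotE tr_vec3 /dot3/= !mulr0 !addr0 mulr1.
have : tr (vec3 1 0 0 : 'rV[R]_3) = (1, 0, 0) by rewrite tr_vec3.
rewrite /tr => -[]; rewrite /xcoord /ycoord /zcoord !mxE => -> -> ->.
by rewrite /= !mulr0 !subr0; congr (_, _, _); ring.
Qed.

(* [flip_x] preserves the halves of the latitude circles and conjugates [rot_y f] to
   [rot_y (- f)]; since [rot_y pi] exchanges colatitudes [p] and [pi - p], the rotation
   angles [f] and [pi - f] give mirror images. *)
Lemma rope_flip_x_sub n k : (0 < n)%N -> (k <= n)%N ->
  [set flip_x x | x in rope n k] `<=` rope n (n - k).
Proof.
move=> n0 kn _ [x [i /= iN xi] <-].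
have fS y : sphere y -> sphere (flip_x y).
  by move=> /sphereP yS; apply/sphereP; move: yS; rewrite tr_flip_x /dot3/= mulrNN.
have /andP[c1 c2] := @odd_theta_itv R n _ iN.
move: xi; rewrite latitudeE ?(ltW c1) ?(ltW c2)//= => -[[[xS xz] y0]|[y [[yS yz] y0] <-]].
  have := tr_flip_x x; rewrite {1}/tr => -[_ yE zE].
  exists i => //; rewrite latitudeE ?(ltW c1) ?(ltW c2)//; left; rewrite /= yE zE.
  by split => //; split => //; exact: fS.
have iN' : (n.-1 - i < n)%N by lia.
have /andP[d1 d2] := @odd_theta_itv R n _ iN'.
exists (n.-1 - i)%N => //; rewrite latitudeE ?(ltW d1) ?(ltW d2)//; right.
exists (vec3 (xcoord y) (ycoord y) (- zcoord y)).
  have := tr_vec3 (xcoord y) (ycoord y) (- zcoord y); rewrite {1}/tr => -[_ yE zE].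
  split; last by rewrite /= yE.
  split; first by apply/sphereP; move/sphereP: yS; rewrite tr_vec3 /dot3/= mulrNN.
  rewrite zE yz.
  have -> : (2 * (n.-1 - i) + 1)%:R * theta_ n = - ((2 * i + 1)%:R * theta_ n) + pi :> R.
    rewrite -(@theta_nat R n n0) addrC -mulrBl -natrM -natrB; last lia.
    by congr (_%:R * _); lia.
  by rewrite cosDpi cosN.
apply: tr_inj; rewrite tr_flip_x tr_rot_y.
have := tr_rot_y (2 * k%:R * theta_ n) y; rewrite {1}/tr => -[-> -> ->].
have := tr_vec3 (xcoord y) (ycoord y) (- zcoord y); rewrite {1}/tr => -[-> -> ->].
have -> : 2 * (n - k)%:R * theta_ n = - (2 * k%:R * theta_ n) + pi :> R.
  by rewrite -(@theta_nat R n n0) natrB//; ring.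
by rewrite cosDpi sinDpi cosN sinN; congr (_, _, _); ring.
Qed.

(** The inclusion applied to [n - k] gives the converse, since [n - (n - k) = k] and [flip_x] is an
    involution. *)
Lemma rope_flip_x n k : (0 < n)%N -> (k <= n)%N ->
  rope n (n - k) = [set flip_x x | x in rope n k].
Proof.
move=> n0 kn; apply/seteqP; split; last exact: rope_flip_x_sub.
move=> x xr; exists (flip_x x); last exact: flip_xK.
rewrite -[X in rope n X](subKn kn); apply: rope_flip_x_sub => //; first exact: leq_subr.
by exists x.
Qed.

Lemma rope_mirror_image n k : (0 < n)%N -> (k <= n)%N ->
  mirror_image (rope n k) (rope n (n - k) : set 'rV[R]_3).
Proof.
move=> n0 kn; exists (vec3 1 0 0), 1%:M; split.
- by apply/sphereP; rewrite tr_vec3 /dot3/= !mulr0 !addr0 mulr1.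
- by split; [rewrite trmx1 mulmx1|rewrite det1].
rewrite rope_flip_x//; congr image; apply/funext => x.
by rewrite mulmx1 reflection_x.
Qed.
End mirror.

Theorem theorem2 (R : realType) :
  (forall n : nat, (0 < n)%N ->
    [/\ jbound (L_ n) = pi / (2 * n%:R) - tan (pi / (4 * n%:R)) :> R,
        forall (C : set 'rV[R]_3) (L : R),
          simple_closed_curve C L -> L <= L_ n ->
          jbound (L_ n) <= avg_dist C /\
          (avg_dist C = jbound (L_ n) -> L = L_ n),
        forall k : nat, (k < n)%N -> coprime k n ->
          simple_closed_curve (rope n k) (L_ n : R) /\
          avg_dist (rope n k) = jbound (L_ n) :> R &
        inf_avg_dist (L_ n) = jbound (L_ n) :> R]) /\
  [/\ L_ 3 = 4 * pi :> R,
      jbound (L_ 3) = pi / 6 + Num.sqrt 3 - 2 :> R,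
      forall C : set 'rV[R]_3, simple_closed_curve C (4 * pi) ->
        pi / 6 + Num.sqrt 3 - 2 <= avg_dist C,
      [/\ simple_closed_curve (rope 3 1) (4 * pi : R),
          avg_dist (rope 3 1) = pi / 6 + Num.sqrt 3 - 2 :> R &
          simple_closed_param 0 (4 * pi) (@six_arc R) (rope 3 1)] &
      [/\ simple_closed_curve (rope 3 2) (4 * pi : R),
          avg_dist (rope 3 2) = pi / 6 + Num.sqrt 3 - 2 :> R &
          mirror_image (rope 3 1) (rope 3 2 : set 'rV[R]_3)]].
Proof.
split=> [n n0|].
  split; first exact: jbound_tan.
  - by move=> C L; exact: avg_dist_ge_jbound.
  - by move=> k _; exact: rope_curve.
  - exact: inf_avg_dist_L.
have [c1 d1] := @rope_curve R 3 1 isT isT; have [c2 d2] := @rope_curve R 3 2 isT isT.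
rewrite L_3 in c1 c2; rewrite jbound_3 in d1 d2.
split; [exact: L_3|exact: jbound_3| |by split => //; exact: six_arc_param|].
  move=> C; rewrite -L_3 -jbound_3 => CL.
  by have [] := @avg_dist_ge_jbound R 3 C _ isT CL (lexx _).
by split => //; exact: (@rope_mirror_image R 3 1).
Qed.
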